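(* Let $L\subseteq\overline{\mathbb Q}$ be a subfield. Both the de Rham--Betti group $G_{\mathrm{dRB}}$ and the de Rham--Betti torsor of periods $\Omega^{\mathrm{dRB}}$ associated with $\mathscr C_{\mathrm{dRB},\overline{\mathbb Q},L}$ are connected. In particular, for any de Rham--Betti object $M$ over $\overline{\mathbb Q}$ with $L$-coefficients, both $G_{\mathrm{dRB}}(M)$ and $\Omega^{\mathrm{dRB}}_M$ are connected.
   Context: $\overline{\mathbb Q}$ is the algebraic closure of $\mathbb Q$ in $\mathbb C$. The category $\mathscr C_{\mathrm{dRB},\overline{\mathbb Q},L}$ of de Rham--Betti objects over $\overline{\mathbb Q}$ with $L$-coefficients has objects the triples $M=(M_{\mathrm{dR}},M_{\mathrm B},c_M)$ with $M_{\mathrm{dR}}$ a finite-dimensional $\overline{\mathbb Q}$-vector space, $M_{\mathrm B}$ a finite-dimensional $L$-vector space and $c_M:M_{\mathrm{dR}}\otimes_{\overline{\mathbb Q}}\mathbb C\to M_{\mathrm B}\otimes_L\mathbb C$ a $\mathbb C$-linear isomorphism; morphisms are pairs of a $\overline{\mathbb Q}$-linear map and an $L$-linear map whose complexifications are compatible with the comparison isomorphisms. With componentwise tensor product and unit $(\overline{\mathbb Q},L,\mathrm{id})$ it is a Tannakian category over $L$, neutralized by $\omega_{\mathrm B}:M\mapsto M_{\mathrm B}$; also $\omega_{\mathrm{dR}}:M\mapsto M_{\mathrm{dR}}$ is a fiber functor over $\overline{\mathbb Q}$. $G_{\mathrm{dRB}}=\mathrm{Aut}^\otimes(\omega_{\mathrm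 B})$ (an affine group scheme over $L$) and $\Omega^{\mathrm{dRB}}=\mathrm{Iso}^\otimes(\omega_{\mathrm{dR}},\omega_{\mathrm B}\otimes_L\overline{\mathbb Q})$ (a torsor under $(G_{\mathrm{dRB}})_{\overline{\mathbb Q}}$). For an object $M$, with $\langle M\rangle$ the Tannakian subcategory generated by $M$, $G_{\mathrm{dRB}}(M)=\mathrm{Aut}^\otimes(\omega_{\mathrm B}|_{\langle M\rangle})$ and $\Omega^{\mathrm{dRB}}_M=\mathrm{Iso}^\otimes(\omega_{\mathrm{dR}}|_{\langle M\rangle},\omega_{\mathrm B}|_{\langle M\rangle}\otimes_L\overline{\mathbb Q})$. *)

(* Defs.v *)
(* Mathematical Components, with MathComp-Analysis for the reals and the
   topology of the prime spectrum. *)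
From HB Require Import structures.
From mathcomp Require Import all_boot all_order all_algebra ring_quotient.
From mathcomp Require Import complex.
From mathcomp Require Import boolp classical_sets reals topology_structure.
From mathcomp Require Import connected.

Set Implicit Arguments.
Unset Strict Implicit.
Unset Printing Implicit Defensive.

Import GRing.Theory.
Import VectorInternalTheory.

Local Open Scope ring_scope.

(* [A -> bool] rather than [pred A] or the bundled [prime_idealr A], whose
   universes are too large for sets of points. *)
Record Spec (A : comNzRingType) := Point {
  ideal_of : A -> bool;
  ideal_closed : idealr_closed ideal_of;
  ideal_prime : prime_idealr_closed ideal_of }.

HB.instance Definition _ (A : comNzRingType) := gen_eqMixin (Spec A).
HB.instance Definition _ (A : comNzRingType) := gen_choiceMixin (Spec A).

Section Zariski.
Variable A : comNzRingType.
Local Open Scope classical_set_scope.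

Definition vanishing (S : set A) : set (Spec A) :=
  [set p | forall a, S a -> a \in ideal_of p].

Definition zariski_open (U : set (Spec A)) : Prop :=
  exists S : set A, U = ~` vanishing S.

Lemma ideal_ofM (p : Spec A) a b :
  (a * b \in ideal_of p) = (a \in ideal_of p) || (b \in ideal_of p).
Proof.
apply/idP/idP; first exact: ideal_prime.
have [p0 _ pM] := ideal_closed p.
move=> /orP[pa|pb]; last by rewrite -[a * b]addr0 pM.
by rewrite mulrC -[b * a]addr0 pM.
Qed.

Lemma zariski_openT : zariski_open setT.
Proof.
exists setT; apply/seteqP; split=> // p _ pT.
by have [_ /negP + _] := ideal_closed p; apply; apply: pT.
Qed.

Lemma zariski_openI : setI_closed zariski_open.
Proof.
move=> _ _ [S ->] [T ->].
exists [set c | exists a b, [/\ S a, T b & c = a * b]].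
apply/seteqP; split=> p /=.
  move=> [/existsNP[a /not_implyP[Sa pa]] /existsNP[b /not_implyP[Tb pb]]].
  move=> /(_ (a * b)) h; have {h} : a * b \in ideal_of p.
    by apply: h; exists a, b.
  by rewrite ideal_ofM => /orP[].
move=> /existsNP[c /not_implyP[[a [b [Sa Tb ->]]] pab]].
split=> h; apply: pab; rewrite ideal_ofM; apply/orP.
  by left; apply: h.
by right; apply: h.
Qed.

Lemma zariski_open_bigU (I : Type) (f : I -> set (Spec A)) :
  (forall i, zariski_open (f i)) -> zariski_open (\bigcup_i f i).
Proof.
move=> /choice[S fS]; exists (\bigcup_i S i).
apply/seteqP; split=> p.
  by move=> [i _]; rewrite fS => h h'; apply: h => a Sa; apply: h'; exists i.
move=> /existsNP[a /not_implyP[[i _ Sa] pa]].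
by exists i => //; rewrite fS => /(_ a Sa).
Qed.

HB.instance Definition _ := isOpenTopological.Build (Spec A)
  zariski_openT zariski_openI zariski_open_bigU.

End Zariski.

(* As usual for schemes, a connected space is required to be nonempty. *)
Definition connected_spec (A : comNzRingType) : Prop :=
  ([set: Spec A] !=set0)%classic /\ connected [set: Spec A]%classic.

(* The algebraic closure of the rationals in the complex numbers R[i]. *)

Section AlgebraicNumbers.
Variable R : realType.

Definition algebraic_number : {pred R[i]} :=
  [pred z | `[< algebraicOver (ratr : rat -> R[i]) z >]].

Lemma algebraic_number_divring_closed : divring_closed algebraic_number.
Proof.
split=> [|x y|x y]; rewrite !inE.
- exact: algebraic1.
- exact: algebraic_sub.
- exact: algebraic_div.
Qed.

HB.instance Definition _ := GRing.isDivringClosed.Build R[i] algebraic_number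
  algebraic_number_divring_closed.

Record Qbar := MkQbar {
  complex_of : R[i];
  complex_ofP : complex_of \in algebraic_number }.

HB.instance Definition _ := [isSub for complex_of].
HB.instance Definition _ := [Choice of Qbar by <:].
HB.instance Definition _ := [SubChoice_isSubIntegralDomain of Qbar by <:].
HB.instance Definition _ := [SubIntegralDomain_isSubField of Qbar by <:].

End AlgebraicNumbers.

(* Functors of points of k-schemes. [comAlgType] excludes the zero algebra,
   over which every scheme has exactly one point. *)

Record kfunctor (k : fieldType) := KFunctor {
  pts :> comAlgType k -> Type;
  pmap : forall A B : comAlgType k, {lrmorphism A -> B} -> pts A -> pts B }.

Definition represents (k : fieldType) (F : kfunctor k) (A : comAlgType k)
    (u : F A) : Prop :=
  forall (B : comAlgType k) (x : F B),
    exists f : {lrmorphism A -> B},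
      pmap f u = x /\ forall g : {lrmorphism A -> B}, pmap g u = x -> g =1 f.

(* F is the functor of points of an affine scheme, and that scheme, which is
   unique up to isomorphism, is connected. *)
Definition connected_affine (k : fieldType) (F : kfunctor k) : Prop :=
  exists (A : comAlgType k) (u : F A), represents u /\ connected_spec A.

(* Extension of scalars of V along s : K -> R, with coordinates taken in the
   basis [vb V] underlying the [vectType] structure of V: elements of V (x) R
   are row vectors and R-linear maps are matrices acting on the right. *)

Section ScalarExtension.
Variables (K : fieldType) (R : comNzRingType) (s : {rmorphism K -> R}).
Implicit Types U V W : vectType K.

Definition vb V (i : 'I_(dim V)) : V := r2v (delta_mx 0 i).

(* v (x) 1 *)
Definition sext V (v : V) : 'rV[R]_(dim V) := map_mx s (v2r v).

(* f (x) R *)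
Definition sext_hom V W (f : 'Hom(V, W)) : 'M[R]_(dim V, dim W) :=
  \matrix_(i < dim V) sext (f (vb i)).

(* the R-linear extension of a map g from V to a free R-module *)
Definition sext_lift V n (g : V -> 'rV[R]_n) : 'M[R]_(dim V, n) :=
  \matrix_(i < dim V) g (vb i).

(* the R-bilinear extension of a map b : V -> W -> U *)
Definition sext_bilin V W U (b : V -> W -> U)
    (x : 'rV[R]_(dim V)) (y : 'rV[R]_(dim W)) : 'rV[R]_(dim U) :=
  \sum_i \sum_j (x 0 i * y 0 j) *: sext (b (vb i) (vb j)).

End ScalarExtension.

(* V (x)_K W, whose pure tensors are the matrices of rank at most 1. *)
Definition tensor (K : fieldType) (V W : vectType K) : vectType K :=
  'M[K]_(dim V, dim W).

Definition pure (K : fieldType) (V W : vectType K) (v : V) (w : W) :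
    tensor V W :=
  (v2r v)^T *m v2r w.

Definition mxiso (R : comNzRingType) (m n : nat) (c : 'M[R]_(m, n)) : Prop :=
  exists d : 'M[R]_(n, m), c *m d = 1%:M /\ d *m c = 1%:M.

Section ScalarExtensionTheory.
Variables (K : fieldType) (R : comNzRingType) (s : {rmorphism K -> R}).
Implicit Types U V W : vectType K.

Lemma sext_vb V (i : 'I_(dim V)) : sext s (vb i) = delta_mx 0 i.
Proof. by rewrite /sext /vb r2vK map_delta_mx. Qed.

Lemma vb_sum V (v : V) : v = \sum_i v2r v 0 i *: vb i.
Proof.
apply: v2r_inj; rewrite linear_sum {1}[v2r v]row_sum_delta.
by apply: eq_bigr => i _; rewrite linearZ /vb /= r2vK.
Qed.

(* The universal property of V (x) R, for free R-modules. *)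
Lemma sext_liftE V n (g : V -> 'rV[R]_n) :
  (forall a v w, g (a *: v + w) = s a *: g v + g w) ->
  forall v, sext s v *m sext_lift g = g v.
Proof.
move=> glin v.
have g0 : g 0 = 0.
  have := glin 1 0 0; rewrite scaler0 addr0 rmorph1 scale1r.
  by rewrite -{1}[g 0]addr0 => /addrI.
have gsum (I : Type) (r : seq I) (a : I -> K) (f : I -> V) :
    g (\sum_(i <- r) a i *: f i) = \sum_(i <- r) s (a i) *: g (f i).
  by elim: r => [|i r IH]; rewrite ?big_nil // !big_cons glin IH.
rewrite [in RHS](vb_sum v) gsum mulmx_sum_row.
by apply: eq_bigr => i _; rewrite rowK mxE.
Qed.

Lemma sext_ext V n (c d : 'M[R]_(dim V, n)) :
  (forall v : V, sext s v *m c = sext s v *m d) -> c = d.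
Proof.
by move=> h; apply/row_matrixP=> i; rewrite !rowE -sext_vb h.
Qed.

Lemma sext_lin V a (v w : V) :
  sext s (a *: v + w) = s a *: sext s v + sext s w.
Proof. by rewrite /sext linearP map_mxD map_mxZ. Qed.

Lemma sext_homE V W (f : 'Hom(V, W)) v :
  sext s v *m sext_hom s f = sext s (f v).
Proof.
rewrite -[sext_hom s f]/(sext_lift (fun u => sext s (f u))).
by apply: sext_liftE => a x y; rewrite linearP sext_lin.
Qed.

Lemma vb_pure V W (i : 'I_(dim V)) (j : 'I_(dim W)) :
  pure (vb i) (vb j) = delta_mx i j :> 'M_(_, _).
Proof. by rewrite /pure /vb !r2vK trmx_delta mul_delta_mx. Qed.

End ScalarExtensionTheory.


(* For R-linear maps c : V (x)_K1 R -> V' (x)_K2 R and d : W (x)_K1 R ->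
   W' (x)_K2 R, the map c (x)_R d, from (V (x)_K1 W) (x)_K1 R to
   (V' (x)_K2 W') (x)_K2 R; see [sext_tensorE]. *)

Section TensorMap.
Variables (R : comNzRingType).

Definition sext_tensor (K1 K2 : fieldType) (s1 : {rmorphism K1 -> R})
    (s2 : {rmorphism K2 -> R}) (V W : vectType K1) (V' W' : vectType K2)
    (c : 'M[R]_(dim V, dim V')) (d : 'M[R]_(dim W, dim W')) :
    'M[R]_(dim (tensor V W), dim (tensor V' W')) :=
  sext_lift (fun t : tensor V W => \sum_i \sum_j
    s1 (t i j) *: sext_bilin s2 (@pure _ V' W') (row i c) (row j d)).

Lemma sext_bilin_linl (K : fieldType) (s : {rmorphism K -> R})
    (V W U : vectType K) (b : V -> W -> U) y a x x' :
  sext_bilin s b (a *: x + x') y = a *: sext_bilin s b x y + sext_bilin s b x' y.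
Proof.
rewrite /sext_bilin scaler_sumr -big_split; apply: eq_bigr => i _ /=.
rewrite scaler_sumr -big_split; apply: eq_bigr => j _ /=.
by rewrite !mxE scalerA mulrDl scalerDl mulrA.
Qed.

Lemma sext_bilin_linr (K : fieldType) (s : {rmorphism K -> R})
    (V W U : vectType K) (b : V -> W -> U) x a y y' :
  sext_bilin s b x (a *: y + y') = a *: sext_bilin s b x y + sext_bilin s b x y'.
Proof.
rewrite /sext_bilin scaler_sumr -big_split; apply: eq_bigr => i _ /=.
rewrite scaler_sumr -big_split; apply: eq_bigr => j _ /=.
by rewrite !mxE scalerA mulrDr scalerDl mulrCA.
Qed.

Lemma sext_bilin_sum (K : fieldType) (s : {rmorphism K -> R})
    (V W U : vectType K) (b : V -> W -> U) m n (x : 'I_m -> R) (y : 'I_n -> R)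
    (u : 'I_m -> 'rV_(dim V)) (v : 'I_n -> 'rV_(dim W)) :
  sext_bilin s b (\sum_i x i *: u i) (\sum_j y j *: v j)
  = \sum_i \sum_j (x i * y j) *: sext_bilin s b (u i) (v j).
Proof.
have b0l z : sext_bilin s b 0 z = 0.
  rewrite /sext_bilin !big1 // => i _; rewrite big1 // => j _.
  by rewrite mxE mul0r scale0r.
have b0r z : sext_bilin s b z 0 = 0.
  rewrite /sext_bilin !big1 // => i _; rewrite big1 // => j _.
  by rewrite mxE mulr0 scale0r.
elim: (index_enum 'I_m) => [|i r IH]; first by rewrite !big_nil b0l.
rewrite !big_cons sext_bilin_linl IH; congr (_ + _).
elim: (index_enum 'I_n) => [|j q IHq]; first by rewrite !big_nil b0r scaler0.
by rewrite !big_cons sext_bilin_linr scalerDr IHq scalerA.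
Qed.

Lemma sext_bilin_delta (K : fieldType) (s : {rmorphism K -> R})
    (V W U : vectType K) (b : V -> W -> U) i j :
  sext_bilin s b (delta_mx 0 i) (delta_mx 0 j) = sext s (b (vb i) (vb j)).
Proof.
rewrite /sext_bilin (bigD1 i) // (bigD1 j) //= !mxE !eqxx mulr1 scale1r.
rewrite big1 => [|j' jj']; last by rewrite !mxE (negPf jj') mulr0 scale0r.
rewrite big1 ?addr0 // => i' ii'; rewrite big1 // => j' _.
by rewrite !mxE (negPf ii') mul0r scale0r.
Qed.

Lemma sext_tensorE (K1 K2 : fieldType) (s1 : {rmorphism K1 -> R})
    (s2 : {rmorphism K2 -> R}) (V W : vectType K1) (V' W' : vectType K2)
    (c : 'M[R]_(dim V, dim V')) (d : 'M[R]_(dim W, dim W')) x y :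
  sext_bilin s1 (@pure _ V W) x y *m sext_tensor s1 s2 c d
  = sext_bilin s2 (@pure _ V' W') (x *m c) (y *m d).
Proof.
rewrite (mulmx_sum_row x c) (mulmx_sum_row y d) sext_bilin_sum mulmx_suml.
apply: eq_bigr => i _; rewrite mulmx_suml; apply: eq_bigr => j _.
rewrite -scalemxAl sext_liftE => [|a t t'].
  rewrite vb_pure (bigD1 i) //= (bigD1 j) //= !mxE !eqxx rmorph1 scale1r.
  rewrite big1 => [|j' jj']; last first.
    by rewrite !mxE eqxx (negPf jj') rmorph0 scale0r.
  rewrite big1 ?addr0 // => i' ii'; rewrite big1 // => j' _.
  by rewrite !mxE (negPf ii') rmorph0 scale0r.
rewrite scaler_sumr -big_split; apply: eq_bigr => k _ /=.
rewrite scaler_sumr -big_split; apply: eq_bigr => l _ /=.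
by rewrite !mxE rmorphD rmorphM scalerDl scalerA.
Qed.

Lemma sext_tensorK (K1 K2 : fieldType) (s1 : {rmorphism K1 -> R})
    (s2 : {rmorphism K2 -> R}) (V W : vectType K1) (V' W' : vectType K2)
    (c : 'M[R]_(dim V, dim V')) (d : 'M[R]_(dim W, dim W')) c' d' :
  c *m c' = 1%:M -> d *m d' = 1%:M ->
  sext_tensor s1 s2 c d *m sext_tensor s2 s1 c' d' = 1%:M.
Proof.
move=> cc' dd'; apply: (@sext_ext _ _ s1) => t; rewrite mulmx1.
have -> : sext s1 t = \sum_i \sum_j s1 ((t : 'M_(_, _)) i j) *:
    sext_bilin s1 (@pure _ V W) (delta_mx 0 i) (delta_mx 0 j).
  rewrite [in LHS](matrix_sum_delta (t : 'M_(_, _))).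
  rewrite /sext !linear_sum map_mx_sum; apply: eq_bigr => i _.
  rewrite linear_sum map_mx_sum; apply: eq_bigr => j _.
  by rewrite sext_bilin_delta vb_pure linearZ map_mxZ.
rewrite mulmx_suml; apply: eq_bigr => i _; rewrite mulmx_suml.
apply: eq_bigr => j _; rewrite -scalemxAl mulmxA !sext_tensorE.
by rewrite -!mulmxA cc' dd' !mulmx1.
Qed.

Lemma sext_tensor_iso (K1 K2 : fieldType) (s1 : {rmorphism K1 -> R})
    (s2 : {rmorphism K2 -> R}) (V W : vectType K1) (V' W' : vectType K2)
    (c : 'M[R]_(dim V, dim V')) (d : 'M[R]_(dim W, dim W')) :
  mxiso c -> mxiso d -> mxiso (sext_tensor s1 s2 c d).
Proof.
move=> [c' [cc' c'c]] [d' [dd' d'd]].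
by exists (sext_tensor s2 s1 c' d'); split; apply: sext_tensorK.
Qed.

End TensorMap.

Section DeRhamBetti.
Variables (R : realType) (L : fieldType) (iota : {rmorphism L -> Qbar R}).

Definition QbarC : {rmorphism Qbar R -> R[i]} := val.
Definition LC : {rmorphism L -> R[i]} := val \o iota.

(* [cmp] is the matrix of an isomorphism from dR (x)_Qbar C to B (x)_L C in the
   sense of the comment before [vb]. The field L is a subfield of Qbar through
   the embedding iota. *)

Record dRB := DRB {
  dR : vectType (Qbar R);
  B : vectType L;
  cmp : 'M[R[i]]_(dim dR, dim B);
  cmp_iso : mxiso cmp }.

Record dRB_hom (M N : dRB) := DRBHom {
  hom_dR : 'Hom(dR M, dR N);
  hom_B : 'Hom(B M, B N);
  hom_cmp : sext_hom QbarC hom_dR *m cmp N = cmp M *m sext_hom LC hom_B }.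

(* The identity of C, seen as a map from Qbar (x)_Qbar C to L (x)_L C. *)
Definition unit_cmp : 'M[R[i]]_(dim (Qbar R)^o, dim L^o) :=
  sext_lift (fun x : (Qbar R)^o => QbarC x *: sext LC (1 : L^o)).

Lemma unit_cmp_iso : mxiso unit_cmp.
Proof.
have lin1 (a : Qbar R) (x y : (Qbar R)^o) :
    QbarC (a *: x + y) *: sext LC (1 : L^o)
    = QbarC a *: (QbarC x *: sext LC (1 : L^o)) + QbarC y *: sext LC (1 : L^o).
  by rewrite rmorphD rmorphM scalerDl scalerA.
have lin2 (a : L) (x y : L^o) :
    LC (a *: x + y) *: sext QbarC (1 : (Qbar R)^o)
    = LC a *: (LC x *: sext QbarC (1 : (Qbar R)^o))
      + LC y *: sext QbarC (1 : (Qbar R)^o).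
  by rewrite rmorphD rmorphM scalerDl scalerA.
exists (sext_lift (fun x : L^o => LC x *: sext QbarC (1 : (Qbar R)^o))).
split; [apply: (@sext_ext _ _ QbarC) => x | apply: (@sext_ext _ _ LC) => x].
  rewrite mulmxA mulmx1 sext_liftE // -scalemxAl sext_liftE // rmorph1 scale1r.
  by rewrite /sext -map_mxZ -linearZ /= /GRing.scale /= mulr1.
rewrite mulmxA mulmx1 sext_liftE // -scalemxAl sext_liftE // rmorph1 scale1r.
by rewrite /sext -map_mxZ -linearZ /= /GRing.scale /= mulr1.
Qed.

Definition dRB_unit : dRB := DRB unit_cmp_iso.

Definition dRB_tensor (M N : dRB) : dRB :=
  DRB (sext_tensor_iso QbarC LC (cmp_iso M) (cmp_iso N)).

(* These stand for the full subcategories they span. *)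
Record tensor_subcat := TensorSubcat {
  in_subcat :> dRB -> Prop;
  subcat_unit : in_subcat dRB_unit;
  subcat_tensor : forall M N,
    in_subcat M -> in_subcat N -> in_subcat (dRB_tensor M N) }.

Definition whole_category : tensor_subcat :=
  @TensorSubcat (fun _ => True) I (fun _ _ _ _ => I).

(* i1 and i2 exhibit S as the direct sum of N1 and N2. *)
Definition is_direct_sum (N1 N2 S : dRB)
    (i1 : dRB_hom N1 S) (i2 : dRB_hom N2 S) : Prop :=
  bijective (fun p : dR N1 * dR N2 => hom_dR i1 p.1 + hom_dR i2 p.2) /\
  bijective (fun p : B N1 * B N2 => hom_B i1 p.1 + hom_B i2 p.2).

(* ev exhibits D as the dual of N. *)
Definition is_dual (N D : dRB) (ev : dRB_hom (dRB_tensor D N) dRB_unit) :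
    Prop :=
  bijective (fun x : dR D =>
    linfun (fun y => hom_dR ev (pure x y)) : 'Hom(dR N, (Qbar R)^o)) /\
  bijective (fun x : B D =>
    linfun (fun y => hom_B ev (pure x y)) : 'Hom(B N, L^o)).

Definition is_mono (M N : dRB) (f : dRB_hom M N) : Prop :=
  injective (hom_dR f) /\ injective (hom_B f).

Definition is_epi (M N : dRB) (f : dRB_hom M N) : Prop :=
  (forall y, exists x, hom_dR f x = y) /\ (forall y, exists x, hom_B f x = y).

(* <M>: the smallest full subcategory containing M and stable under the
   tensor operations, direct sums, duals, subobjects and quotients. *)
Inductive generated (M : dRB) : dRB -> Prop :=
| generated_self : generated M M
| generated_unit : generated M dRB_unit
| generated_tensor N1 N2 :
    generated M N1 -> generated M N2 -> generated M (dRB_tensor N1 N2)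
| generated_sum N1 N2 S (i1 : dRB_hom N1 S) (i2 : dRB_hom N2 S) :
    is_direct_sum i1 i2 -> generated M N1 -> generated M N2 -> generated M S
| generated_dual N D (ev : dRB_hom (dRB_tensor D N) dRB_unit) :
    is_dual ev -> generated M N -> generated M D
| generated_sub N N' (f : dRB_hom N' N) :
    is_mono f -> generated M N -> generated M N'
| generated_quot N N' (f : dRB_hom N N') :
    is_epi f -> generated M N -> generated M N'.

Definition generated_subcat (M : dRB) : tensor_subcat :=
  TensorSubcat (generated_unit M) (@generated_tensor M).

(* The data of a tensor functor to finite-dimensional vector spaces over k. *)

Record tensor_functor (k : fieldType) := TensorFunctor {
  fob :> dRB -> vectType k;
  fhom : forall M N, dRB_hom M N -> 'Hom(fob M, fob N);
  (* the bilinear map underlying F(M) (x) F(N) -> F(M (x) N) *)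
  ftensor : forall M N, fob M -> fob N -> fob (dRB_tensor M N);
  (* the image of 1 under k -> F(unit) *)
  funit : fob dRB_unit }.

Definition omega_dR : tensor_functor (Qbar R) :=
  @TensorFunctor _ dR hom_dR (fun M N => @pure _ (dR M) (dR N))
    (1 : (Qbar R)^o).

Definition omega_B : tensor_functor L :=
  @TensorFunctor _ B hom_B (fun M N => @pure _ (B M) (B N)) (1 : L^o).

(* F (x)_k k', where 'rV[k']_(dim (F M)) is F(M) (x)_k k' *)
Definition base_change (k k' : fieldType) (s : {rmorphism k -> k'})
    (F : tensor_functor k) : tensor_functor k' :=
  @TensorFunctor k' (fun M => 'rV[k']_(dim (F M)))
    (fun M N f => linfun (mulmxr (sext_hom s (fhom F f))))
    (fun M N => sext_bilin s (@ftensor _ F M N))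
    (sext s (funit F)).

(* Iso^tensor (F1|P, F2|P) as a functor of points over k: its A-points are the
   A-linear tensor isomorphisms from F1 (x) A to F2 (x) A on P. Compatibility
   with tensor products is A-bilinear, hence it is enough to require it on
   elements v (x) 1 and w (x) 1. *)

Section TensorIso.
Variables (k : fieldType) (P : tensor_subcat) (F1 F2 : tensor_functor k).

Definition family (A : comAlgType k) : Type :=
  forall M, P M -> 'M[A]_(dim (F1 M), dim (F2 M)).

Record is_tensor_iso (A : comAlgType k) (eta : family A) : Prop := {
  tensor_iso_iso M (PM : P M) : mxiso (eta M PM);
  tensor_iso_natural M N (PM : P M) (PN : P N) (f : dRB_hom M N) :
    sext_hom (in_alg A) (fhom F1 f) *m eta N PN
    = eta M PM *m sext_hom (in_alg A) (fhom F2 f);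
  tensor_iso_tensor M N (PM : P M) (PN : P N) (v : F1 M) (w : F1 N) :
    sext (in_alg A) (ftensor v w) *m eta _ (subcat_tensor PM PN)
    = sext_bilin (in_alg A) (@ftensor _ F2 M N)
        (sext (in_alg A) v *m eta M PM) (sext (in_alg A) w *m eta N PN);
  tensor_iso_unit :
    sext (in_alg A) (funit F1) *m eta _ (subcat_unit P)
    = sext (in_alg A) (funit F2) }.

Lemma map_sext (A A' : comAlgType k) (h : {lrmorphism A -> A'})
    (V : vectType k) (v : V) :
  map_mx h (sext (in_alg A) v) = sext (in_alg A') v.
Proof. by apply/rowP=> i; rewrite !mxE rmorph_alg. Qed.

Lemma map_sext_hom (A A' : comAlgType k) (h : {lrmorphism A -> A'})
    (V W : vectType k) (f : 'Hom(V, W)) :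
  map_mx h (sext_hom (in_alg A) f) = sext_hom (in_alg A') f.
Proof. by apply/row_matrixP=> i; rewrite -map_row !rowK map_sext. Qed.

Lemma map_sext_bilin (A A' : comAlgType k) (h : {lrmorphism A -> A'})
    (V W U : vectType k) (b : V -> W -> U) x y :
  map_mx h (sext_bilin (in_alg A) b x y)
  = sext_bilin (in_alg A') b (map_mx h x) (map_mx h y).
Proof.
rewrite /sext_bilin map_mx_sum; apply: eq_bigr => i _.
rewrite map_mx_sum; apply: eq_bigr => j _.
by rewrite map_mxZ map_sext !mxE rmorphM.
Qed.

Definition push_family (A A' : comAlgType k) (h : {lrmorphism A -> A'})
    (eta : family A) : family A' :=
  fun M PM => map_mx h (eta M PM).

Lemma push_tensor_iso (A A' : comAlgType k) (h : {lrmorphism A -> A'})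
    (eta : family A) :
  is_tensor_iso eta -> is_tensor_iso (push_family h eta).
Proof.
case=> eta_iso eta_nat eta_ten eta_unit; split=> [M PM|M N PM PN f|M N PM PN v w|].
- have [d [ed de]] := eta_iso M PM.
  by exists (map_mx h d); rewrite -!map_mxM ed de !map_mx1.
- by rewrite -!(map_sext_hom h) -!map_mxM eta_nat.
- by rewrite -!(map_sext h) -!map_mxM eta_ten map_sext_bilin.
- by rewrite -!(map_sext h) -map_mxM eta_unit.
Qed.

Definition tensor_iso_functor : kfunctor k :=
  @KFunctor k (fun A => {eta : family A | is_tensor_iso eta})
    (fun A A' h x => exist _ _ (push_tensor_iso h (proj2_sig x))).

End TensorIso.

Definition G_dRB : kfunctor L :=
  tensor_iso_functor whole_category omega_B omega_B.

Definition Omega_dRB : kfunctor (Qbar R) :=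
  tensor_iso_functor whole_category omega_dR (base_change iota omega_B).

Definition G_dRB_of (M : dRB) : kfunctor L :=
  tensor_iso_functor (generated_subcat M) omega_B omega_B.

Definition Omega_dRB_of (M : dRB) : kfunctor (Qbar R) :=
  tensor_iso_functor (generated_subcat M) omega_dR (base_change iota omega_B).

End DeRhamBetti.

(* Main.v *)
Require Import Defs.
From HB Require Import structures.
From mathcomp Require Import all_boot all_order all_algebra ring_quotient ring.
From mathcomp Require Import complex.
From mathcomp Require Import boolp classical_sets reals topology_structure.
From mathcomp Require Import connected.

(* Let A and H be the coordinate rings of the torsor and of the group. The
   comparison isomorphism is a complex point of the torsor, so it identifies
   A (x) C with H (x) C, and everything reduces to showing that an idempotent x
   of this ring is constant. The matrix coefficients of one object M span a
   Qbar-subspace U of A and an L-subspace V of H with U (x) C = V (x) C, and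
   x lies in U (x) C for some M.
   As Qbar is algebraically closed, idempotents do not change under the
   extension from Qbar to C: x is in U and in V (x)_L Qbar. The Qbar-span of the
   idempotents of V (x)_L Qbar is Galois stable, so it is spanned by elements b
   of V, which also lie in U. Now (U, V) is a de Rham--Betti object, a quotient
   of a power of M, and b defines a morphism from the unit object to it; hence b
   is a matrix coefficient of the unit object, that is, a constant. *)

Set Implicit Arguments.
Unset Strict Implicit.
Unset Printing Implicit Defensive.

Import GRing.Theory.
Import VectorInternalTheory.
Local Open Scope ring_scope.

(** * Rings by generators and relations, linear forms *)

(** No automorphism of the complex numbers or of [Qbar] is ever extended. Both descents, from the
    complex numbers to [Qbar] and from [Qbar] to [L], go by specialization: the finitely many
    coordinates involved generate a finitely generated domain, and a ring morphism from it to [Qbar]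
    plays the part of a retraction in the first case and of a Galois conjugation in the second.
    Being idempotent is a system of polynomial equations in the coordinates, so it survives such a
    morphism. The obstacle is that the two algebraic structures on the same complex space, U and V
    (x) [Qbar], are unrelated, their change of basis being made of periods. Idempotents are
    algebraic for both at once, because the descent can be run in either ring. The passage to [L]
    concerns the span of all idempotents, since a single one need not have coordinates in [L]. The
    group and the torsor share one construction: for a functor F equal to [omega_B] or [omega_dR],
    the ring of functions on tensor transformations from F to [omega_B]. Their invertibility is not
    imposed; it follows from the existence of duals. *)

Record presentation := Presentation {
  pcar : Type;
  peq : pcar -> pcar -> Prop;
  pzero : pcar; pone : pcar;
  popp : pcar -> pcar;
  padd : pcar -> pcar -> pcar;
  pmul : pcar -> pcar -> pcar;
  peq_refl : forall x, peq x x;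
  peq_sym : forall x y, peq x y -> peq y x;
  peq_trans : forall x y z, peq x y -> peq y z -> peq x z;
  popp_congr : forall x y, peq x y -> peq (popp x) (popp y);
  padd_congr : forall x y x' y',
    peq x y -> peq x' y' -> peq (padd x x') (padd y y');
  pmul_congr : forall x y x' y',
    peq x y -> peq x' y' -> peq (pmul x x') (pmul y y');
  paddA : forall x y z, peq (padd x (padd y z)) (padd (padd x y) z);
  paddC : forall x y, peq (padd x y) (padd y x);
  padd0 : forall x, peq (padd pzero x) x;
  paddN : forall x, peq (padd (popp x) x) pzero;
  pmulA : forall x y z, peq (pmul x (pmul y z)) (pmul (pmul x y) z);
  pmulC : forall x y, peq (pmul x y) (pmul y x);
  pmul1 : forall x, peq (pmul pone x) x;
  pmulD : forall x y z, peq (pmul (padd x y) z) (padd (pmul x z) (pmul y z));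
  pone_neq0 : ~ peq pone pzero }.

Section Quotient.
Variable p : presentation.

(** Elements are the equivalence classes themselves, as predicates, so that equality in the quotient
    is Leibniz equality by extensionality although [peq] is undecidable. *)
Record presented := Presented {
  pclass : pcar p -> Prop;
  pclassP : exists x, pclass = peq x }.

HB.instance Definition _ := gen_eqMixin presented.
HB.instance Definition _ := gen_choiceMixin presented.

Definition ppi (x : pcar p) : presented := Presented (ex_intro _ x erefl).

Lemma presentedP (a : presented) : exists x, ppi x = a.
Proof.
case: a => c [x cE]; exists x; rewrite /ppi; move: (ex_intro _ x _) => h.
by move: (ex_intro _ _ _); rewrite cE => h'; congr Presented; apply: Prop_irrelevance.
Qed.

Lemma ppiE x y : (ppi x = ppi y) <-> peq x y.
Proof.
split=> [[] e|xy]; first by have := peq_refl y; rewrite -e.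
rewrite /ppi; have e : peq x = peq y.
  apply/funext=> z; apply/propext; split; first exact/peq_trans/peq_sym.
  exact: peq_trans.
move: (ex_intro _ x _) (ex_intro _ y _); rewrite e => h h'.
by congr Presented; apply: Prop_irrelevance.
Qed.

Definition prepr (a : presented) : pcar p := projT1 (cid (presentedP a)).

Lemma preprK a : ppi (prepr a) = a.
Proof. exact: projT2 (cid (presentedP a)). Qed.

Lemma prepr_pi x : peq (prepr (ppi x)) x.
Proof. by apply/ppiE; rewrite preprK. Qed.

Let pi_add a b := ppi (padd (prepr a) (prepr b)).
Let pi_mul a b := ppi (pmul (prepr a) (prepr b)).
Let pi_opp a := ppi (popp (prepr a)).

Let addE x y : pi_add (ppi x) (ppi y) = ppi (padd x y).
Proof. by apply/ppiE/padd_congr; apply: prepr_pi. Qed.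
Let mulE x y : pi_mul (ppi x) (ppi y) = ppi (pmul x y).
Proof. by apply/ppiE/pmul_congr; apply: prepr_pi. Qed.
Let oppE x : pi_opp (ppi x) = ppi (popp x).
Proof. by apply/ppiE/popp_congr/prepr_pi. Qed.

Let addA : associative pi_add.
Proof.
move=> a b c; rewrite -(preprK a) -(preprK b) -(preprK c) !addE.
exact/ppiE/paddA.
Qed.
Let addC : commutative pi_add.
Proof. by move=> a b; rewrite -(preprK a) -(preprK b) !addE; apply/ppiE/paddC. Qed.
Let add0 : left_id (ppi (pzero p)) pi_add.
Proof. by move=> a; rewrite -(preprK a) addE; apply/ppiE/padd0. Qed.
Let addN : left_inverse (ppi (pzero p)) pi_opp pi_add.
Proof. by move=> a; rewrite -(preprK a) oppE addE; apply/ppiE/paddN. Qed.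

HB.instance Definition _ := GRing.isZmodule.Build presented addA addC add0 addN.

Let mulA : associative pi_mul.
Proof.
move=> a b c; rewrite -(preprK a) -(preprK b) -(preprK c) !mulE.
exact/ppiE/pmulA.
Qed.
Let mulC : commutative pi_mul.
Proof. by move=> a b; rewrite -(preprK a) -(preprK b) !mulE; apply/ppiE/pmulC. Qed.
Let mul1 : left_id (ppi (pone p)) pi_mul.
Proof. by move=> a; rewrite -(preprK a) mulE; apply/ppiE/pmul1. Qed.
Let mulD : left_distributive pi_mul pi_add.
Proof.
move=> a b c; rewrite -(preprK a) -(preprK b) -(preprK c) addE !mulE addE.
exact/ppiE/pmulD.
Qed.
Let one0 : ppi (pone p) != ppi (pzero p).
Proof. by apply/eqP => /ppiE; apply: pone_neq0. Qed.

HB.instance Definition _ :=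
  GRing.Zmodule_isComNzRing.Build presented mulA mulC mul1 mulD one0.

Lemma ppiD x y : ppi (padd x y) = ppi x + ppi y.
Proof. by rewrite -addE. Qed.
Lemma ppiM x y : ppi (pmul x y) = ppi x * ppi y.
Proof. by rewrite -mulE. Qed.
Lemma ppiN x : ppi (popp x) = - ppi x.
Proof. by rewrite -oppE. Qed.
Lemma ppi0 : ppi (pzero p) = 0. Proof. by []. Qed.
Lemma ppi1 : ppi (pone p) = 1. Proof. by []. Qed.

End Quotient.

(** An alias of [B] that remembers [f], on which the algebra structure induced by [f] can be
    declared. *)
Definition algebra_along (k B : comNzRingType) (f : {rmorphism k -> B}) : Type :=
  B.

Section AlgebraAlong.
Variables (k B : comNzRingType) (f : {rmorphism k -> B}).
Local Notation Bf := (algebra_along f).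

HB.instance Definition _ := GRing.ComNzRing.copy Bf B.

Let scale (a : k) (x : Bf) : Bf := f a * x.
Let scaleA a b v : scale a (scale b v) = scale (a * b) v.
Proof. by rewrite /scale rmorphM mulrA. Qed.
Let scale1 : left_id 1 scale.
Proof. by move=> v; rewrite /scale rmorph1 mul1r. Qed.
Let scaleDr : right_distributive scale +%R.
Proof. by move=> a u v; rewrite /scale mulrDr. Qed.
Let scaleDl v : {morph scale^~ v : a b / a + b}.
Proof. by move=> a b; rewrite /scale rmorphD mulrDl. Qed.

HB.instance Definition _ := GRing.Zmodule_isLmodule.Build k Bf
  scaleA scale1 scaleDr scaleDl.

Let scaleAl a (u v : Bf) : a *: (u * v) = a *: u * v.
Proof. exact: mulrA. Qed.

HB.instance Definition _ := GRing.Lmodule_isLalgebra.Build k Bf scaleAl.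
HB.instance Definition _ := GRing.Lalgebra_isComAlgebra.Build k Bf.

Lemma in_alg_along (a : k) : in_alg Bf a = f a.
Proof. exact: mulr1. Qed.

End AlgebraAlong.

(** Zorn's lemma is applied to the sets whose union with [W] satisfies [P]; the empty chain then
    gives [W] itself. *)
Lemma Zorn_above (T : Type) (P : set (set T)) (W : set T) : P W ->
  (forall F : set (set T), (F !=set0)%classic -> (F `<=` P)%classic ->
    total_on F subset -> P (\bigcup_(X in F) X)%classic) ->
  exists D, [/\ P D, (W `<=` D)%classic &
    forall E, P E -> (D `<=` E)%classic -> (E `<=` D)%classic].
Proof.
move=> PW Pchain.
have [F FP Ftot|D [PD maxD]] := @Zorn_bigcup T [set U | P (W `|` U)%classic].
  have [[X FX]|F0] := pselect (F !=set0)%classic; last first.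
    rewrite (_ : F = set0) /= ?bigcup_set0 ?setU0 //.
    by apply/seteqP; split=> // X FX; apply: F0; exists X.
  pose F' : set (set T) := [set W `|` U | U in F]%classic.
  rewrite /mkset; have -> : (W `|` \bigcup_(X in F) X)%classic =
    (\bigcup_(X in F') X)%classic.
    apply/seteqP; split=> t /=.
      move=> [Wt|[Y FY Yt]]; first by exists (W `|` X)%classic; [exists X|left].
      by exists (W `|` Y)%classic; [exists Y|right].
    move=> [_ [Y FY <-] [Wt|Yt]]; first by left.
    by right; exists Y.
  apply: Pchain.
  - by exists (W `|` X)%classic, X.
  - by move=> _ [Y FY <-]; apply: FP.
  - move=> _ _ [Y FY <-] [Z FZ <-].
    by case: (Ftot _ _ FY FZ) => YZ; [left|right]; apply: setUS.
exists (W `|` D)%classic; split=> // E PE DE.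
apply: contrapT => ED; apply: (maxD E).
  by rewrite /proper; split=> [t Dt|ED'];
    [apply: DE; right|apply: ED => t /ED'; right].
rewrite /mkset (_ : (W `|` E)%classic = E) //; apply/setUidPr => t Wt.
by apply: DE; left.
Qed.

Section Functionals.
Variables (k : fieldType) (V : lmodType k).

Definition linear_form (psi : V -> k) : Prop :=
  forall a x y, psi (a *: x + y) = a * psi x + psi y.

Definition subspace (W : set V) : Prop :=
  W 0 /\ forall a x y, W x -> W y -> W (a *: x + y).

Lemma linear_form0 psi : linear_form psi -> psi 0 = 0.
Proof.
move=> psiP; have := psiP 1 0 0; rewrite scaler0 addr0 mul1r.
by rewrite -{1}[psi 0]addr0 => /addrI.
Qed.

Lemma linear_form_sum psi (I : Type) (r : seq I) (a : I -> k) (v : I -> V) :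
  linear_form psi ->
  psi (\sum_(i <- r) a i *: v i) = \sum_(i <- r) a i * psi (v i).
Proof.
move=> psiP; elim: r => [|i r IH]; first by rewrite !big_nil linear_form0.
by rewrite !big_cons psiP IH.
Qed.

Lemma subspaceZ W a x : subspace W -> W x -> W (a *: x).
Proof. by move=> [W0 WP] Wx; rewrite -[_ *: _]addr0; apply: WP. Qed.

(* A subspace maximal among those containing W and avoiding v is a hyperplane
   complementary to the line of v. *)
Lemma separating_form (W : set V) (v : V) : subspace W -> ~ W v ->
  exists psi, [/\ linear_form psi, forall w, W w -> psi w = 0 & psi v = 1].
Proof.
move=> Wsub Wv.
have [|F [X FX] FP Ftot|D [[Dsub Dv] WD maxD]] :=
    @Zorn_above V [set U | subspace U /\ ~ U v] W; first by [].
  split; last by move=> [Y FY]; have [] := FP _ FY.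
  split; first by exists X => //; have [[]] := FP _ FX.
  move=> a x y [Y FY Yx] [Z FZ Zy].
  have [YZ|ZY] := Ftot _ _ FY FZ.
    exists Z => //; have [[_ ZP] _] := FP _ FZ; apply: ZP => //; exact: YZ.
  exists Y => //; have [[_ YP] _] := FP _ FY; apply: YP => //; exact: ZY.
have [D0 DP] := Dsub.
have DB x y : D x -> D y -> D (x - y).
  by move=> Dx Dy; rewrite addrC -scaleN1r; apply: DP.
have dec h : exists a, D (h - a *: v).
  (* If D + k h avoids v, it equals D by maximality and a = 0 works. Otherwise v = b h + d, where b
     is nonzero because v is not in D, and a is the inverse of b. *)
  pose E := [set x | exists b d, D d /\ x = b *: h + d]%classic.
  have [Ev|nEv] := pselect (E v); last first.
    exists 0; rewrite scale0r subr0; apply: (maxD E) => /=.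
    - split=> //; split; first by exists 0, 0; rewrite scale0r addr0.
      move=> a _ _ [b [d [Dd ->]]] [b' [d' [Dd' ->]]].
      exists (a * b + b'), (a *: d + d'); split; first exact: DP.
      by rewrite scalerDr scalerA scalerDl addrACA.
    - by move=> x Dx; exists 0, x; rewrite scale0r add0r.
    - by exists 1, 0; rewrite scale1r addr0.
  have [b [d [Dd vE]]] := Ev.
  have b0 : b != 0.
    by apply/eqP => b0; apply: Dv; rewrite vE b0 scale0r add0r.
  exists b^-1; rewrite vE scalerDr scalerA mulVf // scale1r opprD addNKr.
  by rewrite -scaleNr; apply: subspaceZ.
have uni h a b : D (h - a *: v) -> D (h - b *: v) -> a = b.
  move=> Da Db; have [//|] := eqVneq a b; rewrite -subr_eq0 => ab.
  case: Dv; rewrite -[v]scale1r -(mulVf ab) -scalerA; apply: subspaceZ => //.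
  rewrite scalerBl; have -> : a *: v - b *: v = (h - b *: v) - (h - a *: v).
    by rewrite opprB [RHS]addrC addrA subrK.
  exact: DB.
have /choice[psi psiP] := dec.
exists psi; split=> [a x y|w Ww|].
- apply: (uni (a *: x + y)) => //; rewrite scalerDl -scalerA opprD addrACA.
  by rewrite -scalerBr; apply: DP.
- by apply: (uni w) => //; rewrite scale0r subr0; apply: WD.
- by apply: (uni v) => //; rewrite scale1r subrr.
Qed.

Definition independent n (h : 'I_n -> V) : Prop :=
  forall a : 'I_n -> k, \sum_i a i *: h i = 0 -> forall i, a i = 0.

(** Separates [h l] from the span [W] of the other vectors. *)
Lemma dual_form n (h : 'I_n -> V) (l : 'I_n) : independent h ->
  exists psi, linear_form psi /\ forall i, psi (h i) = (i == l)%:R.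
Proof.
move=> hind.
pose W := [set x | exists a : 'I_n -> k, a l = 0 /\ x = \sum_i a i *: h i]%classic.
have [|[a [al hlE]]|psi [psiP psiW psil]] := @separating_form W (h l).
- split; first by exists (fun _ => 0); split=> //; rewrite big1 // => i;
    rewrite scale0r.
  move=> c _ _ [a [al ->]] [b [bl ->]]; exists (fun i => c * a i + b i).
  split; first by rewrite al bl mulr0 addr0.
  rewrite scaler_sumr -big_split; apply: eq_bigr => i _ /=.
  by rewrite scalerDl scalerA.
- have e : \sum_i ((i == l)%:R - a i) *: h i = 0.
    rewrite (eq_bigr _ (fun i _ => scalerBl _ _ _)) sumrB -hlE (bigD1 l) //=.
    rewrite eqxx scale1r big1 ?addr0 ?subrr // => i /negPf ->.
    by rewrite scale0r.
  by have := hind _ e l; rewrite /= eqxx al subr0 => /eqP; rewrite oner_eq0.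
- exists psi; split=> // i; have [->//|il] := eqVneq i l.
  apply: psiW; exists (fun j => (j == i)%:R).
  split; first by rewrite eq_sym (negPf il).
  rewrite (bigD1 i) //= eqxx scale1r big1 ?addr0 // => j /negPf ->.
  by rewrite scale0r.
Qed.

(** Both matrices are kept: [X] gives the coordinates of the family, while [Y], which puts the basis
    in the span of the family, will make the object of matrix coefficients a quotient. *)
Lemma span_basis n (v : 'I_n -> V) :
  exists r (h : 'I_r -> V) (X : 'M[k]_(n, r)) (Y : 'M[k]_(r, n)),
  [/\ independent h, forall i, v i = \sum_j X i j *: h j &
      forall j, h j = \sum_i Y j i *: v i].
Proof.
elim: n v => [|n IH] v.
  exists 0%N, v, 0, 0; split; [move=> a _|..]; by case.
have [r [h [X [Y [hind vE hE]]]]] := IH (fun i => v (widen_ord (leqnSn n) i)).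
have liftE (i : 'I_n) : lift ord_max i = widen_ord (leqnSn n) i.
  by apply: val_inj; rewrite /= /bump leqNgt ltn_ord.
have [[x xE]|nx] := pselect (exists x : 'I_r -> k, v ord_max = \sum_j x j *: h j).
  exists r, h, (\matrix_(i, j) oapp (fun i => X i j) (x j) (unlift ord_max i)).
  exists (\matrix_(j, i) oapp (Y j) 0 (unlift ord_max i)); split=> // [i|j].
    case: (unliftP ord_max i) => [l ->|->].
      by rewrite liftE vE; apply: eq_bigr => j _; rewrite mxE -liftE liftK.
    by rewrite xE; apply: eq_bigr => j _; rewrite mxE unlift_none.
  rewrite big_ord_recr /= !mxE unlift_none /= scale0r addr0 hE.
  by apply: eq_bigr => i _; rewrite mxE -liftE liftK.
pose h' (j : 'I_r.+1) := oapp h (v ord_max) (unlift ord_max j).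
have liftEr (i : 'I_r) : widen_ord (leqnSn r) i = lift ord_max i.
  by apply: val_inj; rewrite /= /bump leqNgt ltn_ord.
have h'sum (a : 'I_r.+1 -> k) : \sum_j a j *: h' j =
    \sum_j a (lift ord_max j) *: h j + a ord_max *: v ord_max.
  rewrite big_ord_recr /= /h' unlift_none /=; congr (_ + _).
  by apply: eq_bigr => j _; rewrite liftEr liftK.
exists r.+1, h', (\matrix_(i, j) match unlift ord_max i, unlift ord_max j with
  | Some i, Some j => X i j | None, None => 1 | _, _ => 0 end).
exists (\matrix_(j, i) match unlift ord_max i, unlift ord_max j with
  | Some i, Some j => Y j i | None, None => 1 | _, _ => 0 end).
split=> [a|i|j].
- rewrite h'sum => a0; have am : a ord_max = 0.
    have [//|am] := eqVneq (a ord_max) 0; case: nx.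
    exists (fun j => - (a ord_max)^-1 * a (lift ord_max j)).
    move/eqP: a0; rewrite addrC addr_eq0 => /eqP/(congr1 ( *:%R (a ord_max)^-1)).
    rewrite scalerA mulVf // scale1r => ->.
    rewrite scalerN scaler_sumr -sumrN; apply: eq_bigr => j _.
    by rewrite scalerA mulNr scaleNr.
  move=> j; case: (unliftP ord_max j) => [l ->|-> //].
  by move: a0; rewrite am scale0r addr0 => /hind; apply.
- rewrite h'sum !mxE unlift_none; case: (unliftP ord_max i) => [l ->|->].
    rewrite scale0r addr0 liftE vE; apply: eq_bigr => j _.
    by rewrite mxE -liftE !liftK.
  rewrite scale1r big1 ?add0r // => j _.
  by rewrite mxE unlift_none liftK scale0r.
- rewrite big_ord_recr /= !mxE unlift_none /h';
    case: (unliftP ord_max j) => [l ->|->].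
    rewrite scale0r addr0 /= hE; apply: eq_bigr => i _.
    by rewrite mxE -liftE !liftK.
  rewrite scale1r big1 ?add0r // => i _.
  by rewrite mxE -liftE liftK unlift_none scale0r.
Qed.

End Functionals.

(** * Tensor products of an algebra with a field *)

Section TensorProduct.
Variables (k F : fieldType) (s : {rmorphism k -> F}) (A : comAlgType k).
Implicit Types (psi : A -> k) (x y : seq (A * F)).

(** A list stands for the sum of the pure tensors of its pairs. Two lists are identified when psi
    (x) id agrees on them for every linear form psi on [A]; over a field these maps separate the
    elements of the tensor product. *)
Let ev psi x : F := \sum_(p <- x) s (psi p.1) * p.2.
Let teq x y := forall psi, linear_form psi -> ev psi x = ev psi y.
Let tmul x y : seq (A * F) := [seq (p.1 * q.1, p.2 * q.2) | p <- x, q <- y].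
Let topp x : seq (A * F) := [seq (p.1, - p.2) | p <- x].

Let ev_cat psi x y : ev psi (x ++ y) = ev psi x + ev psi y.
Proof. exact: big_cat. Qed.

Let ev_opp psi x : ev psi (topp x) = - ev psi x.
Proof. by rewrite /ev big_map -sumrN; apply: eq_bigr => p _; rewrite mulrN. Qed.

Let ev_mul psi x y :
  ev psi (tmul x y) = \sum_(q <- y) ev (fun a => psi (a * q.1)) x * q.2.
Proof.
rewrite /ev /tmul big_allpairs_dep exchange_big; apply: eq_bigr => q _ /=.
by rewrite mulr_suml; apply: eq_bigr => p _; rewrite mulrA.
Qed.

Let ev_mulC psi x y : ev psi (tmul x y) = ev psi (tmul y x).
Proof.
rewrite /ev /tmul !big_allpairs_dep exchange_big; apply: eq_bigr => q _ /=.
by apply: eq_bigr => p _; rewrite mulrC [q.2 * _]mulrC [q.1 * _]mulrC mulrC.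
Qed.

Let form_mulr psi b : linear_form psi -> linear_form (fun a => psi (a * b)).
Proof. by move=> psiP c a a'; rewrite mulrDl -scalerAl psiP. Qed.

Let mul_congrl x y z : teq x y -> teq (tmul x z) (tmul y z).
Proof.
move=> xy psi psiP; rewrite !ev_mul; apply: eq_bigr => q _.
by rewrite xy //; apply: form_mulr.
Qed.

Lemma tens_presentation_subproof : ~ teq [:: (1, 1)] [::].
Proof.
have [|/eqP|psi [psiP _ psi1]] := @separating_form k A [set 0]%classic 1.
- by split=> // a _ _ -> ->; rewrite scaler0 addr0.
- by rewrite oner_eq0.
move=> /(_ psi psiP)/eqP.
by rewrite /ev big_seq1 big_nil psi1 rmorph1 mulr1 oner_eq0.
Qed.

Definition tens_presentation : presentation.
Proof.
refine (@Presentation (seq (A * F)) teq [::] [:: (1, 1)] topp cat tmul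
  _ _ _ _ _ _ _ _ _ _ _ _ _ _ tens_presentation_subproof).
- by [].
- by move=> x y xy psi /xy.
- by move=> x y z xy yz psi psiP; rewrite xy ?yz.
- by move=> x y xy psi psiP; rewrite !ev_opp xy.
- by move=> x y x' y' xy xy' psi psiP; rewrite !ev_cat xy ?xy'.
- move=> x y x' y' xy xy' psi psiP; rewrite (mul_congrl _ xy) //.
  by rewrite ev_mulC (mul_congrl _ xy') // ev_mulC.
- by move=> x y z psi _; rewrite !ev_cat addrA.
- by move=> x y psi _; rewrite !ev_cat addrC.
- by [].
- by move=> x psi _; rewrite ev_cat ev_opp addNr /ev big_nil.
- move=> x y z psi _; rewrite !ev_mul /tmul big_allpairs_dep exchange_big.
  apply: eq_bigr => q _ /=; rewrite -/(tmul x y) ev_mul mulr_suml.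
  apply: eq_bigr => p _; rewrite mulrA; congr (_ * _ * _).
  by apply: eq_bigr => r _; rewrite mulrA.
- by move=> x y psi _; rewrite ev_mulC.
- move=> x psi _; rewrite ev_mul; apply: eq_bigr => q _.
  by rewrite /ev big_seq1 mul1r mulr1.
- move=> x y z psi _; rewrite ev_cat !ev_mul -big_split; apply: eq_bigr => q _.
  by rewrite ev_cat mulrDl.
Defined.

Definition tens : comNzRingType := presented tens_presentation.

Definition tens_ev psi (t : tens) : F := ev psi (prepr t).

Let tens_ev_pi psi x : linear_form psi ->
  tens_ev psi (ppi (x : pcar tens_presentation)) = ev psi x.
Proof. exact: (@prepr_pi tens_presentation x psi). Qed.

Lemma tens_ext (t u : tens) :
  (forall psi, linear_form psi -> tens_ev psi t = tens_ev psi u) -> t = u.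
Proof. by move=> tu; rewrite -(preprK t) -(preprK u); apply/ppiE. Qed.

Lemma tens_evD psi t u : linear_form psi ->
  tens_ev psi (t + u) = tens_ev psi t + tens_ev psi u.
Proof.
move=> psiP; rewrite -(preprK t) -(preprK u) -ppiD !tens_ev_pi //.
exact: ev_cat.
Qed.

Lemma tens_ev0 psi : linear_form psi -> tens_ev psi 0 = 0.
Proof. by move=> psiP; rewrite -ppi0 tens_ev_pi // /ev big_nil. Qed.

Lemma tens_ev_sum psi (I : Type) (r : seq I) (t : I -> tens) :
  linear_form psi ->
  tens_ev psi (\sum_(i <- r) t i) = \sum_(i <- r) tens_ev psi (t i).
Proof.
move=> psiP; elim: r => [|i r IH]; first by rewrite !big_nil tens_ev0.
by rewrite !big_cons tens_evD // IH.
Qed.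

Let tl (a : A) : tens := ppi ([:: (a, 1)] : pcar tens_presentation).
Let tr (z : F) : tens := ppi ([:: (1, z)] : pcar tens_presentation).

Let tl_additive : zmod_morphism tl.
Proof.
move=> a b; rewrite -ppiN -ppiD; apply/ppiE => psi psiP.
rewrite /ev /= !big_cons !big_nil /= !addr0 !mulr1 mulrN mulr1 -rmorphB; congr (s _).
by rewrite addrC -scaleN1r psiP mulN1r addrC.
Qed.

Let tl_multiplicative : monoid_morphism tl.
Proof.
split=> [|a b]; first by rewrite -ppi1.
rewrite -ppiM; apply/ppiE => psi psiP.
by rewrite /ev !big_seq1 /= !mulr1.
Qed.

Let tr_additive : zmod_morphism tr.
Proof.
move=> a b; rewrite -ppiN -ppiD; apply/ppiE => psi psiP.
by rewrite /ev /= !big_cons !big_nil /= !addr0 mulrBr mulrN.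
Qed.

Let tr_multiplicative : monoid_morphism tr.
Proof.
split=> [|a b]; first by rewrite -ppi1.
rewrite -ppiM; apply/ppiE => psi psiP.
by rewrite /ev !big_seq1 /= mulr1.
Qed.

HB.instance Definition _ := GRing.isZmodMorphism.Build A tens tl tl_additive.
HB.instance Definition _ :=
  GRing.isMonoidMorphism.Build A tens tl tl_multiplicative.
HB.instance Definition _ := GRing.isZmodMorphism.Build F tens tr tr_additive.
HB.instance Definition _ :=
  GRing.isMonoidMorphism.Build F tens tr tr_multiplicative.

(* Locked, since unfolding these maps makes unification very slow. *)
Fact tens_key : unit. Proof. by []. Qed.
Definition tensl : {rmorphism A -> tens} :=
  locked_with tens_key (tl : {rmorphism A -> tens}).
Definition tensr : {rmorphism F -> tens} :=
  locked_with tens_key (tr : {rmorphism F -> tens}).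

Let tenslE : tensl = tl :> (A -> tens).
Proof. by rewrite /tensl; case: tens_key. Qed.
Let tensrE : tensr = tr :> (F -> tens).
Proof. by rewrite /tensr; case: tens_key. Qed.

Lemma tens_ev_pure psi a z : linear_form psi ->
  tens_ev psi (tensl a * tensr z) = s (psi a) * z.
Proof.
by move=> psiP; rewrite tenslE tensrE -ppiM tens_ev_pi // /ev big_seq1 /= mulr1 mul1r.
Qed.

Lemma tensl_alg c : tensl (in_alg A c) = tensr (s c).
Proof.
rewrite tenslE tensrE; apply/ppiE => psi psiP; rewrite /ev !big_seq1 /= mulr1.
rewrite -[c%:A]addr0 psiP linear_form0 // addr0.
by rewrite rmorphM mulrC.
Qed.

Section Lift.
Variables (B : comNzRingType) (f : {rmorphism A -> B}) (g : {rmorphism F -> B}).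
Hypothesis fg : forall c, f (in_alg A c) = g (s c).

Let lift x : B := \sum_(p <- x) f p.1 * g p.2.

Let lift_opp x : lift (topp x) = - lift x.
Proof. 
by rewrite /lift big_map -sumrN; apply: eq_bigr => p _; rewrite rmorphN mulrN.
Qed.

Let fZ c a : f (c *: a) = g (s c) * f a.
Proof. by rewrite -fg -rmorphM /= mulr_algl. Qed.

(** This makes the lift well defined. Once the first components are written in a basis [h] of their
    span, the coefficient of [h j] in [F] is the value at x of the form dual to [h j], hence
    zero. *)
Let lift0 x : teq x [::] -> lift x = 0.
Proof.
move=> x0; pose v (i : 'I_(size x)) := tnth (in_tuple x) i.
have [r [h [X [_ [hind vE _]]]]] := span_basis (fun i => (v i).1).
have -> : lift x = \sum_i f (v i).1 * g (v i).2 by rewrite /lift big_tnth.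
rewrite (eq_bigr (fun i => \sum_j f (h j) * g (s (X i j) * (v i).2))); last first.
  move=> i _; rewrite vE rmorph_sum mulr_suml; apply: eq_bigr => j _.
  by rewrite fZ rmorphM mulrCA mulrA.
rewrite exchange_big big1 // => j _; rewrite -mulr_sumr -rmorph_sum /=.
have [psi [psiP psih]] := dual_form j hind.
have e0 : \sum_i s (psi (v i).1) * (v i).2 = 0.
  by have := x0 _ psiP; rewrite /ev big_nil => e; rewrite -[RHS]e [RHS]big_tnth.
suff -> : \sum_i s (X i j) * (v i).2 = 0 by rewrite rmorph0 mulr0.
rewrite -[RHS]e0; apply: eq_bigr => i _.
congr (s _ * _); rewrite vE linear_form_sum // (bigD1 j) //= psih eqxx.
by rewrite mulr1 big1 ?addr0 // => l /negPf lj; rewrite psih lj mulr0.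
Qed.

Let lift_congr x y : teq x y -> lift x = lift y.
Proof.
move=> xy; apply/eqP; rewrite -subr_eq0 -lift_opp -[_ + _]big_cat; apply/eqP.
apply: lift0 => psi psiP.
by rewrite ev_cat ev_opp (xy _ psiP) subrr /ev big_nil.
Qed.

Let liftT (t : tens) : B := lift (prepr t).

Let liftT_pi x : liftT (ppi (x : pcar tens_presentation)) = lift x.
Proof. exact/lift_congr/(@prepr_pi tens_presentation). Qed.

Let liftT_additive : zmod_morphism liftT.
Proof.
move=> t u; rewrite -(preprK t) -(preprK u) -ppiN -ppiD !liftT_pi.
by rewrite /lift /= big_cat -/(lift _) -/(lift _) lift_opp.
Qed.

Let liftT_multiplicative : monoid_morphism liftT.
Proof.
split=> [|t u]; first by rewrite -ppi1 liftT_pi /lift big_seq1 !rmorph1 mulr1.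
rewrite -(preprK t) -(preprK u) -ppiM !liftT_pi.
rewrite /lift /= /tmul big_allpairs_dep mulr_suml; apply: eq_bigr => p _.
by rewrite mulr_sumr; apply: eq_bigr => q _; rewrite !rmorphM mulrACA.
Qed.

HB.instance Definition _ := GRing.isZmodMorphism.Build tens B liftT liftT_additive.
HB.instance Definition _ :=
  GRing.isMonoidMorphism.Build tens B liftT liftT_multiplicative.

Lemma tens_lift : exists h : {rmorphism tens -> B},
  (forall a, h (tensl a) = f a) /\ (forall z, h (tensr z) = g z).
Proof.
exists liftT; split=> a; rewrite ?tenslE ?tensrE [LHS]liftT_pi /lift big_seq1 rmorph1
  ?mulr1 //.
by rewrite mul1r.
Qed.

End Lift.

Lemma tensl_inj : injective tensl.
Proof.
move=> a b ab; have [//|nab] := pselect (a = b).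
have [||psi [psiP _]] := @separating_form k A [set 0]%classic (a - b).
- by split=> // c _ _ -> ->; rewrite scaler0 addr0.
- by move=> /eqP; rewrite subr_eq0 => /eqP.
have : tens_ev psi (tensl (a - b) * tensr 1) = 0.
  by rewrite rmorphB ab subrr mul0r tens_ev0.
rewrite tens_ev_pure // mulr1 => e0 e1; move: e0.
by rewrite e1 rmorph1 => /eqP; rewrite oner_eq0.
Qed.

Lemma tens_independent n (h : 'I_n -> A) (z : 'I_n -> F) : independent h ->
  \sum_i tensl (h i) * tensr (z i) = 0 -> forall i, z i = 0.
Proof.
move=> hind h0 i; have [psi [psiP psih]] := dual_form i hind.
have := tens_ev_sum (index_enum 'I_n) (fun i => tensl (h i) * tensr (z i)) psiP.
rewrite h0 tens_ev0 // (bigD1 i) //= big1 ?addr0 => [|j /negPf ji].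
  by rewrite tens_ev_pure // psih eqxx rmorph1 mul1r => <-.
by rewrite tens_ev_pure // psih ji rmorph0 mul0r.
Qed.

End TensorProduct.

(** * Specialization of finitely generated domains *)

Definition alg_closed (K : fieldType) : Prop :=
  forall p : {poly K}, (1 < size p)%N -> exists x, root p x.

(** Says that [phi] factors through the image of [i]. Finitely generated subrings of a field are
    never formed: they are handled as images of iterated polynomial rings. *)
Definition kills_kernel (R S T : nzRingType) (i : R -> S) (phi : R -> T) : Prop :=
  forall r, i r = 0 -> phi r = 0.

(** A root of [p * 'X + 1] cannot be a root of [p]. *)
Lemma alg_closed_nonroot (K : fieldType) (p : {poly K}) :
  alg_closed K -> p != 0 -> exists x, ~~ root p x.
Proof.
move=> Kc p0; have [|x] := Kc (p * 'X + 1%:P).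
  by rewrite size_MXaddC (negPf p0) /= ltnS lt0n size_poly_eq0.
move=> rx; exists x; apply/negP => /rootP px.
by move/rootP: rx; rewrite !hornerE px mul0r add0r => /eqP; rewrite oner_eq0.
Qed.

Section Chevalley.
Variables (F K : fieldType) (Kc : alg_closed K).
Variables (R : idomainType) (i : {rmorphism R -> F}) (z : F).
Implicit Types p q t f : {poly R}.

Let ev p : F := (map_poly i p).[z].

Let evD p q : ev (p + q) = ev p + ev q.
Proof. by rewrite /ev rmorphD hornerD. Qed.
Let evM p q : ev (p * q) = ev p * ev q.
Proof. by rewrite /ev rmorphM hornerM. Qed.
Let evZ c p : ev (c *: p) = i c * ev p.
Proof. by rewrite /ev map_polyZ /= hornerZ. Qed.

Let drop_lead p : p != 0 -> i (lead_coef p) = 0 ->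
  exists2 p' : {poly R}, (size p' < size p)%N & map_poly i p' = map_poly i p.
Proof.
move=> p0 ip; exists (\poly_(l < (size p).-1) p`_l).
  by rewrite (leq_ltn_trans (size_poly _ _)) // prednK // lt0n size_poly_eq0.
apply/polyP => l; rewrite !coef_map coef_poly; case: ltnP => // pl /=.
rewrite rmorph0; move: pl; rewrite leq_eqVlt => /orP[/eqP <-//|pl].
by rewrite nth_default ?rmorph0 //; move: pl; case: (size p).
Qed.

Let minimal (P : {poly R} -> Prop) p : P p ->
  exists2 t, P t & forall t', P t' -> (size t <= size t')%N.
Proof.
move=> Pp; have ex : exists n, `[< exists t, P t /\ size t = n >].
  by exists (size p); apply/asboolP; exists p.
case: (ex_minnP ex) => n /asboolP[t [Pt <-]] tmin; exists t => // t' Pt'.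
by apply: tmin; apply/asboolP; exists t'.
Qed.

(** One step of Chevalley's theorem: a morphism to [K] that does not kill [q0] extends to the ring
    generated by [z], keeping the value of [q] at [z] nonzero. *)
Lemma chevalley q : ev q != 0 ->
  exists q0 : R, i q0 != 0 /\ forall phi : {rmorphism R -> K},
    kills_kernel i phi -> phi q0 != 0 ->
    exists zeta, (forall p, ev p = 0 -> (map_poly phi p).[zeta] = 0) /\
      (map_poly phi q).[zeta] != 0.
Proof.
move=> q0.
have map0 (phi : {rmorphism R -> K}) p : kills_kernel i phi ->
    map_poly i p = 0 -> map_poly phi p = 0.
  move=> ker ip; apply/polyP => l; rewrite coef_map coef0 /= ker //.
  by rewrite -coef_map ip coef0.
(* If [z] is transcendental over the image of [i], any coefficient of [q] not killed by [i] serves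
   as [q0], and [zeta] only has to avoid the roots of the specialized [q]. *)
have [trans|] := pselect (forall p, ev p = 0 -> map_poly i p = 0).
  have [l ql] : exists l, i q`_l != 0.
    apply: contrapT => nl; move/eqP: q0; apply; rewrite /ev.
    rewrite (_ : map_poly i q = 0) ?horner0 //; apply/polyP => l.
    rewrite coef_map coef0; have [//|nz] := eqVneq (i q`_l) 0.
    by case: nl; exists l.
  exists q`_l; split=> // phi ker phiq.
  have [|zeta rz] := @alg_closed_nonroot K (map_poly phi q) Kc.
    by apply: contraNneq phiq => e; rewrite -coef_map e coef0.
  exists zeta; split=> // p /trans/map0 ->; rewrite ?horner0 //.
move=> /existsNP[p1 /not_implyP[evp1 /eqP ip1]].
(* In the algebraic case [p] is a minimal polynomial of [z] up to a scalar. As the coefficients form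
   only a domain, all divisions are pseudo-divisions. *)
have [p [evp ip] pmin] :=
  @minimal (fun p => ev p = 0 /\ map_poly i p != 0) p1 (conj evp1 ip1).
have p0 : p != 0 by apply: contraNneq ip => ->; rewrite rmorph0.
have lp : i (lead_coef p) != 0.
  apply/eqP => /(drop_lead p0)[p' sp' ip']; move: sp'; rewrite ltnNge pmin //.
  by rewrite /ev ip'.
(* The ideal generated by p and q, up to coefficients killed by i. *)
pose I t := exists u v n, t = u * q + v * p + n /\ map_poly i n = 0.
have Iq : I q by exists 1, 0, 0; rewrite mul1r mul0r !addr0 rmorph0.
have Ip : I p by exists 0, 1, 0; rewrite mul1r mul0r add0r addr0 rmorph0.
have Imul c f t t' : I t -> I t' -> I (c *: t - f * t').
  move=> [u [v [n [-> n0]]]] [u' [v' [n' [-> n0']]]].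
  exists (c *: u - f * u'), (c *: v - f * v'), (c *: n - f * n'); split.
    by rewrite !scalerDr !mulrDr !mulrBl !opprD -!scalerAl !mulrA addrACA;
       congr (_ + _); rewrite addrACA.
  by rewrite rmorphB rmorphM /= map_polyZ /= n0 n0' scaler0 mulr0 subr0.
(* This replaces a Bezout relation between [p] and [q]: a shortest element of the ideal that does
   not vanish at [z] turns out to be a constant. *)
have [t [It evt] tmin] := @minimal (fun t => I t /\ ev t != 0) q (conj Iq q0).
have t0 : t != 0.
  by apply: contraNneq evt => ->; rewrite /ev rmorph0 horner0.
have It' t' : map_poly i t' = map_poly i t -> I t'.
  case: It => u [v [n [tE n0]]] tt'.
  exists u, v, (n + (t' - t)); split; last by rewrite rmorphD rmorphB /=
    tt' subrr n0 addr0.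
  by rewrite addrA -tE addrC subrK.
have lt : i (lead_coef t) != 0.
  apply/eqP => /(drop_lead t0)[t' st' it']; move: st'; rewrite ltnNge tmin //.
  by split; [apply: It'|rewrite /ev it'].
have divpI f g : I f -> I g -> I (f %% g) /\
    ev (f %% g) = i (lead_coef g ^+ scalp f g) * ev f - ev (f %/ g) * ev g.
  move=> If Ig; have -> : f %% g = lead_coef g ^+ scalp f g *: f - f %/ g * g.
    by rewrite Pdiv.WeakIdomain.divp_eq addrC addKr.
  by split; [apply: Imul|rewrite -mulNr evD evZ -scaleN1r evM evZ rmorphN1 mulN1r
    mulNr].
have tp : (size t < size p)%N.
  have [Itp] := divpI t p It Ip; rewrite evp mulr0 subr0 => evtp.
  apply: leq_ltn_trans (tmin _ (conj Itp _)) _;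
    last by rewrite Pdiv.CommonIdomain.ltn_modp.
  by rewrite evtp mulf_neq0 // rmorphXn expf_neq0.
(* Otherwise [p %% t], shorter than [t], vanishes at [z], and so does [p %/ t]. The latter is
   shorter than [p], hence killed by [i]; so up to a scalar and the kernel [p] is [p %% t], which is
   too short. *)
have st : size t = 1%N.
  apply/eqP; rewrite eqn_leq size_poly_gt0 t0 andbT leqNgt; apply/negP => st.
  have [Ipt] := divpI p t Ip It; rewrite evp mulr0 sub0r => evpt.
  have evpt0 : ev (p %% t) = 0.
    have [//|nz] := eqVneq (ev (p %% t)) 0.
    have := tmin _ (conj Ipt nz).
    by rewrite leqNgt Pdiv.CommonIdomain.ltn_modp t0.
  have := evpt0; rewrite evpt => /eqP; rewrite oppr_eq0 mulf_eq0 (negPf evt) orbF.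
  move=> /eqP evg; have [ig|ig] := eqVneq (map_poly i (p %/ t)) 0.
    have := congr1 (map_poly i) (Pdiv.WeakIdomain.divp_eq p t).
    rewrite map_polyZ /= rmorphD rmorphM /= ig mul0r add0r => e.
    have : (size (map_poly i p) <= size (p %% t)%R)%N.
      rewrite -(@size_scale _ (i (lead_coef t ^+ scalp p t))).
        by rewrite e; apply: size_poly.
      by rewrite rmorphXn expf_neq0.
    rewrite size_map_poly_id0 // leqNgt => /negP; apply.
    by apply: ltn_trans tp; rewrite Pdiv.CommonIdomain.ltn_modp.
  have := pmin _ (conj evg ig); rewrite Pdiv.CommonIdomain.size_divp // leqNgt.
  move=> /negP; apply; rewrite ltn_subrL size_poly_gt0 p0 andbT.
  by rewrite -subn1 subn_gt0.
have [b tb] : exists b, t = b%:P.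
  by exists (t`_0); rewrite {1}(size1_polyC (eq_leq st)).
have b0 : i b != 0 by move: lt; rewrite tb lead_coefC.
(* If [lead_coef p] survives, the specialized [p] has a root [zeta], and every equation of [z] is a
   multiple of [p] there. If [b] survives, [q] is nonzero at [zeta], since [b] is a combination of
   [p] and [q]. *)
exists (lead_coef p * b); split=> [|phi ker]; first by rewrite rmorphM mulf_neq0.
rewrite rmorphM mulf_eq0 negb_or => /andP[lphi bphi].
have sp : (1 < size p)%N by apply: leq_ltn_trans tp; rewrite size_poly_gt0.
have [|zeta rz] := @Kc (map_poly phi p); first by rewrite size_map_poly_id0.
exists zeta; split=> [f evf|].
  have im0 : map_poly i (f %% p) = 0.
    have [//|nz] := eqVneq (map_poly i (f %% p)) 0.
    have e : f %% p = lead_coef p ^+ scalp f p *: f + - (f %/ p) * p.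
      by rewrite Pdiv.WeakIdomain.divp_eq mulNr addrC addKr.
    have /pmin : ev (f %% p) = 0 /\ map_poly i (f %% p) != 0.
      by split=> //; rewrite e evD evZ evM evf evp !mulr0 addr0.
    by rewrite leqNgt Pdiv.CommonIdomain.ltn_modp p0.
  have := congr1 (fun g => (map_poly phi g).[zeta]) (Pdiv.WeakIdomain.divp_eq f p).
  rewrite map_polyZ /= rmorphD rmorphM /= (map0 _ _ ker im0) addr0.
  rewrite hornerZ hornerM (rootP rz) mulr0 => /eqP; rewrite mulf_eq0.
  by rewrite rmorphXn expf_eq0 (negPf lphi) andbF /= => /eqP.
have [u [v [n [tE n0]]]] := It.
apply: contraNneq bphi => qz.
have := congr1 (fun g => (map_poly phi g).[zeta]) tE.
rewrite tb map_polyC hornerC !rmorphD !rmorphM /= !hornerD !hornerM qz (rootP rz).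
by rewrite (map0 _ _ ker n0) horner0 !mulr0 !addr0 => ->.
Qed.
End Chevalley.

(** The elements of [zs] are adjoined one at a time, and [chevalley] pushes the condition on the
    morphism down from the top ring to [R0]. *)
Lemma spreading_out (F K : fieldType) (R0 : idomainType) (i0 : {rmorphism R0 -> F})
    (zs : seq F) : alg_closed K ->
  exists (R : idomainType) (b : {rmorphism R0 -> R}) (i : {rmorphism R -> F}),
  [/\ forall r, i (b r) = i0 r, forall z, z \in zs -> exists r, i r = z &
   forall q, i q != 0 -> exists q0, i0 q0 != 0 /\
     forall phi0 : {rmorphism R0 -> K}, kills_kernel i0 phi0 -> phi0 q0 != 0 ->
     exists phi : {rmorphism R -> K},
       [/\ forall r, phi (b r) = phi0 r, kills_kernel i phi & phi q != 0]].
Proof.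
move=> Kc; elim: zs => [|z zs [R [b [i [ib izs ext]]]]].
  exists R0, idfun, i0; split=> // q iq; exists q; split=> // phi0 ker phiq.
  by exists phi0.
exists {poly R}, (polyC \o b : {rmorphism R0 -> {poly R}}).
exists (horner_eval z \o map_poly i : {rmorphism {poly R} -> F}).
split=> [r|w|q].
- by rewrite /= map_polyC /= /horner_eval hornerC.
- rewrite inE => /orP[/eqP ->|/izs[r <-]].
    by exists 'X; rewrite /= map_polyX /horner_eval hornerX.
  by exists r%:P; rewrite /= map_polyC /horner_eval hornerC.
- move=> /(chevalley Kc)[q1 [iq1 ext1]]; have [q0 [iq0 ext0]] := ext _ iq1.
  exists q0; split=> // phi0 ker0 phi0q;
    have [phi [phib ker phiq]] := ext0 _ ker0 phi0q.
  have [zeta [kerz nz]] := ext1 _ ker phiq.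
  exists (horner_eval zeta \o map_poly phi : {rmorphism {poly R} -> K}).
  by split=> // r; rewrite /= map_polyC /= /horner_eval hornerC.
Qed.

(** A form of the Nullstellensatz: over the base [K] the condition [q0] is a nonzero scalar, so the
    identity of [K] extends to a retraction [phi]. *)
Lemma specialization (F K : fieldType) (j : {rmorphism K -> F}) (zs : seq F) :
  alg_closed K ->
  exists (R : idomainType) (b : {rmorphism K -> R}) (i : {rmorphism R -> F})
    (phi : {rmorphism R -> K}),
  [/\ forall r, i (b r) = j r, forall z, z \in zs -> exists r, i r = z,
   forall r, phi (b r) = r & kills_kernel i phi].
Proof.
move=> Kc; have [R [b [i [ib izs ext]]]] := @spreading_out F K K j zs Kc.
have [|q0 [jq0]] := ext 1; first by rewrite rmorph1 oner_eq0.
move=> /(_ idfun)[r /eqP|/=|phi [phib ker _]].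
- by rewrite fmorph_eq0 => /eqP.
- by apply: contraNneq jq0 => ->; rewrite rmorph0.
- by exists R, b, i, phi.
Qed.

(** Stands in for an automorphism of [K] over [L] that moves [alpha], defined only on a ring
    covering [alpha] and [zs]. The base ring is [{poly L}], evaluated at [alpha] by [i] and at
    another conjugate by [phi]. *)
Lemma moving_embedding (L K : fieldType) (iota : {rmorphism L -> K}) (alpha : K)
    (zs : seq K) : alg_closed K -> (forall n, n.+1%:R != 0 :> L) ->
  algebraicOver iota alpha -> (forall l, iota l != alpha) ->
  exists (R : idomainType) (b : {rmorphism L -> R}) (i phi : {rmorphism R -> K}),
  [/\ forall l, i (b l) = iota l, forall z, z \in zs -> exists r, i r = z,
   forall l, phi (b l) = iota l, kills_kernel i phi &
   exists2 a, i a = alpha & phi a != alpha].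
Proof.
move=> Kc char0 [p1 p10 rp1] nalpha.
pose ev (p : {poly L}) := (map_poly iota p).[alpha].
have evM p q : ev (p * q) = ev p * ev q by rewrite /ev rmorphM hornerM.
have [p [p0 evp] pmin] : exists2 p, p != 0 /\ ev p = 0 &
    forall q, q != 0 -> ev q = 0 -> (size p <= size q)%N.
  have ex : exists n, `[< exists t, [/\ t != 0, ev t = 0 & size t = n] >].
    by exists (size p1); apply/asboolP; exists p1; split=> //; apply/rootP.
  case: (ex_minnP ex) => n /asboolP[t [t0 evt <-]] tmin.
  exists t => // q q0 evq; apply: tmin; apply/asboolP; by exists q.
(* The degree is at least two because [alpha] is not in the image of [L]. *)
have sp : (2 < size p)%N.
  rewrite ltnNge; apply/negP => sp.
  have [a [c pE]] : exists a c, p = a *: 'X + c%:P.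
    exists p`_1, p`_0; apply/polyP => l; rewrite coefD coefZ coefX coefC.
    case: l => [|[|l]] /=; rewrite ?mulr0 ?mulr1 ?add0r ?addr0 //.
    by rewrite nth_default // (leq_trans sp).
  move: evp; rewrite /ev pE rmorphD /= map_polyZ /= map_polyX map_polyC hornerD.
  rewrite hornerZ hornerX hornerC => e.
  have a0 : a != 0.
    apply/eqP => a0; move: e p0; rewrite pE a0 rmorph0 mul0r add0r => /eqP.
    by rewrite fmorph_eq0 => /eqP ->; rewrite scale0r addr0 eqxx.
  have /eqP[] := nalpha (- c / a); rewrite rmorphM fmorphV rmorphN.
  apply: (mulIf (x := iota a)); first by rewrite fmorph_eq0.
  rewrite mulfVK ?fmorph_eq0 // mulrC; apply/esym/eqP.
  by rewrite -addr_eq0 e.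
have [g gE] : exists g, map_poly iota p = g * ('X - alpha%:P).
  by apply/factor_theorem/rootP.
(* The value of [g] at [alpha] is that of the derivative of [p], which is nonzero by minimality in
   characteristic zero. So every root of [g] is a conjugate other than [alpha]. *)
have galpha : g.[alpha] != 0.
  have : ev p^`() != 0.
    have d0 : p^`() != 0.
      apply/eqP => /(congr1 (fun q : {poly L} => q`_(size p).-2)).
      rewrite coef_deriv coef0 -mulr_natr => /eqP; rewrite mulf_eq0.
      have -> : (size p).-2.+1 = (size p).-1 by case: (size p) sp => [|[|]].
      rewrite -lead_coefE lead_coef_eq0 (negPf p0) /=.
      by case: (size p) sp => [|[|n]] //= _; apply/negP/char0.
    apply: contraTneq (lt_size_deriv p0) => evd; rewrite -leqNgt; exact: pmin.
  by rewrite /ev -deriv_map gE derivM hornerD !hornerM derivXsubC hornerXsubC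
     subrr mulr0 add0r hornerC mulr1.
have sg : (1 < size g)%N.
  have g0 : g != 0 by apply: contraNneq galpha => ->; rewrite horner0.
  have : size (map_poly iota p) = size p by rewrite size_map_poly.
  by rewrite gE size_Mmonic ?monicXsubC // size_XsubC addn2 /= => e; rewrite -ltnS e.
have [alpha' ra'] := @Kc g sg.
have na : alpha' != alpha.
  by apply: contraNneq galpha => e; move: ra'; rewrite e => /rootP ->.
have pa' : (map_poly iota p).[alpha'] = 0 by rewrite gE hornerM (rootP ra') mul0r.
pose i0 : {rmorphism {poly L} -> K} := horner_eval alpha \o map_poly iota.
pose phi0 : {rmorphism {poly L} -> K} := horner_eval alpha' \o map_poly iota.
have ker0 : kills_kernel i0 phi0.
  move=> f evf; have m0 : f %% p = 0.
    have [//|nz] := eqVneq (f %% p) 0.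
    have e : f %% p = f - f %/ p * p by rewrite {2}(divp_eq f p) addrC addKr.
    have := pmin _ nz; rewrite leqNgt ltn_modp p0 => h; apply/eqP.
    by have := h _; rewrite {1}e /ev rmorphB rmorphM /= hornerD hornerN hornerM
      -/(ev p) evp mulr0 subr0 => /(_ evf).
  by rewrite (divp_eq f p) m0 addr0 rmorphM /= /horner_eval pa' mulr0.
have [R [b [i [ib izs ext]]]] := @spreading_out K K {poly L} i0 zs Kc.
have [|q0 [iq0 /(_ phi0 ker0)]] := ext 1; first by rewrite rmorph1 oner_eq0.
case.
  (* By minimality of [p], the polynomial [q0], nonzero at [alpha], is coprime to [p], so it cannot
     vanish at the conjugate either. *)
  apply/negP => /eqP q0a'.
  have : coprimep p q0.
    rewrite /coprimep eqn_leq size_poly_gt0 gcdp_eq0 negb_and p0 andbT.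
    have /dvdpP[e pE] := dvdp_gcdl p q0; have /dvdpP[f qE] := dvdp_gcdr p q0.
    have /eqP : ev e * ev (gcdp p q0) = 0 by rewrite -evM -pE.
    rewrite mulf_eq0 => /orP[/eqP eva|/eqP da].
      have e0 : e != 0 by apply: contraNneq p0 => e0; rewrite pE e0 mul0r.
      have d0 : gcdp p q0 != 0 by rewrite gcdp_eq0 negb_and p0.
      have h := pmin _ e0 eva; rewrite {1}pE size_mul // in h.
      rewrite -(leq_add2l (size e)) addn1.
      by move: h; case: (size e + _)%N.
    by move: iq0; rewrite /i0 /= /horner_eval -/(ev q0) qE evM da mulr0 eqxx.
  rewrite -(coprimep_map iota) => /coprimep_root/(_ (introT rootP pa')).
  by rewrite -[_.[_]]/(phi0 q0) q0a' eqxx.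
move=> phi [phib ker _]; exists R, (b \o polyC : {rmorphism L -> R}), i, phi.
split=> // [l|l|]; first by rewrite /= ib /= map_polyC /horner_eval hornerC.
  by rewrite /= phib /= map_polyC /horner_eval hornerC.
exists (b 'X); first by rewrite ib /= map_polyX /horner_eval hornerX.
by rewrite phib /= map_polyX /horner_eval hornerX.
Qed.

(** * Idempotents in an extension of scalars *)

Section Idempotents.
Variables (k : fieldType) (A : comAlgType k) (n : nat) (h : 'I_n -> A).

Definition tens_comb (F : fieldType) (s : {rmorphism k -> F}) (z : 'I_n -> F) :
    tens s A :=
  \sum_i tensl s A (h i) * tensr s A (z i).

Lemma tens_ev_comb (F : fieldType) (s : {rmorphism k -> F}) psi z :
  linear_form psi ->
  tens_ev psi (tens_comb s z) = \sum_i s (psi (h i)) * z i.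
Proof.
by move=> psiP; rewrite tens_ev_sum //; apply: eq_bigr => i _; rewrite tens_ev_pure.
Qed.

Definition idempotent_comb (F : fieldType) (s : {rmorphism k -> F}) z : Prop :=
  tens_comb s z * tens_comb s z = tens_comb s z.

(** Each linear form yields a polynomial equation in the coordinates with coefficients in [k], which
    is why specializations over [k] preserve idempotents. *)
Lemma idempotent_combP (F : fieldType) (s : {rmorphism k -> F}) z :
  idempotent_comb s z <-> forall psi, linear_form psi ->
    \sum_i \sum_j s (psi (h i * h j)) * (z i * z j) = \sum_i s (psi (h i)) * z i.
Proof.
have sq psi : linear_form psi -> tens_ev psi (tens_comb s z * tens_comb s z) =
    \sum_i \sum_j s (psi (h i * h j)) * (z i * z j).
  move=> psiP; rewrite /tens_comb mulr_suml tens_ev_sum //; apply: eq_bigr => i _.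
  rewrite mulr_sumr tens_ev_sum //; apply: eq_bigr => j _.
  by rewrite mulrACA -!rmorphM tens_ev_pure.
split=> [zz psi psiP|zz]; first by rewrite -sq // zz tens_ev_comb.
by apply: tens_ext => psi psiP; rewrite sq // zz // tens_ev_comb.
Qed.

Lemma idempotent_comb_map (F F' : fieldType) (s : {rmorphism k -> F})
    (s' : {rmorphism k -> F'}) (R : nzRingType) (b : k -> R)
    (i : {rmorphism R -> F}) (phi : {rmorphism R -> F'}) (z : 'I_n -> R) :
  (forall c, i (b c) = s c) -> (forall c, phi (b c) = s' c) ->
  kills_kernel i phi -> idempotent_comb s (i \o z) ->
  idempotent_comb s' (phi \o z).
Proof.
move=> ib phib ker /idempotent_combP zz; apply/idempotent_combP => psi psiP.
pose d := \sum_l \sum_m b (psi (h l * h m)) * (z l * z m) - \sum_l b (psi (h l)) * z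
  l.
have dE (E : fieldType) (t : {rmorphism k -> E}) (f : {rmorphism R -> E}) :
    (forall c, f (b c) = t c) ->
    f d = \sum_l \sum_m t (psi (h l * h m)) * (f (z l) * f (z m))
          - \sum_l t (psi (h l)) * f (z l).
  move=> fb; rewrite rmorphB !rmorph_sum; congr (_ - _).
    apply: eq_bigr => l _; rewrite rmorph_sum; apply: eq_bigr => m _.
    by rewrite !rmorphM fb.
  by apply: eq_bigr => l _; rewrite rmorphM fb.
have /ker/eqP : i d = 0 by rewrite (dE _ _ _ ib) (zz psi psiP) subrr.
by rewrite (dE _ _ _ phib) subr_eq0 => /eqP.
Qed.

(* If x is idempotent with specialization y, then d = x - y satisfies d^3 = d;
   the coordinates of d then satisfy delta = M delta where M has coefficients
   in the kernel of the specialization, whence delta = 0. *)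
Lemma idempotent_comb_descent (K F : fieldType) (j0 : {rmorphism k -> K})
    (j : {rmorphism K -> F}) (s : {rmorphism k -> F}) (z : 'I_n -> F) :
  alg_closed K -> (forall c, s c = j (j0 c)) -> independent h ->
  idempotent_comb s z -> exists kappa : 'I_n -> K, z =1 j \o kappa.
Proof.
move=> Kc sE hind zz.
have [R [b [i [phi [ib iz phib ker]]]]] := specialization j (codom z) Kc.
have /choice[zeta zetaE] : forall l, exists r, i r = z l.
  by move=> l; apply/iz/codom_f.
pose kappa l := phi (zeta l); exists kappa.
pose delta l := zeta l - b (kappa l).
suff i0 : forall l, i (delta l) = 0.
  by move=> m; have /eqP := i0 m; rewrite rmorphB zetaE ib subr_eq0 => /eqP.
have yy : idempotent_comb s (j \o kappa).
  apply: (@idempotent_comb_map K F j0 s K j0 idfun j kappa) => // [r /= ->|].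
    by rewrite rmorph0.
  apply: (@idempotent_comb_map F K s j0 R (b \o j0) i phi zeta) => // [c|c|] /=.
  - by rewrite ib sE.
  - by rewrite phib.
  - suff e : tens_comb s (i \o zeta) = tens_comb s z by rewrite /idempotent_comb e.
    by apply: eq_bigr => l _; rewrite /= zetaE.
pose x := tens_comb s z; pose y := tens_comb s (j \o kappa).
have dE : x - y = tens_comb s (i \o delta).
  rewrite /x /y /tens_comb -sumrB; apply: eq_bigr => m _.
  rewrite -mulrBr -rmorphB; congr (_ * tensr s A _).
  by rewrite /delta /= rmorphB zetaE ib.
have d3 : (x - y) * ((x - y) * (x - y)) = x - y.
  have xx : x * x = x by []; have yy' : y * y = y by [].
  have -> : (x - y) * ((x - y) * (x - y)) =
      x * x * x - (x * x) * y *+ 3 + x * (y * y) *+ 3 - y * y * y by ring.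
  by rewrite !(xx, yy'); ring.
have /choice[psi psiP] l := dual_form l hind.
pose M : 'M[R]_n := \matrix_(a, l)
  \sum_p \sum_q b (j0 (psi l (h a * (h p * h q)))) * (delta p * delta q).
have tensM a c w v : tensl s A a * tensr s A w * (tensl s A c * tensr s A v) =
    tensl s A (a * c) * tensr s A (w * v) by rewrite mulrACA -!rmorphM.
have Mdelta : (\row_a i (delta a)) *m (1%:M - map_mx i M) = 0.
  rewrite mulmxBr mulmx1; apply/rowP=> l; rewrite !mxE.
  have [psil psilh] := psiP l.
  have := congr1 (tens_ev (psi l)) d3; rewrite dE tens_ev_comb // => e.
  have -> : i (delta l) = \sum_a s (psi l (h a)) * i (delta a).
    rewrite (bigD1 l) //= psilh eqxx rmorph1 mul1r big1 ?addr0 // => a /negPf al.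
    by rewrite psilh al rmorph0 mul0r.
  rewrite -e; apply/eqP; rewrite subr_eq0; apply/eqP.
  rewrite {1}/tens_comb mulr_suml tens_ev_sum //; apply: eq_bigr => a _.
  rewrite !mxE rmorph_sum {1}/tens_comb mulr_suml !mulr_sumr tens_ev_sum //.
  apply: eq_bigr => p _; rewrite rmorph_sum !mulr_sumr tens_ev_sum //.
  apply: eq_bigr => q _; rewrite /= !tensM tens_ev_pure // mulrCA.
  by rewrite !(rmorphM i) ib -sE.
(* Since [phi] kills the entries of [M], it sends the determinant of [1 - M] to 1; by [ker], that
   determinant is not in the kernel of [i]. *)
have det0 : \det (1%:M - map_mx i M) != 0.
  have -> : 1%:M - map_mx i M = map_mx i (1%:M - M) by rewrite map_mxB map_mx1.
  rewrite det_map_mx; apply/eqP => /ker; rewrite -det_map_mx.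
  rewrite map_mxB map_mx1 (_ : map_mx phi M = 0) ?subr0 ?det1.
    by move/eqP; rewrite oner_eq0.
  apply/matrixP=> a c; rewrite !mxE rmorph_sum big1 // => p _.
  rewrite rmorph_sum big1 // => q _; rewrite !rmorphM rmorphB !phib /kappa.
  by rewrite subrr mul0r mulr0.
move=> l; have Mu : 1%:M - map_mx i M \in unitmx by rewrite unitmxE unitfE.
have := mulmxK Mu (\row_a i (delta a)); rewrite Mdelta mul0mx => /rowP/(_ l).
by rewrite !mxE.
Qed.

Section Galois.
Variables (K : fieldType) (iota : {rmorphism k -> K}).
Hypotheses (Kc : alg_closed K) (char0 : forall m, m.+1%:R != 0 :> k).
Hypothesis Kalg : forall a, algebraicOver iota a.

(* The K-span of the idempotents with coefficients in K is stable under
   the Galois group, hence defined over k. *)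
Lemma idempotent_comb_span (y : 'I_n -> K) : idempotent_comb iota y ->
  exists (r m : nat) (b : 'M[k]_(r, n)) (c : 'rV[K]_r)
    (Z : 'M[K]_(r, m)) (Y : 'M[K]_(m, n)),
  [/\ \row_i y i = c *m map_mx iota b, map_mx iota b = Z *m Y &
      forall l, idempotent_comb iota (Y l)].
Proof.
move=> yy.
pose good m (Y : 'M[K]_(m, n)) := forall l, idempotent_comb iota (Y l).
have ex : exists r, `[< exists m (Y : 'M[K]_(m, n)), good m Y /\ \rank Y = r >].
  exists 0%N; apply/asboolP; exists 0%N, 0; split; first by case.
  by rewrite mxrank0.
(* Ranks are bounded by [n], so a finite family of idempotents of maximal rank spans all of them. *)
have [|r /asboolP[m [Y [Yg rY]]] rmax] := ex_maxnP ex (m := n).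
  by move=> r /asboolP[m [Y [_ <-]]]; apply: rank_leq_col.
have Yspan y' : idempotent_comb iota y' -> (\row_i y' i <= Y)%MS.
  move=> y'y'; pose W := col_mx Y (\row_i y' i).
  have /andP[YW yW] : (Y <= W)%MS && (\row_i y' i <= W)%MS by rewrite -col_mx_sub.
  have WY : (\rank W <= \rank Y)%N.
    rewrite rY; apply: rmax; apply/asboolP; exists (m + 1)%N, W; split=> // l.
    case: (split_ordP l) => l' ->.
      suff -> : W (lshift 1 l') = Y l' by apply: Yg.
      by apply/funext=> i; rewrite col_mxEu.
    suff -> : W (rshift m l') = y' by [].
    by apply/funext=> i; rewrite col_mxEd mxE.
  by apply: submx_trans yW _; rewrite -(geq_leqif (mxrank_leqif_sup YW)).
have full : row_full (row_base Y)^T.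
  by rewrite /row_full mxrank_tr eq_row_base eqxx.
(* The matrix [B] built from [D] is a reduced echelon form: the only basis of the row space that is
   the identity on the columns selected by [f]. Uniqueness makes it invariant. *)
pose f := fullrankfun full; pose D := colsub f (row_base Y).
have Du : D \in unitmx.
  have -> : D = (rowsub f (row_base Y)^T)^T by apply/matrixP=> u v; rewrite !mxE.
  by rewrite unitmx_tr fullrowsub_unit.
pose B := invmx D *m row_base Y.
have Bf : colsub f B = 1%:M by rewrite -mulmx_colsub mulVmx.
have YB : (Y <= B)%MS.
  by rewrite -(eq_row_base Y) -[row_base Y]mul1mx -(mulmxV Du) -mulmxA submxMl.
have BY : (B <= Y)%MS by rewrite -(eq_row_base Y) submxMl.
have /submxP[Z BE] := BY.
(* A specialization moving the entry [B u v] carries idempotents to idempotents, so the specialized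
   matrix is [E *m B] for some [E]. The columns selected by [f] force [E] to be 1, so the entry did
   not move. *)
have rational u v : exists l, iota l = B u v.
  apply: contrapT => nl.
  have nl' l : iota l != B u v by apply/eqP => e; apply: nl; exists l.
  pose zs := codom (fun p : 'I_m * 'I_n => Y p.1 p.2) ++
             codom (fun p : 'I_(\rank Y) * 'I_m => Z p.1 p.2).
  have [R [b0 [i [phi [ib izs phib ker [a ia phia]]]]]] :=
    moving_embedding zs Kc char0 (Kalg (B u v)) nl'.
  have /choice[Yt YtE] : forall p : 'I_m * 'I_n, exists t, i t = Y p.1 p.2.
    by move=> p; apply: izs; rewrite mem_cat (codom_f (fun p => Y p.1 p.2)).
  have /choice[Zt ZtE] : forall p : 'I_(\rank Y) * 'I_m, exists t, i t = Z p.1 p.2.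
    by move=> p; apply: izs; rewrite mem_cat (codom_f (fun p => Z p.1 p.2)) orbT.
  pose Ym := \matrix_(p, q) Yt (p, q); pose Zm := \matrix_(p, q) Zt (p, q).
  have iY : map_mx i Ym = Y by apply/matrixP=> p q; rewrite !mxE YtE.
  have iZ : map_mx i Zm = Z by apply/matrixP=> p q; rewrite !mxE ZtE.
  have iB : map_mx i (Zm *m Ym) = B by rewrite map_mxM iY iZ.
  have phiY : (map_mx phi Ym <= Y)%MS.
    apply/row_subP => l.
    have -> : row l (map_mx phi Ym) = \row_q (phi \o Ym l) q.
      by apply/rowP=> q; rewrite !mxE /= mxE.
    apply: Yspan; apply: (@idempotent_comb_map K K iota iota R b0 i) => //.
    suff -> : i \o Ym l = Y l by [].
    by apply/funext=> q; rewrite /= mxE YtE.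
  have /submxP[E phiB] : (map_mx phi (Zm *m Ym) <= B)%MS.
    by rewrite map_mxM (submx_trans (submxMl _ _)) // (submx_trans phiY).
  have E1 : E = 1%:M.
    have -> : E = colsub f (map_mx phi (Zm *m Ym)).
      by rewrite phiB -mulmx_colsub Bf mulmx1.
    apply/matrixP=> p q; rewrite !mxE.
    have := congr1 (fun X : 'M_(_, _) => X p q) Bf; rewrite -iB !mxE => e.
    have /ker/eqP : i ((Zm *m Ym) p (f q) - (p == q)%:R) = 0.
      by rewrite rmorphB rmorph_nat !mxE e subrr.
    by rewrite rmorphB rmorph_nat subr_eq0 !mxE => /eqP.
  have /ker/eqP : i ((Zm *m Ym) u v - a) = 0.
    by rewrite rmorphB ia -iB [X in _ - X]mxE subrr.
  rewrite rmorphB subr_eq0 => /eqP e; move: phia; rewrite -e.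
  by have := congr1 (fun X : 'M_(_, _) => X u v) phiB; rewrite E1 mul1mx mxE => ->;
    rewrite eqxx.
have /choice[b0 b0E] : forall p : 'I_(\rank Y) * 'I_n, exists l, iota l = B p.1 p.2.
  by move=> p; apply: rational.
have bE : map_mx iota (\matrix_(p, q) b0 (p, q)) = B.
  by apply/matrixP=> p q; rewrite mxE mxE b0E.
have /submxP[c yE] := submx_trans (Yspan _ yy) YB.
by exists (\rank Y), m, (\matrix_(p, q) b0 (p, q)), c, Z, Y; rewrite bE.
Qed.

End Galois.
End Idempotents.

(** * Connected spectra *)

Section Primes.
Variable A : comNzRingType.
Local Open Scope classical_set_scope.

Definition is_ideal (I : set A) : Prop :=
  I 0 /\ forall a x y, I x -> I y -> I (a * x + y).

Lemma is_idealM I a x : is_ideal I -> I x -> I (a * x).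
Proof. by move=> [I0 IP] Ix; rewrite -[_ * _]addr0; apply: IP. Qed.

Lemma Spec_ideal (p : Spec A) : is_ideal [set x | ideal_of p x].
Proof.
by have [p0 _ pP] := ideal_closed p; split=> // a x y px py; apply: pP.
Qed.

(** Krull's argument: an ideal maximal among those containing [I] and disjoint from the
    multiplicative set [S] is prime. *)
Lemma prime_avoiding (I S : set A) : is_ideal I -> S 1 ->
  (forall x y, S x -> S y -> S (x * y)) -> (forall x, S x -> ~ I x) ->
  exists p : Spec A, (forall x, I x -> ideal_of p x) /\ forall x,
    S x -> ~~ ideal_of p x.
Proof.
move=> Iid S1 SM SI.
have [|F [X FX] FP Ftot|D [[Did DS] ID maxD]] :=
    @Zorn_above A [set U | is_ideal U /\ forall x, S x -> ~ U x] I; first by [].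
  split; last by move=> x Sx [Y FY Yx]; have [_ /(_ x Sx)] := FP _ FY; apply.
  split; first by exists X => //; have [[]] := FP _ FX.
  move=> a x y [Y FY Yx] [Z FZ Zy].
  have [YZ|ZY] := Ftot _ _ FY FZ.
    exists Z => //; have [[_ ZP] _] := FP _ FZ; apply: ZP => //; exact: YZ.
  exists Y => //; have [[_ YP] _] := FP _ FY; apply: YP => //; exact: ZY.
have [D0 DP] := Did.
have meet a : ~ D a -> exists d b, D d /\ S (d + b * a).
  move=> Da; apply: contrapT => nS; apply: Da.
  apply: (maxD [set x | exists d b, D d /\ x = d + b * a]).
  - split; first split.
    + by exists 0, 0; rewrite mul0r addr0.
    + move=> c _ _ [d [b [Dd ->]]] [d' [b' [Dd' ->]]].
      by exists (c * d + d'), (c * b + b'); split; [apply: DP|ring].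
    + by move=> x Sx [d [b [Dd xE]]]; apply: nS; exists d, b; rewrite -xE.
  - by move=> x Dx; exists x, 0; rewrite mul0r addr0.
  - by exists 0, 1; rewrite mul1r add0r.
have pcl : idealr_closed (fun x => `[< D x >]).
  split=> [||a x y]; rewrite ?unfold_in; first exact/asboolP.
    by apply/negP => /asboolP/DS; apply.
  by move=> /asboolP Dx /asboolP Dy; apply/asboolP/DP.
have ppr : prime_idealr_closed (fun x => `[< D x >]).
  move=> a b; rewrite !unfold_in => /asboolP Dab.
  have [Da|/meet[d [x [Dd Sd]]]] := pselect (D a).
    by apply/orP; left; apply/asboolP.
  have [Db|/meet[e [y [De Se]]]] := pselect (D b).
    by apply/orP; right; apply/asboolP.
  case: (DS _ (SM _ _ Sd Se)).
  have -> : (d + x * a) * (e + y * b) =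
    e * d + (x * a * e + (x * y) * (a * b) + d * y * b).
    by ring.
  apply: (DP _ _ _ Dd); rewrite -addrA; apply: (DP) => //.
  have -> : x * y * (a * b) + d * y * b = (y * b) * d + (x * y) * (a * b) by ring.
  by apply: DP => //; apply: is_idealM.
exists (Point pcl ppr); split=> x /=; first by move=> Ix; apply/asboolP/ID.
by move=> Sx; apply/negP => /asboolP/DS; apply.
Qed.

Definition ideal_generated (S : set A) : set A :=
  [set x | forall I, is_ideal I -> S `<=` I -> I x].

Lemma ideal_generated_ideal S : is_ideal (ideal_generated S).
Proof.
split=> [I [I0 _]//|a x y Sx Sy I Iid SI].
by have [_ IP] := Iid; apply: IP; [apply: Sx|apply: Sy].
Qed.

Lemma coprime_powers (a b : A) m n : a + b = 1 ->
  exists x y, a ^+ m * x + b ^+ n * y = 1.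
Proof.
move=> ab; have step (c d : A) e : c + d = 1 -> exists x y, c ^+ e * x + d * y = 1.
  move=> cd; elim: e => [|e [x [y IH]]].
    by exists 1, 0; rewrite mulr0 addr0 mulr1.
  exists x, (c ^+ e * x + y).
  have -> : c ^+ e.+1 * x + d * (c ^+ e * x + y) = (c + d) * (c ^+ e * x) + d * y.
    by rewrite exprS; ring.
  by rewrite cd mul1r.
have [x [y xy]] := step a b m ab.
have [u [v uv]] := step (b * y) (a ^+ m * x) n (etrans (addrC _ _) xy).
by exists (x * v), (y ^+ n * u); rewrite -uv exprMn; ring.
Qed.

(** Let a clopen set be V(T) with complement V(S). No prime contains both [S] and [T], so a + b = 1
    with a and b in the two ideals; every prime contains ab, so ab is nilpotent. Suitable multiples
    of powers of a and b are then complementary idempotents. *)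
Lemma connected_specP :
  (forall e : A, e * e = e -> e = 0 \/ e = 1) -> connected_spec A.
Proof.
move=> idem; split.
  have [||x y -> ->|x -> /eqP|p _] := @prime_avoiding [set 0] [set 1].
  - by split=> // a _ _ -> ->; rewrite mulr0 addr0.
  - by [].
  - by rewrite mulr1.
  - by rewrite oner_eq0.
  - by exists p.
move=> U U0 [_ [S ->] US] [C Ccl UC]; rewrite setTI in US; rewrite setTI in UC.
have [T TC] : zariski_open (~` C) by move: Ccl; rewrite -openC => [].
rewrite UC in US *.
have CT : C = vanishing T by rewrite -[C]setCK TC setCK.
pose GS := ideal_generated S; pose GT := ideal_generated T.
have vanE X (p : Spec A) : vanishing X p -> forall x,
  ideal_generated X x -> ideal_of p x.
  by move=> pX x gx; apply: (gx [set x | ideal_of p x] (Spec_ideal p)) => t /pX.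
have [a [b [Sa Tb ab]]] : exists a b, [/\ GS a, GT b & a + b = 1].
  apply: contrapT => n1.
  have [||x y -> ->|x -> [a [b [Sa Tb]]]|p [pI _]] :=
      @prime_avoiding [set x | exists a b, [/\ GS a, GT b & x = a + b]] [set 1].
  - split; first by exists 0, 0; rewrite addr0; split=> // I [].
    move=> c _ _ [a [b [Sa Tb ->]]] [a' [b' [Sa' Tb' ->]]].
    exists (c * a + a'), (c * b + b'); split; last by ring.
      by apply: (ideal_generated_ideal S).2.
    by apply: (ideal_generated_ideal T).2.
  - by [].
  - by rewrite mulr1.
  - by move=> ab; apply: n1; exists a, b.
  - have pT : vanishing T p.
      by move=> t Tt; apply: pI; exists 0, t; rewrite add0r; split=> // I;
        [case|move=> _; apply].
    have pS : vanishing S p.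
      by move=> t St; apply: pI; exists t, 0; rewrite addr0; split=> // I;
        [move=> _; apply|case].
    have : C p by rewrite CT.
    by rewrite US => /(_ pS).
have [n abn] : exists n, (a * b) ^+ n.+1 = 0.
  apply: contrapT => nn.
  have [||_ _ [m ->] [m' ->]|_ [m ->] abm|p [_ pab]] :=
      @prime_avoiding [set 0] [set x | exists m, x = (a * b) ^+ m].
  - by split=> // c _ _ -> ->; rewrite mulr0 addr0.
  - by exists 0%N.
  - by exists (m + m')%N; rewrite exprD.
  - by apply: nn; exists m; rewrite exprS abm mulr0.
  - have := pab (a * b) (ex_intro _ 1%N (esym (expr1 _))); move=> /negP; apply.
    have [Cp|Cp] := pselect (C p).
      by apply: is_idealM (Spec_ideal p) _; apply: vanE Tb; rewrite -CT.
    rewrite mulrC; apply: is_idealM (Spec_ideal p) _; apply: vanE Sa.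
    by move: Cp; rewrite US => /contrapT.
have [x [y xy]] := coprime_powers n.+1 n.+1 ab.
have e0 : (a ^+ n.+1 * x) * (b ^+ n.+1 * y) = 0.
  by rewrite mulrACA -exprMn abn mul0r.
have not1 (p : Spec A) c d : ideal_of p c -> c ^+ n.+1 * d <> 1.
  move=> pc c1; have [_ /negP + _] := ideal_closed p; apply; rewrite unfold_in -c1.
  by rewrite exprSr mulrAC; apply: is_idealM (Spec_ideal p) _.
have : a ^+ n.+1 * x = 0 \/ a ^+ n.+1 * x = 1.
  by apply: idem; rewrite -[RHS]mulr1 -xy mulrDr e0 addr0.
case=> ax.
  have [p Up] := U0; have pb : ideal_of p b.
    by apply: vanE Tb; rewrite -CT -UC.
  by case: (not1 p b y pb); rewrite -xy ax add0r.
apply/seteqP; split=> // p _; apply: contrapT => Cp.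
by case: (not1 p a x) => //; apply: vanE Sa; move: Cp; rewrite US => /contrapT.
Qed.

End Primes.

(** * Objects of the category *)

(* Row vectors, as a vector space of dimension n up to conversion. *)
Definition row_space (K : fieldType) (n : nat) : Type := 'rV[K]_n.

Section RowSpace.
Variables (K : fieldType) (n : nat).
HB.instance Definition _ := GRing.Lmodule.copy (row_space K n) 'rV[K]_n.
Let row_space_axiom : Vector.axiom n (row_space K n).
Proof. by exists id => //; exists id. Qed.
HB.instance Definition _ := Lmodule_hasFinDim.Build K (row_space K n) row_space_axiom.
End RowSpace.

Section Coordinates.
Variables (K : fieldType) (A : comNzRingType) (s : {rmorphism K -> A}).
Implicit Types V W U : vectType K.

Lemma hom_mxE V W (a : 'M[K]_(dim V, dim W)) v :
  (Hom a : 'Hom(V, W)) v = r2v (v2r v *m a).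
Proof. by rewrite unlock. Qed.

Lemma v2r_vb V i : v2r (vb i : V) = delta_mx 0 i.
Proof. by rewrite /vb r2vK. Qed.

Lemma sext_hom_mx V W (f : 'Hom(V, W)) : sext_hom s f = map_mx s (f2mx f).
Proof.
apply/row_matrixP=> i; rewrite rowK /sext -map_row; congr (map_mx s _).
by case: f => a; rewrite hom_mxE r2vK v2r_vb rowE.
Qed.

Lemma sextZ V a (v : V) : sext s (a *: v) = s a *: sext s v.
Proof. by rewrite /sext linearZ map_mxZ. Qed.

(** Serves to read coordinates in spaces such as [L^o] or a tensor product, whose basis [vb] is not
    explicit. *)
Lemma form_col V (l : V -> K) : (forall a v w, l (a *: v + w) = a * l v + l w) ->
  exists c : 'cV[K]_(dim V), forall v, sext s v *m map_mx s c = (s (l v))%:M.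
Proof.
move=> lP; exists (\col_i l (vb i)) => v.
have lsum (I : Type) (r : seq I) (a : I -> K) (w : I -> V) :
    l (\sum_(i <- r) a i *: w i) = \sum_(i <- r) a i * l (w i).
  have l0 : l 0 = 0.
    by have := lP 1 0 0; rewrite scaler0 addr0 mul1r -{1}[l 0]addr0 => /addrI.
  by elim: r => [|i r IH]; rewrite ?big_nil // !big_cons lP IH.
apply/rowP=> z; rewrite !mxE !ord1 mulr1n [in RHS](vb_sum v) lsum rmorph_sum.
by apply: eq_bigr => i _; rewrite !mxE rmorphM.
Qed.

Lemma sext_pure V W (v : V) (w : W) :
  sext s (pure v w) = sext_bilin s (@pure _ V W) (sext s v) (sext s w).
Proof.
rewrite [pure v w in LHS]matrix_sum_delta /sext linear_sum map_mx_sum.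
apply: eq_bigr => i _; rewrite linear_sum map_mx_sum; apply: eq_bigr => j _.
rewrite linearZ map_mxZ -vb_pure; congr (_ *: _).
by rewrite !mxE big_ord1 !mxE rmorphM.
Qed.

End Coordinates.

Lemma map_mx_comp_eq (A B C : nzRingType) (f : A -> B) (g : B -> C) (h : A -> C) m n
  (X : 'M[A]_(m, n)) : (forall a, g (f a) = h a) ->
    map_mx g (map_mx f X) = map_mx h X.
Proof. by move=> gfh; apply/matrixP=> i j; rewrite !mxE. Qed.

Section MapCoordinates.
Variables (K : fieldType) (A B : comNzRingType).
Variables (s : {rmorphism K -> A}) (t : {rmorphism K -> B}) (f : {rmorphism A -> B}).
Hypothesis fs : forall c, f (s c) = t c.
Implicit Types V W U : vectType K.

Lemma map_mx_sext V (v : V) : map_mx f (sext s v) = sext t v.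
Proof. exact: map_mx_comp_eq. Qed.

Lemma map_mx_sext_hom V W (g : 'Hom(V, W)) :
  map_mx f (sext_hom s g) = sext_hom t g.
Proof. by rewrite !sext_hom_mx; apply: map_mx_comp_eq. Qed.

Lemma map_mx_sext_bilin V W U (b : V -> W -> U) x y :
  map_mx f (sext_bilin s b x y) = sext_bilin t b (map_mx f x) (map_mx f y).
Proof.
rewrite /sext_bilin map_mx_sum; apply: eq_bigr => i _.
rewrite map_mx_sum; apply: eq_bigr => j _.
by rewrite map_mxZ map_mx_sext !mxE rmorphM.
Qed.

End MapCoordinates.

Section Objects.
Variables (R : realType) (L : fieldType) (iota : {rmorphism L -> Qbar R}).
Local Notation K := (Qbar R).
Local Notation C := R[i].
Local Notation KC := (QbarC R).
Local Notation LC := (LC iota).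

Lemma mxiso_dim (F : fieldType) m n (c : 'M[F]_(m, n)) : mxiso c -> m = n.
Proof.
move=> [d [cd dc]]; apply/eqP; rewrite eqn_leq.
have h p q (a : 'M[F]_(p, q)) (b : 'M[F]_(q, p)) : a *m b = 1%:M -> (p <= q)%N.
  move=> ab; rewrite -(mxrank1 F p) -ab; apply: leq_trans (mxrankM_maxl _ _) _.
  exact: rank_leq_col.
by rewrite (h _ _ _ _ cd) (h _ _ _ _ dc).
Qed.

Definition coord_obj m n (c : 'M[C]_(m, n)) (ciso : mxiso c) : dRB R L :=
  @DRB R L (row_space K m) (row_space L n) c ciso.

Lemma hom_of_mx (M N : dRB R L) (a : 'M[K]_(dim (dR M), dim (dR N)))
    (b : 'M[L]_(dim (B M), dim (B N))) :
  map_mx KC a *m cmp N = cmp M *m map_mx LC b ->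
  exists f : dRB_hom iota M N, hom_dR f = Hom a /\ hom_B f = Hom b.
Proof.
move=> ab; unshelve eexists (@DRBHom _ _ _ _ _ (Hom a) (Hom b) _) => //.
by rewrite !sext_hom_mx.
Qed.

Lemma hom_mx (M N : dRB R L) (f : dRB_hom iota M N) :
  map_mx KC (f2mx (hom_dR f)) *m cmp N = cmp M *m map_mx LC (f2mx (hom_B f)).
Proof. by rewrite -!sext_hom_mx; apply: hom_cmp. Qed.


Lemma tensor_ext (k : fieldType) (A : comNzRingType) (s : {rmorphism k -> A})
    (V W : vectType k) n (X Y : 'M[A]_(dim (tensor V W), n)) :
  (forall (v : V) (w : W), sext s (pure v w) *m X = sext s (pure v w) *m Y) -> X = Y.
Proof.
move=> h; apply: (@sext_ext _ _ s) => t.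
rewrite [t]matrix_sum_delta /sext linear_sum map_mx_sum !mulmx_suml.
apply: eq_bigr => i _; rewrite linear_sum map_mx_sum !mulmx_suml.
apply: eq_bigr => j _; rewrite linearZ map_mxZ -!scalemxAl -vb_pure.
by congr (_ *: _); apply: h.
Qed.

Section Pairing.
Variables (k : fieldType) (V : vectType k).

Let trace (X : 'M[k]_(dim V)) : k^o := \tr X.
Let trace_linear : linear trace.
Proof. by move=> a x y; rewrite /trace linearP. Qed.
HB.instance Definition _ := GRing.isLinear.Build k 'M[k]_(dim V) k^o _ trace
  trace_linear.

(** The evaluation of the dual in coordinates: the pure tensor of x and y is the matrix [x^T *m y],
    and its trace is the scalar product of x and y. *)
Definition pairing : 'Hom(tensor (row_space k (dim V)) V, k^o) :=
  linfun (trace : tensor (row_space k (dim V)) V -> k^o).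

Lemma pairingE (x : row_space k (dim V)) (y : V) :
  pairing (pure x y) = (v2r x *m (v2r y)^T) 0 0.
Proof.
rewrite /pairing lfunE /= /trace /pure mxtrace_mulC /mxtrace big_ord1.
by rewrite -[in RHS](trmxK (v2r x)) -trmx_mul [RHS]mxE.
Qed.

Lemma sext_pairing (A : comNzRingType) (s : {rmorphism k -> A}) x y :
  sext_bilin s (@pure k (row_space k (dim V)) V) x y *m sext_hom s pairing
  = (x *m y^T) 0 0 *: sext s (1 : k^o).
Proof.
rewrite /sext_bilin mxE scaler_suml mulmx_suml; apply: eq_bigr => i _.
rewrite mulmx_suml (bigD1 i) //= big1 ?addr0 => [|j ji].
  rewrite -scalemxAl sext_homE pairingE !v2r_vb trmx_delta mul_delta_mx !mxE.
  by rewrite -[_%:R]/(1 : k^o).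
rewrite -scalemxAl sext_homE pairingE !v2r_vb trmx_delta.
rewrite mul_delta_mx_0; last by rewrite eq_sym.
by rewrite mxE /sext linear0 map_mx0 scaler0.
Qed.

Lemma linfun_hom (U W : vectType k) (f : U -> W) (h : 'Hom(U, W)) : f =1 h ->
  linfun f = h.
Proof. by move=> /funext ->; apply/lfunP => u; rewrite lfunE. Qed.

Lemma pairing_perfect :
  bijective (fun x : row_space k (dim V) =>
    linfun (fun y => pairing (pure x y)) : 'Hom(V, k^o)).
Proof.
pose h (x : row_space k (dim V)) : 'Hom(V, k^o) :=
  Hom ((v2r x : 'rV[k]_(dim V))^T *m v2r (1 : k^o)).
have hE x y : h x y = pairing (pure x y).
  rewrite hom_mxE pairingE mulmxA.
  have -> : v2r y *m (v2r x : 'rV[k]_(dim V))^T = ((v2r x *m (v2r y)^T) 0 0)%:M.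
    by rewrite -[LHS]trmxK trmx_mul trmxK [in LHS](mx11_scalar (_ *m _)) tr_scalar_mx.
  by rewrite mul_scalar_mx linearZ /= v2rK /GRing.scale /= mulr1.
have pE x : linfun (fun y => pairing (pure x y)) = h x.
  by apply: linfun_hom => y; rewrite hE.
have pv x i : h x (vb i) = v2r x 0 i.
  by rewrite hE pairingE v2r_vb trmx_delta -colE mxE.
exists (fun phi : 'Hom(V, k^o) => r2v (\row_i phi (vb i) :
  'rV_(dim (row_space k (dim V))))) => [x|phi].
  by apply: v2r_inj; rewrite r2vK; apply/rowP=> i; rewrite mxE pE pv.
apply/lfunP => y; rewrite (vb_sum y) !linear_sum; apply: eq_bigr => i _.
rewrite pE !linearZ; congr (_ *: _); apply: etrans (pv _ _) _; by rewrite r2vK mxE.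
Qed.

End Pairing.

Lemma cmp_inv (M : dRB R L) : {d | cmp M *m d = 1%:M /\ d *m cmp M = 1%:M}.
Proof. exact/cid/cmp_iso. Qed.

(** The contragredient of [cmp M] is the comparison for which [pairing] is a morphism. *)
Lemma dual_cmp_iso (M : dRB R L) : mxiso (sval (cmp_inv M))^T.
Proof.
case: cmp_inv => d [cd dc] /=; exists (cmp M)^T.
by rewrite -!trmx_mul cd dc !trmx1.
Qed.

Definition dual_obj (M : dRB R L) : dRB R L := coord_obj (dual_cmp_iso M).

Lemma dual_ev_cmp (M : dRB R L) :
  sext_hom KC (pairing (dR M)) *m cmp (dRB_unit iota)
  = cmp (dRB_tensor iota (dual_obj M) M) *m sext_hom LC (pairing (B M)).
Proof.
apply: (@tensor_ext _ _ KC) => x y; rewrite !mulmxA sext_homE pairingE.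
rewrite /= /unit_cmp sext_liftE => [|a v w]; last first.
  by rewrite rmorphD rmorphM scalerDl scalerA.
rewrite sext_pure sext_tensorE /= [RHS]sext_pairing; congr (_ *: _).
case: cmp_inv => d [cd dc] /=; rewrite trmx_mul mulmxA -(mulmxA (sext _ x)) -trmx_mul.
by rewrite cd trmx1 mulmx1 /sext map_trmx -map_mxM [in RHS]mxE.
Qed.

Definition dual_ev (M : dRB R L) :
    dRB_hom iota (dRB_tensor iota (dual_obj M) M) (dRB_unit iota) :=
  @DRBHom R L iota (dRB_tensor iota (dual_obj M) M) (dRB_unit iota)
    (pairing (dR M)) (pairing (B M)) (dual_ev_cmp M).

Lemma dual_ev_dual (M : dRB R L) : is_dual (dual_ev M).
Proof. by split; apply: pairing_perfect. Qed.

Lemma block_mxiso (m1 n1 m2 n2 : nat) (c1 : 'M[C]_(m1, n1)) (c2 : 'M[C]_(m2, n2)) :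
  mxiso c1 -> mxiso c2 -> mxiso (block_mx c1 0 0 c2).
Proof.
move=> [d1 [cd1 dc1]] [d2 [cd2 dc2]]; exists (block_mx d1 0 0 d2).
rewrite !mulmx_block !mulmx0 !mul0mx !addr0 !add0r cd1 dc1 cd2 dc2.
by rewrite -!scalar_mx_block.
Qed.

Definition sum_obj (M N : dRB R L) : dRB R L :=
  coord_obj (block_mxiso (cmp_iso M) (cmp_iso N)).

(** The retractions turn matrix coefficients of a summand into coefficients of the sum; the
    copairing serves to map iterated sums onto an object. *)
Lemma sum_objP (M N : dRB R L) :
  exists (i1 : dRB_hom iota M (sum_obj M N)) (i2 : dRB_hom iota N (sum_obj M N))
    (p1 : dRB_hom iota (sum_obj M N) M) (p2 : dRB_hom iota (sum_obj M N) N),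
  [/\ is_direct_sum i1 i2, f2mx (hom_B i1) *m f2mx (hom_B p1) = 1%:M,
    f2mx (hom_B i2) *m f2mx (hom_B p2) = 1%:M &
    forall Q (q1 : dRB_hom iota M Q) (q2 : dRB_hom iota N Q),
    exists q : dRB_hom iota (sum_obj M N) Q,
      [/\ forall x, hom_dR q (hom_dR i1 x) = hom_dR q1 x,
        forall x, hom_dR q (hom_dR i2 x) = hom_dR q2 x,
        forall x, hom_B q (hom_B i1 x) = hom_B q1 x &
        forall x, hom_B q (hom_B i2 x) = hom_B q2 x]].
Proof.
have [|i1 [i1d i1b]] := @hom_of_mx M (sum_obj M N) (row_mx 1%:M 0) (row_mx 1%:M 0).
  rewrite !map_row_mx !map_mx1 !map_mx0 mul_row_block mul_mx_row !mul1mx !mulmx0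
    !mul0mx.
  by rewrite !addr0 mulmx1.
have [|i2 [i2d i2b]] := @hom_of_mx N (sum_obj M N) (row_mx 0 1%:M) (row_mx 0 1%:M).
  rewrite !map_row_mx !map_mx1 !map_mx0 mul_row_block mul_mx_row !mul1mx !mulmx0
    !mul0mx.
  by rewrite !add0r mulmx1.
have [|p1 [p1d p1b]] := @hom_of_mx (sum_obj M N) M (col_mx 1%:M 0) (col_mx 1%:M 0).
  rewrite !map_col_mx !map_mx1 !map_mx0 mul_block_col mul_col_mx !mulmx1 !mulmx0
    !mul0mx.
  by rewrite !addr0 mul1mx.
have [|p2 [p2d p2b]] := @hom_of_mx (sum_obj M N) N (col_mx 0 1%:M) (col_mx 0 1%:M).
  rewrite !map_col_mx !map_mx1 !map_mx0 mul_block_col mul_col_mx !mulmx1 !mulmx0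
    !mul0mx.
  by rewrite !add0r mul1mx.
exists i1, i2, p1, p2; split; last 1 first.
- move=> Q q1 q2.
  have [|q [qd qb]] := @hom_of_mx (sum_obj M N) Q
      (col_mx (f2mx (hom_dR q1)) (f2mx (hom_dR q2)))
      (col_mx (f2mx (hom_B q1)) (f2mx (hom_B q2))).
    by rewrite !map_col_mx mul_block_col mul_col_mx !hom_mx !mul0mx addr0 add0r.
  have comp (k : fieldType) (U V W : vectType k) (a : 'M_(dim U, dim V))
      (b : 'M_(dim V, dim W)) (g : 'Hom(U, W)) x :
      a *m b = f2mx g -> (Hom b : 'Hom(V, W)) ((Hom a : 'Hom(U, V)) x) = g x.
    by case: g => g /= <-; rewrite !hom_mxE r2vK mulmxA.
  exists q; rewrite qd qb i1d i2d i1b i2b.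
  by split=> x; apply: comp; rewrite mul_row_col mul1mx mul0mx ?addr0 ?add0r.
- have bij (k : fieldType) (V W : vectType k) :
      bijective (fun p : V * W =>
        @Hom k V (row_space k (dim V + dim W)) (row_mx 1%:M 0) p.1 +
        @Hom k W (row_space k (dim V + dim W)) (row_mx 0 1%:M) p.2).
    exists (fun x : row_space k (dim V + dim W) =>
      (r2v (lsubmx (v2r x : 'rV_(dim V + dim W))),
        r2v (rsubmx (v2r x : 'rV_(dim V + dim W))))).
      move=> [v w]; rewrite !hom_mxE !mul_mx_row !mulmx1 !mulmx0 -linearD /= r2vK.
      by rewrite add_row_mx addr0 add0r row_mxKl row_mxKr !v2rK.
    move=> x; rewrite !hom_mxE !mul_mx_row !mulmx1 !mulmx0 -linearD /= !r2vK.
    by rewrite add_row_mx addr0 add0r hsubmxK v2rK.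
  by split; rewrite ?i1d ?i2d ?i1b ?i2b; apply: bij.
- by rewrite i1b p1b mul_row_col mul1mx mul0mx addr0.
- by rewrite i2b p2b mul_row_col mul1mx mul0mx add0r.
Qed.

(** The closure properties shared by the whole category and by [generated M], through which both
    halves of the theorem get a single proof. *)
Record tannakian (P : tensor_subcat iota) : Prop := {
  tannakian_sum : forall N1 N2 S (i1 : dRB_hom iota N1 S) (i2 : dRB_hom iota N2 S),
    is_direct_sum i1 i2 -> P N1 -> P N2 -> P S;
  tannakian_dual : forall N D (ev : dRB_hom iota (dRB_tensor iota D N)
    (dRB_unit iota)),
    is_dual ev -> P N -> P D;
  tannakian_quot : forall N N' (f : dRB_hom iota N N'), is_epi f -> P N -> P N' }.

Lemma whole_tannakian : tannakian (whole_category iota).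
Proof. by []. Qed.

Lemma generated_tannakian M : tannakian (generated_subcat iota M).
Proof.
split=> [N1 N2 S i1 i2|N D ev|N N' f]; first exact: generated_sum.
  exact: generated_dual.
exact: generated_quot.
Qed.

End Objects.

(** * Points and coordinate rings *)

(** Natural indices, with default 0 out of range, allow matrices whose sizes are only
    propositionally equal to be compared without casts. *)
Definition entry (A : nmodType) m n (X : 'M[A]_(m, n)) (i j : nat) : A :=
  if insub i is Some i' then if insub j is Some j' then X i' j' else 0 else 0.

Lemma entryE (A : nmodType) m n (X : 'M[A]_(m, n)) (i : 'I_m) (j : 'I_n) :
  entry X i j = X i j.
Proof. by rewrite /entry !valK. Qed.

Lemma entry_inj (A : nmodType) m n (X Y : 'M[A]_(m, n)) :
  entry X = entry Y -> X = Y.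
Proof. by move=> XY; apply/matrixP=> i j; rewrite -!entryE XY. Qed.

Definition diag_mx1 (A : pzSemiRingType) m n : 'M[A]_(m, n) :=
  \matrix_(i, j) (i == j :> nat)%:R.

Lemma diag_mx1_id (A : nzRingType) n : diag_mx1 A n n = 1%:M.
Proof. by apply/matrixP=> i j; rewrite !mxE. Qed.

Lemma map_diag_mx1 (A B : nzRingType) (f : {rmorphism A -> B}) m n :
  map_mx f (diag_mx1 A m n) = diag_mx1 B m n.
Proof. by apply/matrixP=> i j; rewrite !mxE rmorph_nat. Qed.

Lemma diag_mx1_entry (A : comNzRingType) m n m' n' (X : 'M[A]_(m, n))
  (X' : 'M[A]_(m', n')) :
  m = m' -> n = n' ->
  diag_mx1 A m m' *m X' = X *m diag_mx1 A n n' <-> entry X = entry X'.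
Proof.
move=> em en; move: X'; rewrite -em -en => X'; rewrite !diag_mx1_id mul1mx mulmx1.
by split=> [->|/entry_inj].
Qed.

Section Points.
Variables (R : realType) (L : fieldType) (iota : {rmorphism L -> Qbar R}).
Local Notation C := R[i].

(** Dimensions and comparison matrix determine an object up to isomorphism; a code stands for such a
    class. *)
Definition code : Type := (nat * nat * (nat -> nat -> C))%type.

Definition code_of (M : dRB R L) : code := (dim (dR M), dim (B M), entry (cmp M)).

Lemma code_hom (M M' : dRB R L) : code_of M = code_of M' ->
  exists f : dRB_hom iota M M', f2mx (hom_dR f) = diag_mx1 _ _ _ /\
    f2mx (hom_B f) = diag_mx1 _ _ _.
Proof.
move=> [em en ec].
have [|f [fd fb]] := @hom_of_mx R L iota M M' (diag_mx1 _ _ _) (diag_mx1 _ _ _).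
  by rewrite !map_diag_mx1; apply/diag_mx1_entry.
by exists f; rewrite fd fb.
Qed.

(** What [omega_dR] and [omega_B] have in common: by [ff_code], objects with the same code are
    identified by identity matrices, and by [ff_dual] the evaluation of the dual is a perfect
    pairing with Gram matrix [G]. *)
Record fiber_functor (k : fieldType) (F : tensor_functor iota k) : Prop := {
  ff_dim : forall M, dim (F M) = dim (B M);
  ff_code : forall M M', code_of M = code_of M' -> dim (F M) = dim (F M') /\
    exists f : dRB_hom iota M M', f2mx (fhom F f) = diag_mx1 _ _ _ /\
      f2mx (hom_B f) = diag_mx1 _ _ _;
  ff_dual : forall M, exists G : 'M[k]_(dim (F (dual_obj M)), dim (F M)),
    mxiso G /\ forall d v, fhom F (dual_ev iota M) (ftensor d v)
      = (v2r d *m G *m (v2r v)^T) 0 0 *: funit F }.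

Lemma omega_dR_fiber : fiber_functor (omega_dR iota).
Proof.
split=> [M|M M' MM'|M].
- exact: mxiso_dim (cmp_iso M).
- by split; [case: MM'|apply: code_hom].
- exists 1%:M; split; first by exists 1%:M; rewrite mulmx1.
  by move=> d v; rewrite mulmx1 /= pairingE /GRing.scale /= mulr1.
Qed.

Lemma omega_B_fiber : fiber_functor (omega_B iota).
Proof.
split=> [M|M M' MM'|M] //.
- split; first by case: MM'.
  by have [f [_ fb]] := code_hom MM'; exists f.
- exists 1%:M; split; first by exists 1%:M; rewrite mulmx1.
  by move=> d v; rewrite mulmx1 /= pairingE /GRing.scale /= mulr1.
Qed.

Variables (k : fieldType) (j : {rmorphism L -> k}) (F : tensor_functor iota k).
Variable (P : tensor_subcat iota).

Section PointsOver.
Variables (A : comNzRingType) (s : {rmorphism k -> A}).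

Definition pt_family : Type := forall M, P M -> 'M[A]_(dim (F M), dim (B M)).

Local Notation sB := (s \o j : {rmorphism L -> A}).

(** Tensor transformations from F to [omega_B] over [A]. With [k = Qbar] and [j = iota] these are
    the points of the torsor, with [k = L] and [j] the identity those of the group. The target keeps
    the coordinates of [B M], which avoids [base_change]; invertibility comes from [pt_iso]. *)
Record is_pt (theta : pt_family) : Prop := {
  pt_natural : forall M N (PM : P M) (PN : P N) (f : dRB_hom iota M N),
    sext_hom s (fhom F f) *m theta N PN = theta M PM *m sext_hom sB (hom_B f);
  pt_tensor : forall M N (PM : P M) (PN : P N) (v : F M) (w : F N),
    sext s (ftensor v w) *m theta _ (subcat_tensor PM PN)
    = sext_bilin sB (@pure _ (B M) (B N)) (sext s v *m theta M PM)
      (sext s w *m theta N PN);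
  pt_unit : sext s (funit F) *m theta _ (subcat_unit P) = sext sB (1 : L^o) }.

Lemma pt_entry theta M M' (PM : P M) (PM' : P M') : fiber_functor F -> is_pt theta ->
  code_of M = code_of M' -> entry (theta M PM) = entry (theta M' PM').
Proof.
move=> FF thetaP MM'; have [dF [f [fF fB]]] := ff_code FF MM'.
have [dM' dB' _] := MM'.
apply/diag_mx1_entry => //; rewrite -(map_diag_mx1 s) -(map_diag_mx1 sB).
by have := pt_natural thetaP PM PM' f; rewrite !sext_hom_mx fF fB.
Qed.

Lemma pt_tensor_bilin theta M N (PM : P M) (PN : P N) x y : is_pt theta ->
  sext_bilin s (@ftensor _ _ _ _ F M N) x y *m theta _ (subcat_tensor PM PN)
  = sext_bilin sB (@pure _ (B M) (B N)) (x *m theta M PM) (y *m theta N PN).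
Proof.
move=> thetaP; rewrite (mulmx_sum_row x) (mulmx_sum_row y) sext_bilin_sum.
rewrite mulmx_suml; apply: eq_bigr => i _; rewrite mulmx_suml; apply: eq_bigr => l _.
by rewrite -scalemxAl (pt_tensor thetaP) !sext_vb -!rowE.
Qed.

Lemma right_inverse_mxiso m n (X : 'M[A]_(m, n)) Y : m = n -> X *m Y = 1%:M ->
  mxiso X.
Proof.
move=> e; move: X Y; rewrite e => X Y XY; exists Y; split=> //; exact: mulmx1C.
Qed.

Lemma sext1_cancel (a b : A) :
  a *: sext sB (1 : L^o) = b *: sext sB (1 : L^o) -> a = b.
Proof.
have [|c cP] := @form_col L A sB L^o (fun x => x) ; first by [].
move=> /(congr1 (fun x => (x *m map_mx sB c) 0 0)).
by rewrite -!scalemxAl !cP !mxE rmorph1 !mulr1.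
Qed.

(** Naturality along the evaluation of the dual says that the matrix at the dual times the transpose
    of the matrix at [M] is [G]. So the matrix at [M] has a one-sided inverse, and it is square. *)
Lemma pt_iso theta M (PM : P M) : fiber_functor F -> is_pt theta ->
  (forall N, P N -> P (dual_obj N)) -> mxiso (theta M PM).
Proof.
move=> FF thetaP Pdual; have [G [[H [_ HG]] GE]] := ff_dual FF M.
pose PD := Pdual _ PM; pose D := dual_obj M.
have key : map_mx s G = theta D PD *m (theta M PM)^T.
  apply/matrixP=> i l; apply: sext1_cancel.
  have := pt_natural thetaP (subcat_tensor PD PM) (subcat_unit P) (dual_ev iota M).
  move=> /(congr1 (fun X => sext s (ftensor (vb i : F D) (vb l : F M)) *m X)).
  rewrite !mulmxA sext_homE GE sextZ -scalemxAl (pt_unit thetaP).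
  rewrite (pt_tensor thetaP) [X in _ = X -> _]sext_pairing !sext_vb -!rowE !v2r_vb.
  rewrite trmx_delta -colE -rowE !mxE => ->; congr (_ *: _).
  by apply: eq_bigr => a _; rewrite !mxE.
apply: (@right_inverse_mxiso _ _ _ (map_mx s H *m theta D PD)^T (ff_dim FF M)).
by rewrite -[theta M PM]trmxK -trmx_mul -mulmxA -key -map_mxM HG map_mx1 trmx1.
Qed.

End PointsOver.

Lemma is_pt_ext (A : comNzRingType) (s s' : {rmorphism k -> A}) theta :
  s =1 s' -> is_pt s theta -> is_pt s' theta.
Proof.
move=> ss' [tn tt tu].
have se (V : vectType k) (v : V) : sext s' v = sext s v.
  by rewrite /sext; apply/rowP=> i; rewrite !mxE ss'.
have seB (V : vectType L) (v : V) : sext (s' \o j) v = sext (s \o j) v.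
  by rewrite /sext; apply/rowP=> i; rewrite !mxE /= ss'.
have she (V W : vectType k) (f : 'Hom(V, W)) : sext_hom s' f = sext_hom s f.
  by apply/row_matrixP=> i; rewrite !rowK se.
have sheB (V W : vectType L) (f : 'Hom(V, W)) :
    sext_hom (s' \o j) f = sext_hom (s \o j) f.
  by apply/row_matrixP=> i; rewrite !rowK seB.
have sbe (V W U : vectType L) (b : V -> W -> U) x y :
    sext_bilin (s' \o j) b x y = sext_bilin (s \o j) b x y.
  by apply: eq_bigr => i _; apply: eq_bigr => l _; rewrite seB.
split=> [M N PM PN f|M N PM PN v w|]; first by rewrite she sheB tn.
  by rewrite !se sbe tt.
by rewrite se seB tu.
Qed.

Lemma is_pt_map (A A' : comNzRingType) (f : {rmorphism A -> A'})
    (s : {rmorphism k -> A}) (s' : {rmorphism k -> A'}) theta :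
  (forall c, f (s c) = s' c) -> is_pt s theta ->
  is_pt s' (fun M PM => map_mx f (theta M PM)).
Proof.
move=> fs [tn tt tu].
have fsB c : f ((s \o j) c) = (s' \o j) c by rewrite /= fs.
split=> [M N PM PN g|M N PM PN v w|].
- by rewrite -(map_mx_sext_hom fs) -(map_mx_sext_hom fsB) -!map_mxM tn.
- by rewrite -!(map_mx_sext fs) -!map_mxM tt (map_mx_sext_bilin fsB).
- by rewrite -(map_mx_sext fs) -(map_mx_sext fsB) -map_mxM tu.
Qed.

(* Polynomial expressions in the coordinates of a point; TVar c l m stands for
   the (l, m) entry at the objects with code c. Indexing by codes instead of
   objects keeps this type in the universe of C. *)
Inductive term : Type :=
| TVar of code & nat & nat
| TCst of k
| TOpp of term
| TAdd of term & term
| TMul of term & term.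

Section Evaluation.
Variables (A : comNzRingType) (s : {rmorphism k -> A}).

Definition valuation := code -> nat -> nat -> A.

Fixpoint teval (rho : valuation) (t : term) : A :=
  match t with
  | TVar c l m => rho c l m
  | TCst a => s a
  | TOpp t => - teval rho t
  | TAdd t u => teval rho t + teval rho u
  | TMul t u => teval rho t * teval rho u
  end.

(** An object with code [c] is chosen; by [pt_entry] the choice does not matter when [theta] is a
    point. Codes with no object in [P] get the value 0. *)
Definition val_of (theta : pt_family A) : valuation := fun c l m =>
  if pselect (exists M (PM : P M), code_of M = c) is left h then
    let M := projT1 (cid h) in entry (theta M (projT1 (cid (projT2 (cid h))))) l m
  else 0.

Lemma val_ofE theta M (PM : P M) l m : fiber_functor F -> is_pt s theta ->
  val_of theta (code_of M) l m = entry (theta M PM) l m.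
Proof.
move=> FF thetaP; rewrite /val_of; case: pselect => [h|]; last by case; exists M, PM.
case: (cid h) => M' h' /=; move: (sval _) => PM'.
exact: (congr1 (fun g => g l m) (pt_entry PM' PM FF thetaP
  (let: ex_intro _ e := h' in e))).
Qed.

End Evaluation.

Section CoordinateRing.
Variables (FF : fiber_functor F).
Variables (A0 : comNzRingType) (s0 : {rmorphism k -> A0}) (theta0 : pt_family A0).
Hypothesis theta0P : is_pt s0 theta0.

(** Instead of generating an ideal by the relations of a point, terms are identified when they agree
    at every point over every ring. The given point [theta0] guarantees that 1 differs from 0. *)
Let teq (t u : term) := forall (A : comNzRingType) (s : {rmorphism k -> A})
  (theta : pt_family A), is_pt s theta ->
  teval s (val_of theta) t = teval s (val_of theta) u.

Definition coord_presentation : presentation.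
Proof.
refine (@Presentation term teq (TCst 0) (TCst 1) TOpp TAdd TMul
  _ _ _ _ _ _ _ _ _ _ _ _ _ _ _).
- by [].
- by move=> t u tu A s theta /tu.
- by move=> t u v tu uv A s theta thetaP; rewrite tu ?uv.
- by move=> t u tu A s theta thetaP /=; rewrite tu.
- by move=> t u t' u' tu tu' A s theta thetaP /=; rewrite tu ?tu'.
- by move=> t u t' u' tu tu' A s theta thetaP /=; rewrite tu ?tu'.
- by move=> t u v A s theta _ /=; rewrite addrA.
- by move=> t u A s theta _ /=; rewrite addrC.
- by move=> t A s theta _ /=; rewrite rmorph0 add0r.
- by move=> t A s theta _ /=; rewrite rmorph0 addNr.
- by move=> t u v A s theta _ /=; rewrite mulrA.
- by move=> t u A s theta _ /=; rewrite mulrC.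
- by move=> t A s theta _ /=; rewrite rmorph1 mul1r.
- by move=> t u v A s theta _ /=; rewrite mulrDl.
- by move=> /(_ _ _ _ theta0P) /=; rewrite rmorph0 rmorph1 => /eqP; rewrite oner_eq0.
Defined.

Definition coord_ring : comNzRingType := presented coord_presentation.

Let tpi (t : term) : coord_ring := ppi (t : pcar coord_presentation).
Let cst (c : k) : coord_ring := tpi (TCst c).

Let cst_additive : zmod_morphism cst.
Proof. 
move=> a b; rewrite -ppiN -ppiD; apply/ppiE => A s theta _ /=.
by rewrite rmorphB.
Qed.
Let cst_multiplicative : monoid_morphism cst.
Proof.
split=> [|a b]; first by rewrite -ppi1.
by rewrite -ppiM; apply/ppiE => A s theta _ /=; rewrite rmorphM.
Qed.
HB.instance Definition _ := GRing.isZmodMorphism.Build k coord_ring cst cst_additive.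
HB.instance Definition _ := GRing.isMonoidMorphism.Build k coord_ring cst
  cst_multiplicative.

Definition coord_alg : comAlgType k := algebra_along
  (cst : {rmorphism k -> coord_ring}).

Section EvaluationMorphism.
Variables (A : comNzRingType) (s : {rmorphism k -> A}) (theta : pt_family A).
Hypothesis thetaP : is_pt s theta.

Let ev (a : coord_alg) : A := teval s (val_of theta) (prepr (a : coord_ring)).

Let ev_pi t : ev (tpi t) = teval s (val_of theta) t.
Proof. exact: (@prepr_pi coord_presentation t A s theta thetaP). Qed.

Let ev_additive : zmod_morphism ev.
Proof.
move=> a b; rewrite -(preprK (a : coord_ring)) -(preprK (b : coord_ring)).
by rewrite -ppiN -ppiD !ev_pi.
Qed.
Let ev_multiplicative : monoid_morphism ev.
Proof.
split=> [|a b]; first by rewrite -ppi1 ev_pi /= rmorph1.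
by rewrite -(preprK (a : coord_ring)) -(preprK (b : coord_ring)) -ppiM !ev_pi.
Qed.
HB.instance Definition _ := GRing.isZmodMorphism.Build coord_alg A ev ev_additive.
HB.instance Definition _ := GRing.isMonoidMorphism.Build coord_alg A ev
  ev_multiplicative.

Definition coord_ev : {rmorphism coord_alg -> A} := ev.

Lemma coord_ev_pi t : coord_ev (tpi t) = teval s (val_of theta) t.
Proof. exact: ev_pi. Qed.

End EvaluationMorphism.

Lemma coord_ev_alg (A : comNzRingType) (s : {rmorphism k -> A}) theta
  (H : is_pt s theta) c :
  coord_ev H (in_alg coord_alg c) = s c.
Proof. by rewrite in_alg_along; apply: coord_ev_pi. Qed.

Lemma coord_ext (a b : coord_alg) :
  (forall (A : comNzRingType) (s : {rmorphism k -> A}) theta (H : is_pt s theta),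
     coord_ev H a = coord_ev H b) -> a = b.
Proof.
move=> ab; rewrite -[a](preprK (a : coord_ring)) -[b](preprK (b : coord_ring)).
by apply/ppiE => A s theta H; have := ab _ _ _ H.
Qed.

Definition coord_pt : pt_family coord_alg :=
  fun M PM => \matrix_(i, l) tpi (TVar (code_of M) i l).

Lemma coord_ev_pt (A : comNzRingType) (s : {rmorphism k -> A}) theta
  (H : is_pt s theta) M PM :
  map_mx (coord_ev H) (coord_pt PM) = theta M PM.
Proof.
by apply/matrixP=> i l; rewrite !mxE [LHS]coord_ev_pi /= (val_ofE PM _ _ FF H) entryE.
Qed.

Lemma coord_mx_ext m n (X Y : 'M[coord_alg]_(m, n)) :
  (forall (A : comNzRingType) (s : {rmorphism k -> A}) theta (H : is_pt s theta),
     map_mx (coord_ev H) X = map_mx (coord_ev H) Y) -> X = Y.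
Proof.
move=> XY; apply/matrixP=> i l; apply: coord_ext => A s theta H.
by have /matrixP/(_ i l) := XY A s theta H; rewrite !mxE.
Qed.

(** By [coord_ext] each identity may be checked after evaluation at an arbitrary point, where it is
    the same identity for that point. *)
Lemma coord_ptP : is_pt (in_alg coord_alg) coord_pt.
Proof.
have algB A s theta (H : @is_pt A s theta) c :
    coord_ev H ((in_alg coord_alg \o j) c) = (s \o j) c by apply: coord_ev_alg.
split=> [M N PM PN f|M N PM PN v w|]; apply: coord_mx_ext => A s theta H;
  rewrite !map_mxM ?(map_mx_sext_hom (coord_ev_alg H))
    ?(map_mx_sext_hom (algB _ _ _ H))
    ?(map_mx_sext (coord_ev_alg H)) ?(map_mx_sext_bilin (algB _ _ _ H))
    ?(map_mx_sext (algB _ _ _ H)) ?map_mxM ?(map_mx_sext (coord_ev_alg H))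
      !coord_ev_pt.
- exact: pt_natural.
- exact: pt_tensor.
- exact: pt_unit.
Qed.

Hypothesis PT : tannakian P.

Let spanned (a : coord_alg) := exists M (PM : P M) (X : 'M[k]_(dim (B M), dim (F M))),
  a = \tr (map_mx (in_alg coord_alg) X *m coord_pt PM).

Let spanned_form M (PM : P M) (x : 'rV[k]_(dim (F M))) (y : 'cV[k]_(dim (B M))) :
  spanned ((map_mx (in_alg coord_alg) x *m coord_pt PM *m map_mx (in_alg coord_alg) y)
    0 0).
Proof.
exists M, PM, (y *m x); rewrite map_mxM -[in RHS]mulmxA mxtrace_mulC.
by rewrite /mxtrace big_ord1.
Qed.

Let spannedZ c a : spanned a -> spanned (c *: a).
Proof.
move=> [M [PM [X ->]]]; exists M, PM, (c *: X).
by rewrite map_mxZ -scalemxAl linearZ /= mulr_algl.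
Qed.

Let spanned1 : spanned 1.
Proof.
have [|c cP] := @form_col L coord_alg (in_alg coord_alg \o j) L^o (fun x => x);
  first by [].
have := spanned_form (subcat_unit P) (v2r (funit F)) (map_mx j c).
rewrite -/(sext _ _) (pt_unit coord_ptP).
rewrite (_ : map_mx (in_alg coord_alg) (map_mx j c) =
  map_mx (in_alg coord_alg \o j) c).
  by rewrite cP mxE /= rmorph1 scale1r.
by apply: map_mx_comp_eq.
Qed.

Let spannedD a b : spanned a -> spanned b -> spanned (a + b).
Proof.
move=> [M [PM [X ->]]] [N [PN [Y ->]]].
have [i1 [i2 [p1 [p2 [dsum ip1 ip2 _]]]]] := sum_objP iota M N.
have PS := tannakian_sum PT dsum PM PN.
(* Since [p] retracts [i] on Betti spaces, naturality along [i] rewrites a coefficient of the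
   summand as one of the sum. *)
have retr Q (PQ : P Q) (i : dRB_hom iota Q (sum_obj M N))
  (p : dRB_hom iota (sum_obj M N) Q) Z :
    f2mx (hom_B i) *m f2mx (hom_B p) = 1%:M ->
    \tr (map_mx (in_alg coord_alg) Z *m coord_pt PQ) =
    \tr (map_mx (in_alg coord_alg) (map_mx j (f2mx (hom_B p)) *m Z *m f2mx (fhom F i))
      *m coord_pt PS).
  move=> ip; have := pt_natural coord_ptP PQ PS i; rewrite !sext_hom_mx => nat.
  rewrite !map_mxM -[_ *m coord_pt PS]mulmxA nat -[_ *m _ *m (_ *m _)]mulmxA
    [RHS]mxtrace_mulC -!mulmxA.
  rewrite (map_mx_comp_eq (h := in_alg coord_alg \o j)) // -map_mxM ip.
  by rewrite map_mx1 mulmx1.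
exists _, PS, (map_mx j (f2mx (hom_B p1)) *m X *m f2mx (fhom F i1)
             + map_mx j (f2mx (hom_B p2)) *m Y *m f2mx (fhom F i2)).
rewrite map_mxD mulmxDl linearD /=; congr (_ + _); exact: retr.
Qed.

Let spanned0 : spanned 0.
Proof. by rewrite -(scale0r 1); apply: spannedZ spanned1. Qed.

Let spanned_sum (I : Type) (r : seq I) (f : I -> coord_alg) :
  (forall i, spanned (f i)) -> spanned (\sum_(i <- r) f i).
Proof.
move=> fs; elim: r => [|i r IH]; first by rewrite big_nil; apply: spanned0.
by rewrite big_cons; apply: spannedD.
Qed.

Let spannedM a b : spanned a -> spanned b -> spanned (a * b).
Proof.
move=> [M [PM [X ->]]] [N [PN [Y ->]]].
have key i l i' l' : spanned (coord_pt PM i l * coord_pt PN i' l').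
  have [|c cP] := @form_col L coord_alg (in_alg coord_alg \o j) (tensor (B M) (B N))
      (fun t : 'M_(_, _) => t l l'); first by move=> c t t'; rewrite !mxE.
  have := spanned_form (subcat_tensor PM PN)
    (v2r (ftensor (vb i : F M) (vb i' : F N)))
    (map_mx j c).
  rewrite -/(sext _ _) (pt_tensor coord_ptP) !sext_vb -!rowE.
  rewrite (map_mx_comp_eq (h := in_alg coord_alg \o j)) // /sext_bilin.
  have tE x m m' : (x *: sext (in_alg coord_alg \o j)
    (pure (vb m : B M) (vb m' : B N))
      *m map_mx (in_alg coord_alg \o j) c) 0 0 = x * ((l == m) && (l' == m'))%:R.
    by rewrite -scalemxAl cP vb_pure !mxE mulr1n rmorph_nat.
  rewrite mulmx_suml summxE (bigD1 l) //= mulmx_suml summxE (bigD1 l') //= tE.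
  rewrite !eqxx mulr1 big1 => [|m ml]; last by rewrite tE [l' == m]eq_sym (negPf ml)
    andbF mulr0.
  rewrite big1 => [|m ml]; last first.
    rewrite mulmx_suml summxE big1 // => m' _.
    by rewrite tE [l == m]eq_sym (negPf ml) mulr0.
  by rewrite !addr0 !mxE.
have trE Q (PQ : P Q) Z : \tr (map_mx (in_alg coord_alg) Z *m coord_pt PQ) =
    \sum_i \sum_l Z i l *: coord_pt PQ l i.
  apply: eq_bigr => i _; rewrite mxE; apply: eq_bigr => l _.
  by rewrite [_ i l]mxE mulr_algl.
rewrite !trE mulr_suml; apply: spanned_sum => i; rewrite mulr_suml.
apply: spanned_sum => l; rewrite mulr_sumr; apply: spanned_sum => i'.
rewrite mulr_sumr; apply: spanned_sum => l'; rewrite -scalerAl -scalerAr.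
by do 2!apply: spannedZ; apply: key.
Qed.

(** Induction on terms: constants are coefficients of the unit object, sums come from direct sums
    and products from tensor products. *)
Lemma coord_span a : spanned a.
Proof.
rewrite -[a](preprK (a : coord_ring)); elim:
  (prepr _) => [c l m|c|t IH|t IHt u IHu|t IHt u IHu].
(* Variables whose code has no object in [P], or whose indices are out of range, vanish at every
   point. *)
- have [[M [PM <-]]|nM] := pselect (exists M (_ : P M), code_of M = c); last first.
    suff -> : ppi (TVar c l m : pcar coord_presentation) = 0 :> coord_ring by apply:
      spanned0.
    apply/ppiE => A s theta H /=; rewrite rmorph0 /val_of.
    by case: pselect.
  case: (ltnP l (dim (F M))) => lF; last first.
    suff -> : ppi (TVar (code_of M) l m : pcar coord_presentation) = 0 :> coord_ring.
      exact: spanned0.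
    apply/ppiE => A s theta H /=; rewrite rmorph0 (val_ofE PM _ _ FF H) /entry.
    by case: insubP => // i; rewrite ltnNge lF.
  case: (ltnP m (dim (B M))) => mB; last first.
    suff -> : ppi (TVar (code_of M) l m : pcar coord_presentation) = 0 :> coord_ring.
      exact: spanned0.
    apply/ppiE => A s theta H /=; rewrite rmorph0 (val_ofE PM _ _ FF H) /entry.
    by case: insubP => // i _ _; case: insubP => // i'; rewrite ltnNge mB.
  have := spanned_form PM (delta_mx 0 (Ordinal lF)) (delta_mx (Ordinal mB) 0).
  by rewrite !map_delta_mx -rowE -colE !mxE.
- suff -> : ppi (TCst c : pcar coord_presentation) = c *: 1 :> coord_alg.
    exact/spannedZ/spanned1.
  by apply/esym/mulr1.
- rewrite (_ : ppi _ = - ppi (t : pcar coord_presentation) :> coord_ring);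
    last exact: ppiN.
  by rewrite -[- _](scaleN1r (_ : coord_alg)); apply: spannedZ.
- rewrite (_ : ppi _ = ppi (t : pcar coord_presentation) + ppi
    (u : pcar coord_presentation) :> coord_ring).
    exact: spannedD.
  exact: ppiD.
- rewrite (_ : ppi _ = ppi (t : pcar coord_presentation) * ppi
    (u : pcar coord_presentation) :> coord_ring).
    exact: spannedM.
  exact: ppiM.
Qed.

End CoordinateRing.

(** The targets [A'] are rings with a map from [k] rather than [k]-algebras, because one ring will
    receive points over [L] and points over [Qbar]. *)
Record universal_point (A : comAlgType k) (u : pt_family A) : Prop := {
  universal_is_pt : is_pt (in_alg A) u;
  universal_morphism : forall (A' : comNzRingType) (s : {rmorphism k -> A'}) theta,
    is_pt s theta -> exists f : {rmorphism A -> A'},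
      (forall c, f (in_alg A c) = s c) /\ forall M PM, map_mx f (u M PM) = theta M PM;
  universal_span : forall a, exists M (PM : P M) (X : 'M[k]_(dim (B M), dim (F M))),
    a = \tr (map_mx (in_alg A) X *m u M PM) }.

Lemma universal_point_exists : fiber_functor F -> tannakian P ->
  (exists (A : comNzRingType) (s : {rmorphism k -> A}) theta, is_pt s theta) ->
  exists (A : comAlgType k) (u : pt_family A), universal_point u.
Proof.
move=> FF PT [A0 [s0 [theta0 H0]]]; exists (coord_alg H0), (coord_pt H0).
split; [exact: coord_ptP|move=> A s theta H|exact: coord_span].
exists (coord_ev H0 H); split=> [c|M PM]; first exact: coord_ev_alg.
exact: coord_ev_pt.
Qed.

Lemma universal_morphism_unique (A : comAlgType k) (u : pt_family A)
  (A' : comNzRingType)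
    (f g : {rmorphism A -> A'}) : universal_point u ->
  (forall c, f (in_alg A c) = g (in_alg A c)) ->
  (forall M PM, map_mx f (u M PM) = map_mx g (u M PM)) -> f =1 g.
Proof.
move=> U fg fgu a; have [M [PM [X ->]]] := universal_span U a.
rewrite -!trace_map_mx !map_mxM fgu; congr (\tr (_ *m _)).
by apply/matrixP=> i l; rewrite !mxE.
Qed.

End Points.

(** * Representability *)

Lemma lrmorphism_of (k : comNzRingType) (A B : comAlgType k) (f : {rmorphism A -> B})
  :
  (forall c, f (in_alg A c) = in_alg B c) -> exists g : {lrmorphism A -> B}, g =1 f.
Proof.
move=> fc.
have fZ : scalable f.
  by move=> c a; rewrite -[in LHS]mulr_algl rmorphM [f _]fc /= mulr_algl.
pose fL := HB.pack_for {lrmorphism A -> B} (f : A -> B)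
  (GRing.RMorphism.on f) (GRing.isScalable.Build k A B *:%R f fZ).
by exists fL.
Qed.

Lemma mxisoM (A : comNzRingType) m n p (X : 'M[A]_(m, n)) (Y : 'M[A]_(n, p)) :
  mxiso X -> mxiso Y -> mxiso (X *m Y).
Proof.
move=> [X' [XX' X'X]] [Y' [YY' Y'Y]]; exists (Y' *m X'); split.
  by rewrite mulmxA -(mulmxA X) YY' mulmx1.
by rewrite mulmxA -(mulmxA Y') X'X mulmx1.
Qed.

(* 'rV[k]_n is identified with k^n through the coordinates chosen by its
   vectType structure; J is the matrix of this identification over A. *)
Section RowCoordinates.
Variables (k : fieldType) (A : comNzRingType) (s : {rmorphism k -> A}).

Definition row_coord n : 'M[A]_(n, dim 'rV[k]_n) :=
  \matrix_(i < n) sext s (delta_mx 0 i : 'rV[k]_n).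

Definition row_coord_inv n : 'M[A]_(dim 'rV[k]_n, n) :=
  \matrix_(d < dim 'rV[k]_n) map_mx s (vb d : 'rV[k]_n).

Lemma row_coordE n (x : 'rV[k]_n) : map_mx s x *m row_coord n = sext s x.
Proof.
rewrite mulmx_sum_row [in RHS](row_sum_delta x) /sext linear_sum map_mx_sum.
by apply: eq_bigr => i _; rewrite rowK linearZ map_mxZ mxE.
Qed.

Lemma row_coordK n : row_coord n *m row_coord_inv n = 1%:M.
Proof.
apply/row_matrixP=> i; rewrite row_mul rowK row1 mulmx_sum_row.
rewrite -(map_delta_mx s) [in RHS](vb_sum (delta_mx 0 i : 'rV[k]_n)) map_mx_sum.
by apply: eq_bigr => d _; rewrite rowK map_mxZ mxE.
Qed.

Lemma row_coord_invK n : row_coord_inv n *m row_coord n = 1%:M.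
Proof.
by apply/row_matrixP=> d; rewrite row_mul rowK row_coordE sext_vb row1.
Qed.

Lemma row_coord_iso n : mxiso (row_coord n).
Proof. by exists (row_coord_inv n); rewrite row_coordK row_coord_invK. Qed.

Lemma row_coord_hom m n (X : 'M[k]_(m, n)) :
  row_coord m *m sext_hom s (linfun (mulmxr X) : 'Hom('rV[k]_m, 'rV[k]_n))
  = map_mx s X *m row_coord n.
Proof.
apply/row_matrixP=> i; rewrite row_mul rowK sext_homE lfunE /= -row_coordE.
by rewrite row_mul -map_row rowE.
Qed.

Lemma row_coord_bilin (L : fieldType) (j : {rmorphism L -> k}) (V W U : vectType L)
    (b : V -> W -> U) x y :
  sext_bilin s (sext_bilin j b) (x *m row_coord _) (y *m row_coord _)
  = sext_bilin (s \o j) b x y *m row_coord _.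
Proof.
rewrite (mulmx_sum_row x) (mulmx_sum_row y) sext_bilin_sum mulmx_suml.
apply: eq_bigr => i _; rewrite mulmx_suml; apply: eq_bigr => l _.
rewrite -scalemxAl !rowK; congr (_ *: _).
have pureE v w : sext_bilin s (sext_bilin j b) (sext s v) (sext s w) =
  sext s (sext_bilin j b v w).
  rewrite [in RHS](vb_sum v) [in RHS](vb_sum w) sext_bilin_sum /sext_bilin.
  rewrite [in RHS]/sext linear_sum map_mx_sum; apply: eq_bigr => a _.
  rewrite linear_sum map_mx_sum; apply: eq_bigr => c _.
  by rewrite linearZ map_mxZ !mxE rmorphM.
rewrite pureE sext_bilin_delta -row_coordE; congr (_ *m _).
exact: map_mx_comp_eq.
Qed.

End RowCoordinates.

Lemma map_row_coord (k : fieldType) (A B : comNzRingType) (s : {rmorphism k -> A})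
    (t : {rmorphism k -> B}) (f : {rmorphism A -> B}) n :
  (forall c, f (s c) = t c) -> map_mx f (row_coord s n) = row_coord t n.
Proof.
by move=> fs; apply/row_matrixP=> i; rewrite -map_row !rowK (map_mx_sext fs).
Qed.

Section Representability.
Variables (R : realType) (L : fieldType) (iota : {rmorphism L -> Qbar R}).
Variables (P : tensor_subcat iota) (PT : tannakian P).

Lemma tannakian_dual_obj N : P N -> P (dual_obj N).
Proof. exact/(tannakian_dual PT)/dual_ev_dual. Qed.

Lemma G_represented (A : comAlgType L) (u : pt_family (omega_B iota) P A) :
  universal_point idfun u -> connected_spec A ->
  connected_affine (tensor_iso_functor P (omega_B iota) (omega_B iota)).
Proof.
move=> U Aconn.
have toP (B : comAlgType L) (eta : pt_family (omega_B iota) P B) :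
    is_pt idfun (in_alg B) eta -> is_tensor_iso (F1 := omega_B iota)
      (F2 := omega_B iota) eta.
  move=> H; split.
  - move=> M PM; exact: (pt_iso PM (omega_B_fiber iota) H tannakian_dual_obj).
  - exact: pt_natural H.
  - exact: pt_tensor H.
  - exact: pt_unit H.
exists A, (exist _ u (toP _ _ (universal_is_pt U))); split=> // B [eta etaP].
have H : is_pt idfun (in_alg B) (eta : pt_family (omega_B iota) P B).
  by case: etaP.
have [f [fc fu]] := universal_morphism U H; have [g gf] := lrmorphism_of fc.
have gu M PM : map_mx g (u M PM) = eta M PM.
  by rewrite -fu; apply/matrixP=> i l; rewrite !mxE gf.
exists g; split=> [|h /(congr1 (@proj1_sig _ _)) hu].
  by apply: eq_exist; apply: functional_extensionality_dep => M; apply/funext=> PM;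
    apply: gu.
apply: (universal_morphism_unique U) => [c|M PM]; first by rewrite /= !rmorph_alg.
by rewrite gu; apply: (congr1 (fun e => e M PM) hu).
Qed.

(** Points and tensor isomorphisms towards [base_change] differ only by the identification
    [row_coord]. *)
Lemma Omega_represented (A : comAlgType (Qbar R)) (u : pt_family (omega_dR iota) P A)
  :
  universal_point iota u -> connected_spec A ->
  connected_affine (tensor_iso_functor P (omega_dR iota)
    (base_change iota (omega_B iota))).
Proof.
move=> U Aconn.
have toP (B : comAlgType (Qbar R)) (theta : pt_family (omega_dR iota) P B) :
    is_pt iota (in_alg B) theta ->
    is_tensor_iso (F1 := omega_dR iota) (F2 := base_change iota (omega_B iota))
      (fun M PM => theta M PM *m row_coord (in_alg B) _).
  move=> H; split.
  - move=> M PM; apply: mxisoM (row_coord_iso _ _).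
    exact: (pt_iso PM (omega_dR_fiber iota) H tannakian_dual_obj).
  - move=> M N PM PN f; rewrite mulmxA (pt_natural H) -!mulmxA; congr (_ *m _).
    rewrite [in RHS]/= row_coord_hom; congr (_ *m _).
    by rewrite !sext_hom_mx; apply/esym/map_mx_comp_eq.
  - by move=> M N PM PN v w; rewrite mulmxA (pt_tensor H) !mulmxA row_coord_bilin.
  - rewrite mulmxA (pt_unit H) /= -row_coordE; congr (_ *m _).
    by apply/esym/map_mx_comp_eq.
have ofP (B : comAlgType (Qbar R)) (eta :
  Defs.family P (omega_dR iota) (base_change iota (omega_B iota)) B) :
    is_tensor_iso eta -> is_pt iota (in_alg B)
      ((fun M PM => eta M PM *m row_coord_inv (in_alg B) _) :
        pt_family (omega_dR iota) P B).
  move=> [_ en et eu]; split=> [M N PM PN f|M N PM PN v w|].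
  - rewrite mulmxA en -!mulmxA; congr (_ *m _).
    rewrite -[LHS]mul1mx -(row_coord_invK (in_alg B)) -!mulmxA; congr (_ *m _).
    rewrite mulmxA [in LHS]/= row_coord_hom -mulmxA row_coordK mulmx1 !sext_hom_mx.
    exact: map_mx_comp_eq.
  - rewrite mulmxA et /= -[X in sext_bilin _ _ X _]mulmx1
      -[X in sext_bilin _ _ _ X]mulmx1.
    rewrite -!(row_coord_invK (in_alg B)) !mulmxA row_coord_bilin.
    by rewrite -[LHS]mulmxA row_coordK mulmx1.
  - rewrite mulmxA eu /= -row_coordE -mulmxA row_coordK mulmx1.
    exact: map_mx_comp_eq.
exists A, (exist _ _ (toP _ _ (universal_is_pt U))); split=> // B [eta etaP].
have H := ofP _ _ etaP; have [f [fc fu]] := universal_morphism U H.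
have [g gf] := lrmorphism_of fc.
have gc c : g (in_alg A c) = in_alg B c by rewrite gf.
have gu M PM : map_mx g (u M PM) = eta M PM *m row_coord_inv (in_alg B) _.
  by rewrite -fu; apply/matrixP=> i l; rewrite !mxE gf.
exists g; split=> [|h /(congr1 (@proj1_sig _ _)) hu].
  apply: eq_exist; apply: functional_extensionality_dep => M; apply/funext=> PM.
  rewrite /push_family map_mxM gu (map_row_coord _ gc) -mulmxA row_coord_invK.
  exact: mulmx1.
have hc c : h (in_alg A c) = in_alg B c by rewrite /= rmorph_alg.
apply: (universal_morphism_unique U) => [c|M PM];
  first exact: etrans (hc c) (esym (gc c)).
rewrite gu -[LHS]mulmx1 -(row_coordK (in_alg B)) mulmxA; congr (_ *m _).
rewrite -(map_row_coord _ hc) -map_mxM.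
exact: (congr1 (fun e => e M PM) hu).
Qed.

End Representability.

(** * The comparison isomorphism as a point *)

(** Coordinates are grouped by columns, because the columns of both universal points at [M] are
    indexed by the basis of [B M]. For each [l], the two matrices [X l] will form a morphism from
    [M]. *)
Lemma span_basis_mx (k : fieldType) (A : comAlgType k) m n (G : 'M[A]_(m, n)) :
  exists r (h : 'cV[A]_r) (X : 'I_n -> 'M[k]_(m, r)) (Y : 'I_n -> 'M[k]_(r, m)),
  [/\ independent (fun q => h q 0),
      forall l, col l G = map_mx (in_alg A) (X l) *m h &
      h = \sum_l map_mx (in_alg A) (Y l) *m col l G].
Proof.
have [r [h [X [Y [hind GE hE]]]]] := span_basis (mxvec G 0).
exists r, (\col_q h q), (fun l => \matrix_(i, q) X (mxvec_index i l) q).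
exists (fun l => \matrix_(q, i) Y q (mxvec_index i l)); split=> [|l|].
- by move=> a; rewrite (eq_bigr (fun q => a q *: h q)) => [/hind//|q _]; rewrite mxE.
- apply/colP=> i; rewrite !mxE -mxvecE GE; apply: eq_bigr => q _.
  by rewrite !mxE mulr_algl.
- apply/colP=> q; rewrite mxE hE summxE.
  rewrite (reindex _ (curry_mxvec_bij _ _)) /=.
  pose f i l := Y q (mxvec_index i l) *: mxvec G 0 (mxvec_index i l).
  transitivity (\sum_p f p.1 p.2); first by apply: eq_bigr => -[i l] _.
  rewrite -(pair_bigA _ f) exchange_big; apply: eq_bigr => l _.
  rewrite mxE; apply: eq_bigr => i _.
  by rewrite /f !mxE mxvecE mulr_algl.
Qed.

Section Points.
Variables (R : realType) (L : fieldType) (iota : {rmorphism L -> Qbar R}).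
Variables (P : tensor_subcat iota).
Local Notation K := (Qbar R).
Local Notation C := R[i].
Local Notation KC := (QbarC R).
Local Notation LC := (LC iota).

Definition cmp_pt : pt_family (omega_dR iota) P C := fun M _ => cmp M.

Lemma cmp_ptP : is_pt iota KC cmp_pt.
Proof.
split=> [M N PM PN f|M N PM PN v w|].
- exact: hom_cmp.
- by rewrite /cmp_pt /= sext_pure sext_tensorE.
- rewrite /cmp_pt /= /unit_cmp sext_liftE => [|a x y].
    by rewrite rmorph1 scale1r.
  by rewrite rmorphD rmorphM scalerDl scalerA.
Qed.

Lemma id_ptP : is_pt idfun (idfun : {rmorphism L -> L})
  ((fun M _ => 1%:M) : pt_family (omega_B iota) P L).
Proof.
split=> [M N PM PN f|M N PM PN v w|]; rewrite ?mulmx1 ?mul1mx //.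
exact: sext_pure.
Qed.

Variables (A : comNzRingType) (s : {rmorphism K -> A}).

Lemma comp_ptP (t : {rmorphism L -> A}) (theta : pt_family (omega_dR iota) P A)
    (eta : pt_family (omega_B iota) P A) :
  is_pt iota s theta -> is_pt idfun t eta -> (forall c, t c = s (iota c)) ->
  is_pt iota s ((fun M PM => theta M PM *m eta M PM) : pt_family (omega_dR iota) P A).
Proof.
move=> H E ts; have {}E : is_pt idfun (s \o iota) eta by apply: is_pt_ext E.
split=> [M N PM PN f|M N PM PN v w|].
- by rewrite mulmxA (pt_natural H PM PN) -!mulmxA; congr (_ *m _);
    apply: pt_natural E _ _ _ _ _.
- rewrite mulmxA (pt_tensor H) !mulmxA.
  exact: (pt_tensor_bilin PM PN _ _ E).
- by rewrite mulmxA (pt_unit H); apply: pt_unit E.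
Qed.

(** The difference of two points of the torsor is a point of the group. *)
Lemma inv_comp_ptP (theta eta : pt_family (omega_dR iota) P A)
    (inv : forall M, P M -> 'M[A]_(dim (B M), dim (dR M))) :
  is_pt iota s theta -> is_pt iota s eta ->
  (forall M PM, theta M PM *m inv M PM = 1%:M) ->
  (forall M PM, inv M PM *m theta M PM = 1%:M) ->
  is_pt idfun (s \o iota) ((fun M PM => inv M PM *m eta M PM) :
    pt_family (omega_B iota) P A).
Proof.
move=> H E thetaK invK; split=> [M N PM PN f|M N PM PN v w|].
- have -> : sext_hom (s \o iota) (hom_B f) =
      inv M PM *m sext_hom s (hom_dR f) *m theta N PN.
    by rewrite -mulmxA (pt_natural H PM PN) mulmxA invK mul1mx.
  rewrite -(mulmxA _ (theta N PN)) (mulmxA (theta N PN)) thetaK mul1mx -!mulmxA.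
  by congr (_ *m _); apply: pt_natural E _ _ _ _ _.
- pose X := sext (s \o iota) v *m inv M PM; pose Y := sext (s \o iota) w *m inv N PN.
  have key : sext (s \o iota) (pure v w) *m inv _ (subcat_tensor PM PN) =
      sext_bilin s (@pure _ (dR M) (dR N)) X Y.
    have := pt_tensor_bilin (F := omega_dR iota) PM PN X Y H.
    rewrite -(mulmxA _ (inv M PM)) -(mulmxA _ (inv N PN)) !invK !mulmx1 -sext_pure =>
      <-.
    by rewrite -mulmxA thetaK mulmx1.
  rewrite mulmxA [X in X *m _]key (pt_tensor_bilin PM PN _ _ E).
  by rewrite -!mulmxA.
- rewrite mulmxA -[RHS](pt_unit E) -[sext _ _ in LHS](pt_unit H).
  by rewrite -(mulmxA _ (theta _ _)) thetaK mulmx1.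
Qed.

End Points.

(** * The fields [Qbar] and [L] *)

Section Fields.
Import Num.Theory.
Variables (R : realType) (L : fieldType) (iota : {rmorphism L -> Qbar R}).
Local Notation C := R[i].

Lemma Qbar_alg_closed : alg_closed (Qbar R).
Proof.
move=> p sp; pose f : {rmorphism Qbar R -> C} := QbarC R.
have /closed_rootP[z rz] : size (map_poly f p) != 1%N.
  by rewrite size_map_poly; case: (size p) sp => [|[|]].
have zalg : z \in @algebraic_number R.
  rewrite unfold_in; apply/asboolP/integral_algebraic.
  apply: (@integral_root _ _ _ (map_poly f p)) => //.
    by rewrite map_poly_eq0 -size_poly_gt0 (ltn_trans _ sp).
  apply/integral_poly => i; rewrite coef_map; apply/integral_algebraic.
  by have := complex_ofP p`_i; rewrite unfold_in => /asboolP.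
exists (MkQbar zalg); rewrite /root -(fmorph_eq0 f) -horner_map.
exact: rz.
Qed.

Lemma natr_neq0 n : n.+1%:R != 0 :> L.
Proof. by rewrite -(fmorph_eq0 (LC iota)) rmorph_nat pnatr_eq0. Qed.

(** Denominators are cleared first: a polynomial with integer coefficients maps to any ring, in
    particular to [L]. *)
Lemma Qbar_algebraic (a : Qbar R) : algebraicOver iota a.
Proof.
have := complex_ofP a; rewrite unfold_in => /asboolP[p p0 rp].
have [q [b b0 pE]] := rat_poly_scale p.
have intrE (E E' : nzRingType) (f : {rmorphism E -> E'}) :
    map_poly f (map_poly (intr : int -> E) q) = map_poly (intr : int -> E') q.
  by rewrite -map_poly_comp; apply: eq_map_poly => c /=; rewrite rmorph_int.
have q0 : q != 0 by apply: contraNneq p0 => q0; rewrite pE q0 rmorph0 scaler0.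
exists (map_poly intr q).
  rewrite -(map_poly_eq0 (LC iota)) intrE map_poly_eq0_id0 //.
  by rewrite intr_eq0 lead_coef_eq0.
have := rp; rewrite pE map_polyZ /= (intrE _ _ (ratr : {rmorphism rat -> C})).
rewrite rootZ ?fmorph_eq0 ?invr_eq0 ?intr_eq0 // => /rootP qa.
rewrite intrE /root -(fmorph_eq0 (QbarC R)) -horner_map (intrE _ _ (QbarC R)).
by apply/eqP.
Qed.
End Fields.

Section Comparison.
Variables (R : realType) (L : fieldType) (iota : {rmorphism L -> Qbar R}).
Variables (P : tensor_subcat iota) (PT : tannakian P).
Local Notation K := (Qbar R).
Local Notation C := R[i].
Local Notation KC := (QbarC R).
Local Notation LC := (LC iota).
Variables (A : comAlgType K) (w : pt_family (omega_dR iota) P A).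
Variables (H : comAlgType L) (g : pt_family (omega_B iota) P H).
Hypotheses (UA : universal_point iota w) (UH : universal_point idfun g).

Local Notation T := (tens LC H).
Local Notation T' := (tens KC A).
Local Notation tl := (tensl LC H).
Local Notation tr := (tensr LC H).
Local Notation tl' := (tensl KC A).
Local Notation tr' := (tensr KC A).

(* The torsor Omega is trivialized over C by the comparison isomorphism, which
   identifies O(Omega) (x) C with O(G) (x) C. *)
Lemma comparison_maps : exists (alpha : {rmorphism A -> T})
  (tau : {rmorphism T -> T'}),
  [/\ forall M PM, map_mx alpha (w PM) = map_mx tr (cmp M) *m map_mx tl (g PM),
    forall c, alpha (in_alg A c) = tr (KC c),
    forall a, tau (alpha a) = tl' a & forall z, tau (tr z) = tr' z].
Proof.
have ctr := is_pt_map (s' := tr \o KC) (fun=> erefl) (cmp_ptP P).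
have gtl : is_pt idfun (tl \o in_alg H) (fun M PM => map_mx tl (g PM)).
  by apply: is_pt_map (universal_is_pt UH).
have cg := comp_ptP ctr gtl (tensl_alg LC H).
have [alpha [alphac alphaw]] := universal_morphism UA cg.
pose inv (M : dRB R L) : 'M[T']_(dim (B M), dim (dR M)) :=
  map_mx tr' (sval (cmp_inv M)).
have ctr' := is_pt_map (s' := tr' \o KC) (fun=> erefl) (cmp_ptP P).
have wtl' : is_pt iota (tr' \o KC) (fun M PM => map_mx tl' (w PM)).
  by apply: is_pt_map (universal_is_pt UA); apply: tensl_alg.
(* [tau] extends to [T] the morphism [beta] given by the difference between the comparison and the
   universal point [w]. *)
have cw := inv_comp_ptP (inv := fun M _ => inv M) ctr' wtl'.
have [||beta [betac betag]] := universal_morphism UH (cw _ _).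
- by move=> M PM; have [cd _] := svalP (cmp_inv M); rewrite /inv -map_mxM cd map_mx1.
- by move=> M PM; have [_ dc] := svalP (cmp_inv M); rewrite /inv -map_mxM dc map_mx1.
have [tau [taul taur]] := tens_lift (s := LC) (f := beta) (g := tr') betac.
exists alpha, tau; split=> //.
apply: (universal_morphism_unique (f := tau \o alpha) (g := tl') UA) => [c|M PM].
  exact: etrans (congr1 tau (alphac c)) (etrans (taur _) (esym (tensl_alg _ _ c))).
rewrite map_mx_comp alphaw map_mxM.
rewrite (map_mx_comp_eq (h := tr')) // (map_mx_comp_eq (h := beta)) // betag mulmxA.
have [cd _] := svalP (cmp_inv M).
by rewrite /inv -map_mxM cd map_mx1 mul1mx.
Qed.

End Comparison.

(** * Idempotents are constant *)

Lemma independent_mx (k : fieldType) (A : comAlgType k) r (h : 'cV[A]_r) p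
  (Z : 'M[k]_(p, r)) :
  independent (fun q => h q 0) -> map_mx (in_alg A) Z *m h = 0 -> Z = 0.
Proof.
move=> hind Zh; apply/matrixP=> i q; rewrite mxE.
apply: (hind (Z i)); have /colP/(_ i) := Zh; rewrite !mxE => e; rewrite -[RHS]e.
by apply: eq_bigr => q' _; rewrite !mxE mulr_algl.
Qed.

Lemma tens_independent_mx (k F : fieldType) (s : {rmorphism k -> F})
  (A : comAlgType k) r
    (h : 'cV[A]_r) p (Z : 'M[F]_(p, r)) :
  independent (fun q => h q 0) ->
  map_mx (tensr s A) Z *m map_mx (tensl s A) h = 0 -> Z = 0.
Proof.
move=> hind Zh; apply/matrixP=> i q; rewrite mxE.
apply: (tens_independent (s := s) hind); have /colP/(_ i) := Zh; rewrite !mxE => e;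
  rewrite -[RHS]e.
by apply: eq_bigr => q' _; rewrite !mxE mulrC.
Qed.

Lemma scalar_mx11_inj (A : nzRingType) (x y : A) : x%:M = y%:M :> 'M_1 -> x = y.
Proof. by move=> /matrixP/(_ 0 0); rewrite !mxE. Qed.

Lemma trace_row_col (A : nzRingType) m n (U : 'M[A]_(n, m)) (V : 'M[A]_(m, n)) :
  (\tr (U *m V))%:M = \sum_l row l U *m col l V :> 'M_1.
Proof.
apply/matrixP=> i j; rewrite !ord1 summxE !mxE mulr1n; apply: eq_bigr => l _.
by rewrite !mxE; apply: eq_bigr => k _; rewrite !mxE.
Qed.

Lemma map_mx_mul3 (A B D : nzRingType) (f : {rmorphism A -> B})
  (t : {rmorphism B -> D})
    m n p q r (U : 'M[A]_(m, n)) (V : 'M[A]_(n, p)) (G : 'M[B]_(p, q))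
      (h : 'M[D]_(q, r)) :
  map_mx t (map_mx f (U *m V) *m G) *m h
  = map_mx t (map_mx f U) *m (map_mx t (map_mx f V) *m (map_mx t G *m h)).
Proof. by rewrite !map_mxM !mulmxA. Qed.

Section Subobject.
Variables (R : realType) (L : fieldType) (iota : {rmorphism L -> Qbar R}).
Variables (P : tensor_subcat iota) (PT : tannakian P).

Lemma sum_of_homs (I : eqType) (s : seq I) (M Q : dRB R L) (q : I -> dRB_hom iota M Q)
  :
  P M -> exists N (PN : P N) (f : dRB_hom iota N Q), forall l, l \in s ->
    (forall x, exists y, hom_dR f y = hom_dR (q l) x) /\
    (forall x, exists y, hom_B f y = hom_B (q l) x).
Proof.
move=> PM; elim: s => [|l s [N [PN [f fq]]]].
  (* The unit object with the zero map takes the place of an empty sum. *)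
  have [|f _] := @hom_of_mx R L iota (dRB_unit iota) Q 0 0.
    by rewrite !map_mx0 mul0mx mulmx0.
  by exists (dRB_unit iota), (subcat_unit P), f.
have [i1 [i2 [_ [_ [dsum _ _ copair]]]]] := sum_objP iota M N.
have [f' [f1 f2 f3 f4]] := copair Q (q l) f.
exists _, (tannakian_sum PT dsum PM PN), f' => l';
  rewrite inE => /orP[/eqP ->|/fq[fd fb]].
  by split=> x; [exists (hom_dR i1 x)|exists (hom_B i1 x)].
split=> x; [have [y <-] := fd x|have [y <-] := fb x].
  by exists (hom_dR i2 y).
by exists (hom_B i2 y).
Qed.

Lemma image_sum (k : fieldType) (V W : vectType k) (f : 'Hom(V, W)) n (y : 'I_n -> W)
  :
  (forall l, exists x, f x = y l) -> exists x, f x = \sum_l y l.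
Proof.
by move=> /choice[x xy]; exists (\sum_l x l); rewrite linear_sum;
  apply: eq_bigr => l _; apply: xy.
Qed.

End Subobject.

Section Constancy.
Variables (R : realType) (L : fieldType) (iota : {rmorphism L -> Qbar R}).
Variables (P : tensor_subcat iota) (PT : tannakian P).
Local Notation K := (Qbar R).
Local Notation C := R[i].
Local Notation KC := (QbarC R).
Local Notation LC := (LC iota).
Variables (A : comAlgType K) (w : pt_family (omega_dR iota) P A).
Variables (H : comAlgType L) (g : pt_family (omega_B iota) P H).
Hypotheses (UA : universal_point iota w) (UH : universal_point idfun g).
Local Notation T := (tens LC H).
Local Notation T' := (tens KC A).
Local Notation tl := (tensl LC H).
Local Notation tr := (tensr LC H).
Variables (alpha : {rmorphism A -> T}) (tau : {rmorphism T -> T'}).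
Hypothesis alphaw : forall M PM,
  map_mx alpha (w PM) = map_mx tr (cmp M) *m map_mx tl (g PM).
Hypothesis alphac : forall c, alpha (in_alg A c) = tr (KC c).
Hypothesis taualpha : forall a, tau (alpha a) = tensl KC A a.
Hypothesis taur : forall z, tau (tr z) = tensr KC A z.

Variables (M : dRB R L) (PM : P M).
Local Notation m := (dim (dR M)).
Local Notation n := (dim (B M)).
Variables (r r' : nat) (h : 'cV[H]_r) (a : 'cV[A]_r').
Variables (X : 'I_n -> 'M[L]_(n, r)) (Y : 'I_n -> 'M[L]_(r, n)).
Variables (X' : 'I_n -> 'M[K]_(m, r')) (Y' : 'I_n -> 'M[K]_(r', m)).
Hypothesis hind : independent (fun q => h q 0).
Hypothesis gX : forall l, col l (g PM) = map_mx (in_alg H) (X l) *m h.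
Hypothesis hY : h = \sum_l map_mx (in_alg H) (Y l) *m col l (g PM).
Hypothesis aind : independent (fun q => a q 0).
Hypothesis wX : forall l, col l (w PM) = map_mx (in_alg A) (X' l) *m a.
Hypothesis aY : a = \sum_l map_mx (in_alg A) (Y' l) *m col l (w PM).

Let hT := map_mx tl h.
Let aT := map_mx alpha a.

Let ind_h p (Z : 'M[C]_(p, r)) : map_mx tr Z *m hT = 0 -> Z = 0.
Proof. exact: tens_independent_mx. Qed.

(** Independence over the complex numbers is available in [A] (x) C, where [tau] brings the
    relation. *)
Let ind_a p (Z : 'M[C]_(p, r')) : map_mx tr Z *m aT = 0 -> Z = 0.
Proof.
move=> /(congr1 (map_mx tau)); rewrite map_mxM map_mx0.
rewrite (map_mx_comp_eq (h := tensr KC A)) // (map_mx_comp_eq (h := tensl KC A)) //.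
exact: tens_independent_mx.
Qed.

Let YX : \sum_l Y l *m X l = 1%:M.
Proof.
apply/eqP; rewrite -subr_eq0; apply/eqP/(independent_mx hind).
rewrite map_mxB map_mx1 mulmxBl mul1mx map_mx_sum mulmx_suml [X in _ - X]hY.
rewrite -sumrB big1 // => l _; rewrite map_mxM gX mulmxA subrr //.
Qed.

Let YX' : \sum_l Y' l *m X' l = 1%:M.
Proof.
apply/eqP; rewrite -subr_eq0; apply/eqP/(independent_mx aind).
rewrite map_mxB map_mx1 mulmxBl mul1mx map_mx_sum mulmx_suml [X in _ - X]aY.
rewrite -sumrB big1 // => l _; rewrite map_mxM wX mulmxA subrr //.
Qed.

Let gT l : col l (map_mx tl (g PM)) = map_mx tr (map_mx LC (X l)) *m hT.
Proof.
rewrite -map_col gX map_mxM; congr (_ *m _).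
by apply/matrixP=> i q; rewrite !mxE; apply: tensl_alg.
Qed.

Let wT l : col l (map_mx alpha (w PM)) = map_mx tr (map_mx KC (X' l)) *m aT.
Proof.
rewrite -map_col wX map_mxM; congr (_ *m _).
by apply/matrixP=> i q; rewrite !mxE; apply: alphac.
Qed.

(** The matrix of the basis [aT] in the basis [hT], that is, the comparison of the object [Q] of
    matrix coefficients. *)
Let gamma := \sum_l map_mx KC (Y' l) *m cmp M *m map_mx LC (X l).
Let gamma' := \sum_l map_mx LC (Y l) *m sval (cmp_inv M) *m map_mx KC (X' l).

Let aT_gamma : aT = map_mx tr gamma *m hT.
Proof.
rewrite /aT {1}aY map_mx_sum /gamma map_mx_sum mulmx_suml; apply: eq_bigr => l _.
rewrite !map_mxM map_col alphaw -!mulmxA -gT.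
rewrite (_ : map_mx alpha _ = map_mx tr (map_mx KC (Y' l))); last first.
  by apply/matrixP=> i q; rewrite !mxE; apply: alphac.
congr (_ *m _); apply/colP=> i; rewrite !mxE; apply: eq_bigr => q _; rewrite !mxE //.
Qed.

Let hT_gamma' : hT = map_mx tr gamma' *m aT.
Proof.
rewrite /hT {1}hY map_mx_sum /gamma' map_mx_sum mulmx_suml; apply: eq_bigr => l _.
have [_ dc] := svalP (cmp_inv M).
have gE : map_mx tl (g PM) = map_mx tr (sval (cmp_inv M)) *m map_mx alpha (w PM).
  by rewrite alphaw mulmxA -map_mxM dc map_mx1 mul1mx.
rewrite !map_mxM map_col gE -!mulmxA -wT.
rewrite (_ : map_mx tl _ = map_mx tr (map_mx LC (Y l))); last first.
  by apply/matrixP=> i q; rewrite !mxE; apply: tensl_alg.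
congr (_ *m _); apply/colP=> i; rewrite !mxE; apply: eq_bigr => q _; rewrite !mxE //.
Qed.

Let gamma_iso : mxiso gamma.
Proof.
exists gamma'; split; apply/eqP; rewrite -subr_eq0; apply/eqP.
  apply: ind_a; rewrite map_mxB map_mx1 mulmxBl mul1mx map_mxM -mulmxA.
  by rewrite -hT_gamma' -aT_gamma subrr.
apply: ind_h; rewrite map_mxB map_mx1 mulmxBl mul1mx map_mxM -mulmxA.
by rewrite -aT_gamma -hT_gamma' subrr.
Qed.

(** So [X' l] and [X l] form a morphism from [M] to [Q]: a vector is sent to its matrix coefficient
    against the coordinate [l]. *)
Let compat l : map_mx KC (X' l) *m gamma = cmp M *m map_mx LC (X l).
Proof.
apply/eqP; rewrite -subr_eq0; apply/eqP/ind_h.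
rewrite map_mxB mulmxBl !map_mxM -!mulmxA -aT_gamma -wT -gT alphaw.
by rewrite !colE mulmxA subrr.
Qed.

Let Q : dRB R L := coord_obj L gamma_iso.

(** The morphisms of [compat] are jointly surjective by [YX] and [YX']: a vector y is the sum over l
    of the images of [y *m Y l]. *)
Let PQ : P Q.
Proof.
have /choice[q qE] : forall l, exists f : dRB_hom iota M Q,
    hom_dR f = Hom (X' l : 'M_(_, dim (dR Q))) /\ hom_B f =
      Hom (X l : 'M_(_, dim (B Q))).
  by move=> l; apply: hom_of_mx; apply: compat.
have [N [PN [f fq]]] := sum_of_homs PT (enum 'I_n) q PM.
apply: (tannakian_quot PT (f := f)) PN; split=> y.
  have [l|x xE] := @image_sum _ _ _ (hom_dR f) _
      (fun l => hom_dR (q l) (r2v (v2r y *m Y' l))).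
    by have [fd _] := fq l (mem_enum _ _); apply: fd.
  exists x; rewrite xE; apply: v2r_inj; rewrite linear_sum.
  rewrite -[RHS]mulmx1 -YX' mulmx_sumr; apply: eq_bigr => l _.
  by have [-> _] := qE l; rewrite hom_mxE [LHS]r2vK r2vK mulmxA.
have [l|x xE] := @image_sum _ _ _ (hom_B f) _
    (fun l => hom_B (q l) (r2v (v2r y *m Y l))).
  by have [_ fb] := fq l (mem_enum _ _); apply: fb.
exists x; rewrite xE; apply: v2r_inj; rewrite linear_sum.
rewrite -[RHS]mulmx1 -YX mulmx_sumr; apply: eq_bigr => l _.
by have [_ ->] := qE l; rewrite hom_mxE [LHS]r2vK r2vK mulmxA.
Qed.

(* The unit object maps to Q with image (z, b), and matrix coefficients of
   invariant vectors are constant. *)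
Lemma common_elements_constant (b : 'rV[L]_r) (z : 'rV[K]_r') :
  map_mx alpha (map_mx (in_alg A) z *m a) = map_mx tl (map_mx (in_alg H) b *m h) ->
  exists c : 'M[L]_1, map_mx (in_alg H) b *m h = map_mx (in_alg H) c.
Proof.
move=> zb.
have zgamma : map_mx KC z *m gamma = map_mx LC b.
  apply/eqP; rewrite -subr_eq0; apply/eqP/ind_h.
  rewrite map_mxB mulmxBl map_mxM -mulmxA -aT_gamma.
  apply/eqP; rewrite subr_eq0; apply/eqP; move: zb; rewrite !map_mxM.
  rewrite (_ : map_mx alpha (map_mx _ z) = map_mx tr (map_mx KC z)); last first.
    by apply/matrixP=> i q; rewrite !mxE; apply: alphac.
  rewrite (_ : map_mx tl (map_mx _ b) = map_mx tr (map_mx LC b)) //.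
  by apply/matrixP=> i q; rewrite !mxE; apply: tensl_alg.
(* [cK] and [cL] read the coordinate relative to 1 in the two spaces of the unit object. *)
have [|cK cKE] := @form_col K K idfun K^o (fun x => x); first by [].
have [|cL cLE] := @form_col L L idfun L^o (fun x => x); first by [].
have sextK (x : K^o) : sext KC x *m map_mx KC cK = (KC x)%:M.
  have := congr1 (map_mx KC) (cKE x); rewrite map_mxM map_scalar_mx => <-.
  by congr (_ *m _); apply/esym/map_mx_comp_eq.
have sextL (B : comNzRingType) (s : {rmorphism L -> B}) :
    sext s (1 : L^o) *m map_mx s cL = 1%:M.
  have := congr1 (map_mx s) (cLE 1); rewrite map_mxM map_scalar_mx rmorph1 => <-.
  by congr (_ *m _); apply/esym/map_mx_comp_eq.
have [|t [_ tB]] := @hom_of_mx R L iota (dRB_unit iota) Q (cK *m z) (cL *m b).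
  apply: (@sext_ext _ _ KC) => x; rewrite map_mxM !mulmxA sextK.
  rewrite -[cmp (dRB_unit iota)]/(unit_cmp iota) sext_liftE => [|c u v].
    by rewrite mul_scalar_mx -!scalemxAl zgamma map_mxM mulmxA sextL mul1mx.
  by rewrite rmorphD rmorphM scalerDl scalerA.
have gP := universal_is_pt UH.
have tB' : f2mx (hom_B t) = cL *m b by rewrite tB.
(* Naturality along the morphism [t] from the unit: the vector [b] is invariant under the group. *)
have bg : map_mx (in_alg H) b *m g PQ = map_mx (in_alg H) b.
  have := congr1 (fun Z => sext (in_alg H) (1 : L^o) *m Z)
    (pt_natural gP (subcat_unit P) PQ t).
  rewrite !mulmxA [X in _ = X *m _](pt_unit gP) !sext_hom_mx -[fhom _ t]/(hom_B t)
    tB'.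
  rewrite !map_mxM !mulmxA !sextL !mul1mx => ->.
  by apply/matrixP=> i q; rewrite !mxE.
have [eps [epsc epsg]] := universal_morphism UH (id_ptP P).
pose e := map_mx eps h.
have Xe l : X l *m e = col l 1%:M.
  rewrite -(epsg _ PM) -map_col gX map_mxM (map_mx_comp_eq (h := idfun)) //.
  by congr (_ *m _); apply/matrixP=> i q; rewrite !mxE.
(* The counit axiom: [Q] carries the regular action on V, and a function is recovered from its
   translates by evaluating them at the identity [eps]. *)
have kappa : h = g PQ *m map_mx (in_alg H) e.
  have [q qE] : exists q : 'I_n -> dRB_hom iota M Q, forall l,
      hom_B (q l) = Hom (X l : 'M_(_, dim (B Q))).
    have /choice[q qE] : forall l, exists f : dRB_hom iota M Q,
      hom_B f = Hom (X l : 'M_(_, dim (B Q))).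
      move=> l; have [f [_ fE]] := @hom_of_mx R L iota M Q (X' l) (X l) (compat l).
      by exists f.
    by exists q.
  have nat l : map_mx (in_alg H) (X l) *m g PQ = g PM *m map_mx (in_alg H) (X l).
    by have := pt_natural gP PM PQ (q l); rewrite !sext_hom_mx [fhom _ _]qE qE.
  rewrite {1}hY -[RHS]mul1mx -(map_mx1 (in_alg H)) -YX map_mx_sum mulmx_suml.
  apply: eq_bigr => l _; rewrite map_mxM -mulmxA; congr (_ *m _).
  by rewrite mulmxA nat -mulmxA -map_mxM Xe map_col map_mx1 !colE mul1mx.
by exists (b *m e); rewrite map_mxM {1}kappa mulmxA bg.
Qed.

Definition coef_span (z : 'rV[C]_r) : T := tens_comb (fun q => h q 0) LC (z 0).

Lemma coef_span_mx z : (coef_span z)%:M = map_mx tr z *m hT.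
Proof.
apply/matrixP=> i l; rewrite !ord1 !mxE mulr1n; apply: eq_bigr => q _.
by rewrite !mxE mulrC.
Qed.

Lemma idempotent_constant z : coef_span z * coef_span z = coef_span z ->
  coef_span z = 0 \/ coef_span z = 1.
Proof.
move=> xx.
have [kappa kappaE] := idempotent_comb_descent (s := LC) (j := KC) (j0 := iota)
  (@Qbar_alg_closed R)
  (fun=> erefl) hind xx.
have KC_inj : kills_kernel KC (idfun : {rmorphism K -> K}).
  by move=> c /eqP; rewrite fmorph_eq0 => /eqP.
have : idempotent_comb (fun q => h q 0) iota kappa.
  apply: (@idempotent_comb_map _ _ _ _ _ _ LC iota K iota KC idfun kappa) => //.
  by rewrite -(funext kappaE).
move=> /(idempotent_comb_span (@Qbar_alg_closed R) (natr_neq0 iota)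
  (Qbar_algebraic iota)).
move=> [p [s [b [c [Z [y [kE bE yidem]]]]]]].
have alphaE q (Z1 : 'M[K]_(q, r')) :
    map_mx alpha (map_mx (in_alg A) Z1 *m a) = map_mx tr (map_mx KC Z1) *m aT.
  rewrite map_mxM; congr (_ *m _); apply/matrixP=> i l; rewrite !mxE; exact: alphac.
have tlE q (Z1 : 'M[L]_(q, r)) :
    map_mx tl (map_mx (in_alg H) Z1 *m h) = map_mx tr (map_mx LC Z1) *m hT.
  rewrite map_mxM; congr (_ *m _); apply/matrixP=> i l; rewrite !mxE;
    exact: tensl_alg.
(* Each spanning idempotent is moved by [tau] to [A] (x) C, where the descent applies with base
   [Qbar] and basis [a]; this puts it in the image of [A]. *)
have /choice[zz zzE] : forall l, exists zz : 'rV[K]_r',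
    map_mx alpha (map_mx (in_alg A) zz *m a) = map_mx tr (map_mx KC (row l y)) *m hT.
  move=> l; pose v := map_mx KC (row l y).
  have vv : coef_span v * coef_span v = coef_span v.
    have -> : coef_span v = tens_comb (fun q => h q 0) LC (KC \o y l).
      by congr (tens_comb _ _ _); apply/funext=> q; rewrite !mxE.
    apply: (@idempotent_comb_map _ _ _ _ _ _ iota LC K iota idfun KC (y l)) => //.
      by move=> c0 /= ->; apply: rmorph0.
    exact: yidem.
  pose v' := tens_comb (fun q => a q 0) KC ((v *m gamma') 0).
  have vE : tau (coef_span v) = v'.
    apply: scalar_mx11_inj; rewrite -map_scalar_mx coef_span_mx hT_gamma' mulmxA
      -map_mxM.
    rewrite map_mxM (map_mx_comp_eq (h := tensr KC A)) //.
    rewrite /aT (map_mx_comp_eq (h := tensl KC A)) //.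
    apply/matrixP=> i i'; rewrite !ord1 !mxE mulr1n; apply: eq_bigr => q _.
    by rewrite !mxE mulrC.
  have v'v' : v' * v' = v' by rewrite -vE -rmorphM vv.
  have [kap' kapE] := idempotent_comb_descent (s := KC) (j := KC) (j0 := idfun)
    (@Qbar_alg_closed R) (fun=> erefl) aind v'v'.
  exists (\row_q kap' q); rewrite alphaE.
  have -> : map_mx KC (\row_q kap' q) = v *m gamma'.
    by apply/rowP=> q; rewrite kapE !mxE.
  by rewrite map_mxM -mulmxA -hT_gamma'.
pose ZZ := \matrix_l zz l.
have yE : map_mx tr (map_mx KC y) *m hT = map_mx alpha (map_mx (in_alg A) ZZ *m a).
  apply/row_matrixP => l; rewrite row_mul -!map_row -zzE.
  by rewrite row_mul -!map_row rowK.
(* A row of [b] has coordinates in [L] in the basis [h] and, being a [Qbar]-combination of the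
   idempotents [y], coordinates in [Qbar] in the basis [a]. *)
have /choice[ct ctE] : forall t, exists c0 : 'M[L]_1,
    map_mx (in_alg H) (row t b) *m h = map_mx (in_alg H) c0.
  move=> t; apply: (@common_elements_constant _ (row t Z *m ZZ)).
  rewrite tlE (_ : map_mx LC (row t b) = map_mx KC (row t Z) *m map_mx KC y);
    last first.
    by rewrite -map_mxM -row_mul -bE map_row; apply/rowP=> q; rewrite !mxE.
  rewrite (map_mxM tr) -mulmxA yE (map_mxM (in_alg A)) -mulmxA (map_mxM alpha).
  congr (_ *m _).
  by apply/matrixP=> i q; rewrite !mxE; apply: alphac.
pose zeta : C := (map_mx KC c *m map_mx LC (\matrix_t ct t)) 0 0.
have xE : coef_span z = tr zeta.
  apply: scalar_mx11_inj; rewrite coef_span_mx.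
  have -> : z = map_mx KC c *m map_mx LC b.
    apply/rowP=> q; have := congr1 (map_mx KC) kE; rewrite map_mxM.
    by rewrite (map_mx_comp_eq (h := LC)) // => /rowP/(_ q); rewrite !mxE => <-;
      apply: kappaE.
  rewrite map_mxM -mulmxA.
  have -> : map_mx tr (map_mx LC b) *m hT = map_mx tr (map_mx LC (\matrix_t ct t)).
    rewrite -tlE; apply/row_matrixP => t.
    rewrite -map_row row_mul -map_row ctE -!map_row rowK.
    by apply/matrixP=> i q; rewrite !mxE; apply: tensl_alg.
  by rewrite -map_mxM [X in map_mx tr X]mx11_scalar map_scalar_mx.
have : zeta * zeta = zeta.
  by apply: (fmorph_inj tr); rewrite rmorphM -xE.
move=> /eqP; rewrite -subr_eq0 -{3}[zeta]mulr1 -mulrBr mulf_eq0 subr_eq0.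
by rewrite xE => /orP[]/eqP ->; [left|right]; rewrite ?rmorph0 ?rmorph1.
Qed.

Lemma coef_H (Z : 'M[L]_n) :
  exists z, tl (\tr (map_mx (in_alg H) Z *m g PM)) = coef_span z.
Proof.
exists (\sum_l map_mx LC (row l Z *m X l)); apply: scalar_mx11_inj.
rewrite coef_span_mx -map_scalar_mx trace_row_col !map_mx_sum mulmx_suml.
apply: eq_bigr => l _; rewrite -map_row (map_mxM tl) map_col gT mulmxA;
  congr (_ *m _).
rewrite !map_mxM; congr (_ *m _).
by apply/matrixP=> i q; rewrite !mxE; apply: tensl_alg.
Qed.

Lemma coef_A (Z : 'M[K]_(n, m)) :
  exists z, alpha (\tr (map_mx (in_alg A) Z *m w PM)) = coef_span z.
Proof.
exists (\sum_l map_mx KC (row l Z *m X' l) *m gamma); apply: scalar_mx11_inj.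
rewrite coef_span_mx -map_scalar_mx trace_row_col !map_mx_sum mulmx_suml.
apply: eq_bigr => l _; rewrite -map_row (map_mxM alpha) map_col wT aT_gamma.
rewrite (map_mx_mul3 KC tr) (_ : map_mx alpha _ = map_mx tr (map_mx KC (row l Z))) //.
by apply/matrixP=> i q; rewrite !mxE; apply: alphac.
Qed.

End Constancy.

Section Idempotents.
Variables (R : realType) (L : fieldType) (iota : {rmorphism L -> Qbar R}).
Variables (P : tensor_subcat iota) (PT : tannakian P).
Variables (A : comAlgType (Qbar R)) (w : pt_family (omega_dR iota) P A).
Variables (H : comAlgType L) (g : pt_family (omega_B iota) P H).
Hypotheses (UA : universal_point iota w) (UH : universal_point idfun g).

(** Both rings embed in [T]: [H] by [tl], and [A] by [alpha], whose composite with [tau] is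
    injective. *)
Lemma no_idempotents :
  (forall e : H, e * e = e -> e = 0 \/ e = 1) /\
  (forall e : A, e * e = e -> e = 0 \/ e = 1).
Proof.
have [alpha [tau [alphaw alphac taualpha taur]]] := comparison_maps UA UH.
split=> e ee.
  have [M [PM [Z eE]]] := universal_span UH e.
  have [r [h [X [Y [hind gX hY]]]]] := span_basis_mx (g PM).
  have [r' [a [X' [Y' [aind wX aY]]]]] := span_basis_mx (w PM).
  have [z zE] := coef_H gX Z.
  have := idempotent_constant PT UH alphaw alphac taualpha taur
    hind gX hY aind wX aY (z := z).
  rewrite -zE -eE -rmorphM ee => /(_ erefl)[e0|e1]; [left|right];
    apply: (@tensl_inj _ _ (LC iota)).
    by rewrite e0 rmorph0.
  by rewrite e1 rmorph1.
have [M [PM [Z eE]]] := universal_span UA e.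
have [r [h [X [Y [hind gX hY]]]]] := span_basis_mx (g PM).
have [r' [a [X' [Y' [aind wX aY]]]]] := span_basis_mx (w PM).
have [z zE] := coef_A alphaw alphac gX wX aY Z.
have := idempotent_constant PT UH alphaw alphac taualpha taur
  hind gX hY aind wX aY (z := z).
rewrite -zE -eE -rmorphM ee => /(_ erefl)[e0|e1]; [left|right];
  apply: (@tensl_inj _ _ (QbarC R)); rewrite -taualpha.
  by rewrite e0 !rmorph0.
by rewrite e1 !rmorph1.
Qed.

End Idempotents.

Lemma tannakian_connected (R : realType) (L : fieldType)
  (iota : {rmorphism L -> Qbar R})
    (P : tensor_subcat iota) : tannakian P ->
  connected_affine (tensor_iso_functor P (omega_B iota) (omega_B iota)) /\
  connected_affine (tensor_iso_functor P (omega_dR iota)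
    (base_change iota (omega_B iota))).
Proof.
move=> PT.
have [A [w UA]] := universal_point_exists (omega_dR_fiber iota) PT
  (ex_intro _ _ (ex_intro _ _ (ex_intro _ _ (cmp_ptP P)))).
have [H [g UH]] := universal_point_exists (omega_B_fiber iota) PT
  (ex_intro _ _ (ex_intro _ _ (ex_intro _ _ (id_ptP P)))).
have [idH idA] := no_idempotents PT UA UH.
split.
  apply: (G_represented PT UH); exact: connected_specP.
apply: (Omega_represented PT UA); exact: connected_specP.
Qed.

Theorem theorem2p6 (R : realType) (L : fieldType)
    (iota : {rmorphism L -> Qbar R}) :
  (connected_affine (G_dRB iota) /\ connected_affine (Omega_dRB iota)) /\
  (forall M : dRB R L,
     connected_affine (G_dRB_of iota M) /\
     connected_affine (Omega_dRB_of iota M)).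
Proof.
split=> [|M]; first exact/tannakian_connected/whole_tannakian.
exact/tannakian_connected/generated_tannakian.
Qed.
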